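(* Let $\{B(t)\}_{t\ge0}$ be the standard linear Brownian motion on a probability space $(\Omega,\mathcal F,\mathbb P)$, let $T_2>T_1>0$ be reals and $\boldsymbol{\mathcal T}=(T_1,T_2)$. Let $\delta:\mathbb N\to(0,1/4)$ be a map such that $\limsup_{Q\to\infty}\delta(Q)<\frac14$. Then the following dichotomy holds: (1) If $\delta(Q)\cdot Q^5\to\infty$ as $Q\to\infty$, then the ratio of $\mathcal N^{\flat}(\boldsymbol{\mathcal T};(\delta,Q))$ to $$\frac{4}{3\sqrt\pi}\,(T_2-T_1)\,\sqrt{\delta(Q)\,Q^5}$$ tends to $1$ in probability as $Q\to\infty$; in particular $\mathcal N^{\flat}(\boldsymbol{\mathcal T};(\delta,Q))\to\infty$ in probability as $Q\to\infty$. (2) If $\delta(Q)\cdot Q^5\to0$ as $Q\to\infty$, then $$\mathbb P\left(\mathcal N^{\flat}(\boldsymbol{\mathcal T};(\delta,Q))\ge1\right)\ll(T_2-T_1)\,\sqrt{\delta(Q)\,Q^5};$$ in particular $\mathcal N^{\flat}(\boldsymbol{\mathcal T};(\delta,Q))\to0$ in probability as $Q\to\infty$.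
   Context: Let $\mathcal G(\boldsymbol{\mathcal T})=\{(t,B(t)):T_1\le t\le T_2\}$ and, for $\boldsymbol y=(y_1,y_2)\in\mathbb R^2$, let $\mathrm{dist}(\boldsymbol y,\mathcal G(\boldsymbol{\mathcal T}))=\inf_{T_1\le t\le T_2}\max\{|t-y_1|,|B(t)-y_2|\}$. With $\xi_Q^{(\delta)}(q)=2\delta(Q)\min\{q/Q,1\}$, define $$\mathcal N^{\flat}(\boldsymbol{\mathcal T};(\delta,Q))=\sharp\left\{(p,q,r)\in\mathbb Z^3:\ 1\le q\le Q,\ \ \mathrm{dist}\left(\left(\tfrac pq,\tfrac rq\right),\mathcal G(\boldsymbol{\mathcal T})\right)\le\frac{\xi_Q^{(\delta)}(q)}{2q}\right\},$$ where $\xi_Q^{(\delta)}(q)/(2q)=\delta(Q)/Q$ for $1\le q\le Q$. The notation $x\ll y$ means $x\le c\,y$ for some constant $c>0$ independent of $Q$. *)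

(* Defs.v *)
From HB Require Import structures.
From mathcomp Require Import all_boot all_order all_algebra.
From mathcomp Require Import all_classical all_reals all_analysis.
Set Implicit Arguments.
Unset Strict Implicit.
Unset Printing Implicit Defensive.
Import Order.TTheory GRing.Theory Num.Theory.
Import numFieldNormedType.Exports.
Local Open Scope classical_set_scope.
Local Open Scope ring_scope.

Section brownian_motion.
Context {R : realType} {d : measure_display} {Omega : measurableType d}.
Variable P : probability Omega R.

(* Product rule over the whole family; taking some of the [A i] to be [setT]
   yields the product rule over every subfamily. *)
Definition mutually_independent (n : nat) (X : 'I_n -> Omega -> R) : Prop :=
  forall A : 'I_n -> set R, (forall i, measurable (A i)) ->
    P (\bigcap_(i in [set: 'I_n]) (X i @^-1` A i)) =
    (\prod_(i < n) P (X i @^-1` A i))%E.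

(* The process is only constrained at times [0 <= t]; its values at negative
   times are irrelevant.  The second parameter of [normal_prob] is the standard
   deviation. *)
Record standard_brownian_motion (B : R -> {RV P >-> R}) : Prop := {
  bm_start : {ae P, forall w, B 0 w = 0} ;
  bm_indep_increments : forall (n : nat) (t : nat -> R),
    0 <= t 0%N -> nondecreasing_seq t ->
    mutually_independent (fun (i : 'I_n) w => B (t i.+1) w - B (t i) w) ;
  bm_gaussian_increments : forall s t : R, 0 <= s -> s < t ->
    forall A : set R, measurable A ->
      P ((fun w => B t w - B s w) @^-1` A) = normal_prob 0 (Num.sqrt (t - s)) A ;
  bm_continuous :
    {ae P, forall w, {within `[0, +oo[, continuous (fun t => B t w)}} }.

End brownian_motion.

Section convergence_in_probability.
Context {R : realType} {d : measure_display} {Omega : measurableType d}.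
Variable P : probability Omega R.

(* Since paths are continuous only almost surely and [P] is not assumed to be
   complete, functionals of a path are measurable only for the completion of
   [P].  Probabilities of such events are therefore taken with the outer
   measure [mu_ext P], which equals [P] on measurable sets and the completion
   of [P] on the completed sigma-algebra. *)

Lemma mu_ext_measurable (A : set Omega) : measurable A -> mu_ext P A = P A.
Proof. by move=> mA; rewrite measurable_mu_extE. Qed.

Definition cvg_in_prob (X : nat -> Omega -> \bar R) (l : R) : Prop :=
  forall e : R, 0 < e ->
    (fun n => mu_ext P [set w | (e%:E < `|X n w - l%:E|)%E]) @ \oo --> 0%E.

Definition cvg_in_prob_pinfty (X : nat -> Omega -> \bar R) : Prop :=
  forall M : R,
    (fun n => mu_ext P [set w | (X n w <= M%:E)%E]) @ \oo --> 0%E.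

End convergence_in_probability.

Section rational_points.
Context {R : realType}.

Definition dist_graph (f : R -> R) (T1 T2 : R) (y : R * R) : R :=
  inf [set Num.max `|t - y.1| `|f t - y.2| | t in `[T1, T2]].

Definition xi (delta : nat -> R) (Q : nat) (q : R) : R :=
  2 * delta Q * Num.min (q / Q%:R) 1.

Definition near_points (f : R -> R) (T1 T2 : R) (delta : nat -> R) (Q : nat) :
    set (int * int * int) :=
  [set x | let: (p, q, r) := x in
    1 <= q <= Q%:Z /\
    dist_graph f T1 T2 (p%:~R / q%:~R, r%:~R / q%:~R)
      <= xi delta Q q%:~R / (2 * q%:~R)].

(* [+oo] when the set is infinite, which does not happen for a path that is
   continuous on [T1, T2]. *)
Definition count_near (f : R -> R) (T1 T2 : R) (delta : nat -> R) (Q : nat) :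
    \bar R :=
  counting (near_points f T1 T2 delta Q).

End rational_points.

(* Main.v *)
Require Import Defs.
From HB Require Import structures.
From mathcomp Require Import all_boot all_order all_algebra finmap.
From mathcomp Require Import all_classical all_reals all_analysis.
From mathcomp Require Import measurable_realfun.
From mathcomp Require Import ring lra zify.
Set Implicit Arguments.
Unset Strict Implicit.
Unset Printing Implicit Defensive.
Import Order.TTheory GRing.Theory Num.Theory.
Import numFieldNormedType.Exports.
Local Open Scope classical_set_scope.
Local Open Scope ring_scope.

(** Put eta = delta(Q) / Q.  A fraction p/q contributes to the count the number
    of r such that r/q lies within eta of the range of B over the window
    [p/q - eta, p/q + eta].  The starting value of the window is Gaussian and
    independent of the increments inside it, and a Gaussian lattice sum
    equals q up to the peak of the density; so this number has mean
    q * E[range] * (1 + O(1/q)), where E[range] = 4 / sqrt (2 pi) * sqrt (2 eta)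
    by Spitzer's identity for the random walk sampled on a fine grid.
    Summation over q and p yields the main term, and Markov's inequality the
    second alternative.

    In the first alternative the count is squeezed between two measurable
    counts.  The upper one uses a slightly larger eta and Fatou's lemma along
    finer and finer grids.  The lower one is a sampled count over the fractions
    whose reduced denominator exceeds eps * Q.  Its second moment is almost the
    square of its mean: for windows that are far apart, the Gaussian increment
    over the gap decouples the two counts up to a factor
    1 + O(1 / (q * sqrt gap)); close or equal fractions are few.  Chebyshev's
    inequality applies to the lower count and Markov's inequality to the
    difference of the two counts. *)

(** * Independence of vectors of random variables *)

(** Write T = T2 - T1. For each q about q T values of p are admissible, so the main term is the sum
    over q of T q^2 E[range], that is T Q^3 / 3 times 4 / sqrt(2 pi) times sqrt(2 eta), which equals
    4 / (3 sqrt pi) T sqrt(delta(Q) Q^5). Spitzer's identity gives the expected extremes of a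
    sampled path from its one-time marginals alone, so no law of a continuous-time maximum is
    needed. As T1 > 0, every window starts at a time bounded below; the Gaussian peaks are then at
    most 1 / sqrt T1 and the lattice error is uniform. The obstacle is the second moment: p/q and
    kp/(kq) share one window, so their counts are strongly dependent. A fraction of reduced
    denominator b has at most Q / b representations; discarding b <= eps Q costs a relative error
    O(eps) and leaves at most 1 / eps representations of each fraction. The diagonal then
    contributes, relative to the squared mean, terms of order 1 / (eps Q^3 sqrt eta) and 1 / (eps
    Q^2); the first tends to 0 exactly because delta(Q) Q^5 tends to infinity. *)

Lemma prod_reindex_inj (R : realType) (m n : nat) (f : 'I_m -> 'I_n) (F : 'I_n -> \bar R) :
  injective f -> (forall j, (forall i, f i != j) -> F j = 1%E) ->
  (\prod_(j < n) F j = \prod_(i < m) F (f i))%E.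
Proof.
move=> finj F1.
rewrite (bigID (fun j => j \in codom f)) /= [X in (_ * X)%E]big1; last first.
  move=> j jf; apply: F1 => i; apply: contra jf => /eqP <-; exact: codom_f.
rewrite mule1 -big_enum /=.
transitivity (\prod_(i <- [seq f i | i <- enum 'I_m]) F i)%E; last by rewrite big_map big_enum.
apply: perm_big; apply: uniq_perm; first exact: enum_uniq.
  by rewrite map_inj_uniq // enum_uniq.
by move=> j; rewrite mem_enum.
Qed.

Section independence.
Context {R : realType} {d : measure_display} {Omega : measurableType d}.
Variable P : probability Omega R.

Lemma mutually_independent_reindex (m n : nat) (X : 'I_n -> Omega -> R) (f : 'I_m -> 'I_n) :
  injective f -> mutually_independent P X ->
  mutually_independent P (fun i => X (f i)).
Proof.
move=> finj indX A mA.
(* Coordinates outside the range of [f] receive [setT]: they contribute a factor 1 and no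
   constraint, so the full product rule restricts to the subfamily. *)
pose A' j := if [pick i | f i == j] is Some i then A i else setT.
have A'f i : A' (f i) = A i.
  rewrite /A'; case: pickP => [k /eqP /finj -> //|/(_ i)]; by rewrite eqxx.
have A'T j : (forall i, f i != j) -> A' j = setT.
  by move=> fj; rewrite /A'; case: pickP => // i /eqP fij; have := fj i; rewrite fij eqxx.
have mA' j : measurable (A' j) by rewrite /A'; case: pickP.
have := indX A' mA'; rewrite (@prod_reindex_inj _ _ _ f) //; last first.
  by move=> j /A'T ->; rewrite preimage_setT probability_setT.
under [X in _ = X -> _]eq_bigr do rewrite A'f.
move=> <-; congr (P _); apply/seteqP; split => w /= H.
  move=> j _; rewrite /= /A'; case: pickP => [i /eqP <-|//]; exact: H.
by move=> i _; have := H (f i) I; rewrite /= A'f.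
Qed.

Definition tuple_rv (n : nat) (X : 'I_n -> Omega -> R) (w : Omega) : n.-tuple R :=
  [tuple X i w | i < n].

Lemma measurable_tuple_rv (n : nat) (X : 'I_n -> Omega -> R) :
  (forall i, measurable_fun setT (X i)) -> measurable_fun setT (tuple_rv X).
Proof.
move=> mX; apply/measurable_fun_tnthP => i.
rewrite (_ : _ \o _ = X i) //; apply/funext => w /=; by rewrite tnth_mktuple.
Qed.

(** A pi-system generating the product sigma-algebra: finite measures that agree on it are equal,
    which is how laws of tuples are identified below. *)
Definition boxes (n : nat) : set (set (n.-tuple R)) :=
  [set B | exists A : 'I_n -> set R, (forall i, measurable (A i)) /\
     B = \bigcap_(i in [set: 'I_n]) ((@tnth n R ^~ i) @^-1` A i)].

Lemma measurable_boxes n : @measurable _ (n.-tuple R) = <<s @boxes n >>.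
Proof.
apply/seteqP; split; last first.
  apply: smallest_sub; first exact: sigma_algebra_measurable.
  move=> _ [A [mA ->]]; rewrite -[X in measurable X]setCK setC_bigcap.
  apply: measurableC; apply: fin_bigcup_measurable; first exact: finite_finset.
  move=> i _; apply: measurableC; rewrite -[X in measurable X]setTI.
  exact: measurable_tnth.
rewrite {1}/measurable /=; apply: smallest_sub; first exact: smallest_sigma_algebra.
(* For [n = 0] the generators form an empty union; the reindexing by [inord] needs a nonempty
   ordinal type. *)
case: n => [|n]; first by rewrite big_ord0.
rewrite -bigcup_mkord_ord; apply: bigcup_sub => i Ii _ [B mB <-].
apply: sub_sigma_algebra; exists (fun j => if j == inord i then B else setT); split.
  by move=> j; case: ifP.
apply/seteqP; split => x /=.
  by move=> [_ xB] j _ /=; case: ifP => // /eqP ->.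
by move=> /(_ (inord i) I) /=; rewrite eqxx.
Qed.

Lemma boxes_setI_closed n : setI_closed (@boxes n).
Proof.
move=> _ _ [A [mA ->]] [B [mB ->]]; exists (fun i => A i `&` B i); split.
  by move=> i; exact: measurableI.
rewrite -bigcapI; apply: eq_bigcapr => i _; by rewrite preimage_setI.
Qed.

Lemma boxes_setT n : @boxes n setT.
Proof.
exists (fun _ => setT); split => //; apply/esym/seteqP; split => // x _ i _ //.
Qed.

Lemma tuple_rv_boxE n (X : 'I_n -> Omega -> R) (A : 'I_n -> set R) :
  tuple_rv X @^-1` (\bigcap_(i in [set: 'I_n]) ((@tnth n R ^~ i) @^-1` A i)) =
  \bigcap_(i in [set: 'I_n]) (X i @^-1` A i).
Proof.
rewrite preimage_bigcap; apply: eq_bigcapr => i _; apply/seteqP; split => w /=;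
  by rewrite tnth_mktuple.
Qed.

Lemma tuple_law_unique n (X Y : 'I_n -> Omega -> R) :
  (forall i, measurable_fun setT (X i)) -> (forall i, measurable_fun setT (Y i)) ->
  mutually_independent P X -> mutually_independent P Y ->
  (forall i A, measurable A -> P (X i @^-1` A) = P (Y i @^-1` A)) ->
  forall A, measurable A -> P (tuple_rv X @^-1` A) = P (tuple_rv Y @^-1` A).
Proof.
move=> mX mY iX iY XY A mA.
have mtX := measurable_tuple_rv mX; have mtY := measurable_tuple_rv mY.
pose mtXm := isMeasurableFun.Build _ _ _ _ _ mtX.
pose mtYm := isMeasurableFun.Build _ _ _ _ _ mtY.
pose tX : {mfun Omega >-> n.-tuple R} := HB.pack (tuple_rv X) mtXm.
pose tY : {mfun Omega >-> n.-tuple R} := HB.pack (tuple_rv Y) mtYm.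
apply: (measure_unique (@boxes n) (fun _ => setT) _ _ _ _ (distribution P tX) (distribution P tY)) => //.
- exact: measurable_boxes.
- exact: boxes_setI_closed.
- by move=> _; exact: boxes_setT.
- by rewrite bigcup_const.
- move=> _ [B [mB ->]]; set C := \bigcap_(_ in _) _.
  change (P (tuple_rv X @^-1` C) = P (tuple_rv Y @^-1` C)).
  rewrite !tuple_rv_boxE iX // iY //.
  by apply: eq_bigr => i _; exact: XY.
- by move=> _; rewrite /= probability_setT ltry.
Qed.

Definition indep_rv d1 d2 (T1 : measurableType d1) (T2 : measurableType d2)
    (V : Omega -> T1) (W : Omega -> T2) :=
  forall A B, measurable A -> measurable B ->
    P (V @^-1` A `&` W @^-1` B) = (P (V @^-1` A) * P (W @^-1` B))%E.

(** For fixed [E] both sides are finite measures in [A]: the law of the tuple under [P] restricted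
    to [E], and its law under [P] scaled by [P E]. They agree on boxes. *)
Lemma indep_event_tuple n (X : 'I_n -> Omega -> R) (E : set Omega) :
  (forall i, measurable_fun setT (X i)) -> measurable E ->
  (forall A : 'I_n -> set R, (forall i, measurable (A i)) ->
     P (\bigcap_(i in [set: 'I_n]) (X i @^-1` A i) `&` E) =
     (P (\bigcap_(i in [set: 'I_n]) (X i @^-1` A i)) * P E)%E) ->
  forall A, measurable A -> P (tuple_rv X @^-1` A `&` E) = (P (tuple_rv X @^-1` A) * P E)%E.
Proof.
move=> mX mE H A mA.
have mtX := measurable_tuple_rv mX.
pose mtXm := isMeasurableFun.Build _ _ _ _ _ mtX.
pose tX : {mfun Omega >-> n.-tuple R} := HB.pack (tuple_rv X) mtXm.
have PEn : 0 <= fine (P E) by rewrite fine_ge0.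
pose m1 : {measure set (n.-tuple R) -> \bar R} :=
  measure_function_pushforward__canonical__measure_function_Measure (mrestr P mE) mtX.
pose m2 := mscale (NngNum PEn) (distribution P tX).
have m2E B : m2 B = (P (tuple_rv X @^-1` B) * P E)%E.
  by rewrite /m2 /mscale /= fineK ?fin_num_measure // muleC.
rewrite -m2E; change (m1 A = m2 A).
apply: (measure_unique (@boxes n) (fun _ => setT) _ _ _ _ m1 m2) => //.
- exact: measurable_boxes.
- exact: boxes_setI_closed.
- by move=> _; exact: boxes_setT.
- by rewrite bigcup_const.
- move=> _ [B [mB ->]]; set C := \bigcap_(_ in _) _.
  rewrite [RHS]m2E; change (P (tuple_rv X @^-1` C `&` E) = (P (tuple_rv X @^-1` C) * P E)%E).
  rewrite !tuple_rv_boxE.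
  exact: H.
- by move=> _; rewrite /m1 /pushforward /= /mrestr (le_lt_trans (probability_le1 _ _)) ?ltry // preimage_setT setTI.
Qed.

Lemma indep_tuple_split m k (X : 'I_m -> Omega -> R) (Y : 'I_k -> Omega -> R) :
  (forall i, measurable_fun setT (X i)) -> (forall i, measurable_fun setT (Y i)) ->
  mutually_independent P (fun i => match fintype.split i with inl a => X a | inr b => Y b end) ->
  indep_rv (tuple_rv X) (tuple_rv Y).
Proof.
move=> mX mY iXY.
have key (A : 'I_m -> set R) (B : 'I_k -> set R) :
    (forall i, measurable (A i)) -> (forall i, measurable (B i)) ->
    P (\bigcap_(i in [set: 'I_m]) (X i @^-1` A i) `&`
       \bigcap_(i in [set: 'I_k]) (Y i @^-1` B i)) =
    (\prod_(i < m) P (X i @^-1` A i) * \prod_(i < k) P (Y i @^-1` B i))%E.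
  move=> mA mB.
  have := iXY (fun i => match fintype.split i with inl a => A a | inr b => B b end).
  rewrite big_split_ord /=.
  under eq_bigr do rewrite (unsplitK (inl _)).
  under [X in (_ * X)%E]eq_bigr do rewrite (unsplitK (inr _)).
  move=> <-; last by move=> i; case: (fintype.split i).
  congr (P _); apply/seteqP; split => w /=.
    by move=> [HA HB] i _ /=; case: (fintype.split i) => j; [exact: HA|exact: HB].
  move=> H; split => i _ /=.
    by have := H (lshift k i) I; rewrite /= (unsplitK (inl _)).
  by have := H (rshift m i) I; rewrite /= (unsplitK (inr _)).
have keyX (A : 'I_m -> set R) : (forall i, measurable (A i)) ->
    P (\bigcap_(i in [set: 'I_m]) (X i @^-1` A i)) = (\prod_(i < m) P (X i @^-1` A i))%E.
  move=> mA; have := key A (fun _ => setT) mA (fun _ => measurableT).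
  rewrite [X in (_ * X)%E]big1; last by move=> i _; rewrite preimage_setT probability_setT.
  by rewrite mule1 => <-; congr (P _); apply/seteqP; split=> w //= -[].
have keyY (B : 'I_k -> set R) : (forall i, measurable (B i)) ->
    P (\bigcap_(i in [set: 'I_k]) (Y i @^-1` B i)) = (\prod_(i < k) P (Y i @^-1` B i))%E.
  move=> mB; have := key (fun _ => setT) B (fun _ => measurableT) mB.
  rewrite [X in (X * _)%E]big1; last by move=> i _; rewrite preimage_setT probability_setT.
  by rewrite mul1e => <-; congr (P _); apply/seteqP; split=> w //= -[].
have mbigcap l (Z : 'I_l -> Omega -> R) (B : 'I_l -> set R) :
    (forall i, measurable_fun setT (Z i)) -> (forall i, measurable (B i)) ->
    measurable (\bigcap_(i in [set: 'I_l]) (Z i @^-1` B i)).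
  move=> mZ mB; rewrite -[X in measurable X]setCK setC_bigcap.
  apply: measurableC; apply: fin_bigcup_measurable; first exact: finite_finset.
  by move=> i _; apply: measurableC; rewrite -[X in measurable X]setTI; exact: mZ.
(* Boxes are upgraded to measurable sets one vector at a time: first with the event on [Y] held
   fixed, then, for each box [A'], with the box event on [X] held fixed. *)
move=> A B mA mB; apply: indep_event_tuple => //.
  by rewrite -[X in measurable X]setTI; exact: measurable_tuple_rv.
move=> A' mA'; rewrite setIC muleC.
apply: indep_event_tuple => //; first exact: mbigcap.
by move=> B' mB'; rewrite setIC key // keyX // keyY // muleC.
Qed.

Lemma indep_rv_comp d1 d2 d3 d4 (T1 : measurableType d1) (T2 : measurableType d2)
    (T3 : measurableType d3) (T4 : measurableType d4)
    (V : Omega -> T1) (W : Omega -> T2) (f : T1 -> T3) (g : T2 -> T4) :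
  measurable_fun setT f -> measurable_fun setT g ->
  indep_rv V W -> indep_rv (f \o V) (g \o W).
Proof.
move=> mf mg i A B mA mB; apply: (i (f @^-1` A) (g @^-1` B)).
  by rewrite -[X in measurable X]setTI; exact: mf.
by rewrite -[X in measurable X]setTI; exact: mg.
Qed.

Lemma indep_rv_sym d1 d2 (T1 : measurableType d1) (T2 : measurableType d2)
    (V : Omega -> T1) (W : Omega -> T2) : indep_rv V W -> indep_rv W V.
Proof. by move=> i A B mA mB; rewrite setIC i // muleC. Qed.

Lemma measurable_integral_pair d1 d2 (T1 : measurableType d1) (T2 : measurableType d2)
    (V : Omega -> T1) (f : T1 * T2 -> \bar R) :
  measurable_fun setT V -> measurable_fun [set: T1 * T2] f -> (forall x, 0 <= f x)%E ->
  measurable_fun setT (fun y => \int[P]_w f (V w, y))%E.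
Proof.
move=> mV mf f0.
pose mVm := isMeasurableFun.Build _ _ _ _ _ mV.
pose V' : {mfun Omega >-> T1} := HB.pack V mVm.
rewrite (_ : (fun y => _) = fubini_G (distribution P V') f).
  exact: measurable_fun_fubini_tonelli_G.
apply/funext => y; apply/esym.
apply: (ge0_integral_distribution V' (f := fun x => f (x, y))) => //.
apply: measurableT_comp => //; exact: measurable_fun_pair.
Qed.

(** Independence says that the joint law is the product of the laws; Tonelli then integrates over
    [V] first, with [W] frozen. *)
Lemma indep_rv_tonelli d1 d2 (T1 : measurableType d1) (T2 : measurableType d2)
    (V : Omega -> T1) (W : Omega -> T2) (f : T1 * T2 -> \bar R) :
  measurable_fun setT V -> measurable_fun setT W -> indep_rv V W ->
  measurable_fun [set: T1 * T2] f -> (forall x, 0 <= f x)%E ->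
  (\int[P]_w f (V w, W w) = \int[P]_w \int[P]_w' f (V w', W w))%E.
Proof.
move=> mV mW iVW mf f0.
pose mVm := isMeasurableFun.Build _ _ _ _ _ mV.
pose mWm := isMeasurableFun.Build _ _ _ _ _ mW.
have mVW : measurable_fun setT (fun w => (V w, W w)).
  exact: measurable_fun_pair.
pose mVWm := isMeasurableFun.Build _ _ _ _ _ mVW.
pose V' : {mfun Omega >-> T1} := HB.pack V mVm.
pose W' : {mfun Omega >-> T2} := HB.pack W mWm.
pose VW' : {mfun Omega >-> (T1 * T2)%type} := HB.pack (fun w => (V w, W w)) mVWm.
have -> : (\int[P]_w f (V w, W w) = \int[distribution P VW']_z f z)%E.
  by rewrite ge0_integral_distribution.
have HX : forall X, measurable X -> (distribution P V' \x distribution P W')%E X = distribution P VW' X.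
  apply: product_measure_unique => A B mA mB.
  change (P ((fun w => (V w, W w)) @^-1` (A `*` B)) = (P (V @^-1` A) * P (W @^-1` B))%E).
  by rewrite -iVW.
rewrite (eq_measure_integral (distribution P V' \x distribution P W')%E); last first.
  by move=> A mA _; apply: esym; exact: HX.
rewrite fubini_tonelli2 //.
rewrite ge0_integral_distribution; last 2 first.
- exact: measurable_fun_fubini_tonelli_G.
- by move=> y; apply: integral_ge0.
apply: eq_integral => w _; apply: (ge0_integral_distribution V' (f := fun x => f (x, W w))) => //.
apply: measurableT_comp => //; exact: measurable_fun_pair.
Qed.

End independence.

(** * Maxima of random walks *)

Section max_prefix_sum.
Context {R : realType}.
Implicit Types (x y : R) (s : seq R).

Fixpoint max_psum s : R := if s is x :: s' then Num.max 0 (x + max_psum s') else 0.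

Lemma max_psum_ge0 s : 0 <= max_psum s.
Proof. by case: s => //= x s; rewrite le_max lexx. Qed.

Lemma sum_le_max_psum s : \sum_(y <- s) y <= max_psum s.
Proof.
by elim: s => [|x s IH]; rewrite ?big_nil ?big_cons //= le_max lerD2l IH orbT.
Qed.

Lemma max_psum_rcons s x :
  max_psum (rcons s x) = Num.max (max_psum s) (\sum_(y <- s) y + x).
Proof.
elim: s => [|z s IH] /=; first by rewrite big_nil add0r addr0.
by rewrite IH big_cons -addrA addr_maxr maxA.
Qed.

Lemma max_psum_pos x s : 0 < x + \sum_(y <- s) y -> max_psum (x :: s) = x + max_psum s.
Proof.
move=> S0 /=; apply/max_idPr/ltW/(lt_le_trans S0).
by rewrite lerD2l sum_le_max_psum.
Qed.

Lemma max_psum_neg x s : \sum_(y <- s) y + x <= 0 -> max_psum (rcons s x) = max_psum s.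
Proof.
by move=> S0; rewrite max_psum_rcons; apply/max_idPl/(le_trans S0)/max_psum_ge0.
Qed.

(* Summing over all cyclic shifts is what makes Spitzer's identity pathwise: dropping the
   first term of a shift changes its maximum by that term when the total sum is positive and
   merely advances the shift otherwise. *)
Lemma max_psum_rot_sum s :
  \sum_(k < size s) max_psum (rot k s) =
  Num.max 0 (\sum_(y <- s) y) + \sum_(k < size s) max_psum (behead (rot k s)).
Proof.
case: s => [|x0 s0]; first by rewrite !big_ord0 big_nil maxxx addr0.
set s := x0 :: s0; set n := size s.
have sumrot k : \sum_(y <- rot k s) y = \sum_(y <- s) y.
  by apply: perm_big; rewrite perm_rot.
have rotE k : rot k s = head 0 (rot k s) :: behead (rot k s).
  have : size (rot k s) = n by rewrite size_rot.
  by case: (rot k s).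
have sumE k : head 0 (rot k s) + \sum_(y <- behead (rot k s)) y = \sum_(y <- s) y.
  by rewrite -(sumrot k) [in RHS]rotE big_cons.
have rotS k : (k < n)%N -> rot k.+1 s = rcons (behead (rot k s)) (head 0 (rot k s)).
  by move=> kn; rewrite -addn1 addnC rotD ?add1n // [in LHS]rotE rot1_cons.
case: (ltP 0 (\sum_(y <- s) y)) => S0.
  transitivity (\sum_(k < n) (head 0 (rot k s) + max_psum (behead (rot k s)))).
    apply: eq_bigr => k _; rewrite [in LHS]rotE max_psum_pos //; by rewrite sumE.
  rewrite big_split /=; congr (_ + _).
  transitivity (\sum_(k < n) s`_k); last by rewrite [RHS](big_nth 0) big_mkord.
  apply: eq_bigr => k _; rewrite -nth0 /rot nth_cat size_drop subn_gt0 ltn_ord.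
  by rewrite nth_drop addn0.
rewrite add0r.
transitivity (\sum_(k < n) max_psum (rot k.+1 s)).
  rewrite -(big_mkord predT (fun k => max_psum (rot k s))).
  rewrite -(big_mkord predT (fun k => max_psum (rot k.+1 s))).
  rewrite [in LHS]big_nat_recl // [in RHS]big_nat_recr //.
  by rewrite rot0 -[X in rot X s]/(size s) rot_size addrC.
apply: eq_bigr => k _; rewrite rotS // max_psum_neg //.
by rewrite addrC sumE.
Qed.

(* Pathwise form of Doob's L2 maximal inequality. *)
Lemma max_psum_doob s :
  max_psum s ^+ 2 / 2 + \sum_(k < size s) max_psum (take k s) * s`_k
   <= max_psum s * \sum_(y <- s) y.
Proof.
elim/last_ind: s => [|s x IH].
  by rewrite /= big_ord0 big_nil !mulr0 expr0n /= mul0r addr0.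
rewrite size_rcons big_ord_recr /= -cats1 take_size_cat // nth_cat ltnn subnn /=.
rewrite cats1 big_rcons /= max_psum_rcons.
rewrite (eq_bigr (fun k : 'I_(size s) => max_psum (take k s) * s`_k)); last first.
  by move=> k _; rewrite -cats1 takel_cat ?(ltnW (ltn_ord k)) // nth_cat ltn_ord.
move: IH; set M := max_psum s; set S := \sum_(y <- s) y; set A := \sum_(k < _) _.
move=> IH.
case: (leP (S + x) M) => h; first by nra.
by have := sqr_ge0 (S + x - M); nra.
Qed.

(** Doob's inequality combined with [M * S <= M ^+ 2 / 4 + S ^+ 2]. The increments are split into
    positive and negative parts so that every term is nonnegative and can be integrated in the
    extended reals; for symmetric increments the two correction sums have equal means. *)
Lemma max_psum_sqr_le s :
  max_psum s ^+ 2 / 4 + \sum_(k < size s) max_psum (take k s) * Num.max 0 s`_k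
   <= (\sum_(y <- s) y) ^+ 2 + \sum_(k < size s) max_psum (take k s) * Num.max 0 (- s`_k).
Proof.
have := max_psum_doob s.
have -> : \sum_(k < size s) max_psum (take k s) * s`_k =
   \sum_(k < size s) max_psum (take k s) * Num.max 0 s`_k -
   \sum_(k < size s) max_psum (take k s) * Num.max 0 (- s`_k).
  rewrite -sumrB; apply: eq_bigr => k _; rewrite -mulrBr; congr (_ * _).
  by case: (leP 0 s`_k) => h; case: (leP 0 (- s`_k)) => h'; lra.
set M := max_psum s; set S := \sum_(y <- s) y.
have := sqr_ge0 (M / 2 - S); nra.
Qed.

(** Stated for a path [w] rather than its increments, so that it serves both maxima, with [w] the
    sampled path, and minima, with [w] its opposite. *)
Lemma lt_max_psum (w : nat -> R) n y :
  (y < w 0%N + max_psum (mkseq (fun i => w i.+1 - w i) n)) <->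
  (exists2 i, (i <= n)%N & y < w i).
Proof.
elim: n w => [|n IH] w.
  rewrite /= addr0; split => [h|[i]]; first by exists 0%N.
  by rewrite leqn0 => /eqP ->.
rewrite /mkseq /= (iotaDl 1 0) -map_comp.
rewrite addr_maxr addr0 lt_max.
rewrite (_ : w 0%N + (w 1%N - w 0%N + _) =
   w 1%N + max_psum (mkseq (fun i => w i.+2 - w i.+1) n)); last by rewrite /mkseq; ring.
split.
  case/orP => [h|/(IH (fun i => w i.+1)) [i ? ?]]; first by exists 0%N.
  by exists i.+1.
case=> -[|i] li h; apply/orP; [by left|right].
by apply/(IH (fun i => w i.+1)); exists i.
Qed.

End max_prefix_sum.

Lemma sume_const_ord (R : realType) n (c : \bar R) :
  (\sum_(k < n) c = n%:R%:E * c)%E.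
Proof.
elim: n => [|n IH]; first by rewrite big_ord0 mul0e.
by rewrite big_ord_recr /= IH -natr1 EFinD ge0_muleDl ?lee_fin ?ler0n // mul1e.
Qed.

Section iid_maximum.
Context {R : realType} {d : measure_display} {Omega : measurableType d}.
Variable P : probability Omega R.
Variable X : nat -> Omega -> R.
Hypothesis mX : forall i, measurable_fun setT (X i).
Hypothesis iX : forall n, mutually_independent P (fun i : 'I_n => X i).
Hypothesis lawX : forall i A, measurable A -> P (X i @^-1` A) = P (X 0%N @^-1` A).

Let path n w := mkseq (X ^~ w) n.

Lemma measurable_max_psum n (f : 'I_n -> nat) :
  measurable_fun setT (fun w => max_psum [seq X (f i) w | i <- enum 'I_n]).
Proof.
elim: n f => [|n IH] f.
  by rewrite enum_ord0; exact: measurable_cst.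
rewrite enum_ordSl /=; apply: measurable_maxr; first exact: measurable_cst.
apply: measurable_funD => //.
rewrite (_ : (fun w => _) = (fun w => max_psum [seq X (f (lift ord0 i)) w | i <- enum 'I_n])).
  exact: IH.
by apply/funext => w; rewrite -map_comp.
Qed.

Lemma measurable_max_psum_tuple n :
  measurable_fun setT (fun t : n.-tuple R => max_psum t).
Proof.
elim: n => [|n IH].
  rewrite (_ : (fun t => _) = cst 0); first exact: measurable_cst.
  by apply/funext => t; rewrite tuple0.
rewrite (_ : (fun t => _) =
    (fun t : n.+1.-tuple R => Num.max 0 (tnth t ord0 + max_psum [tuple of behead t]))).
  apply: measurable_maxr; first exact: measurable_cst.
  apply: measurable_funD; first exact: measurable_tnth.
  apply: (measurableT_comp IH); exact: measurable_behead.
by apply/funext => t; case/tupleP: t => x t; rewrite tnth0.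
Qed.

(** The law of a tuple of i.i.d. variables depends only on its length, not on which distinct indices
    are chosen. *)
Lemma integral_exchangeable n (G : n.-tuple R -> \bar R) (f : 'I_n -> nat) :
  measurable_fun setT G -> (forall t, 0 <= G t)%E -> injective f ->
  (\int[P]_w G (tuple_rv (fun i => X (f i)) w) =
   \int[P]_w G (tuple_rv (fun i : 'I_n => X i) w))%E.
Proof.
move=> mG G0 finj.
have mt (g : 'I_n -> nat) : measurable_fun setT (tuple_rv (fun i => X (g i))).
  by apply: measurable_tuple_rv => i; exact: mX.
have key (g : 'I_n -> nat) : (\int[P]_w G (tuple_rv (fun i => X (g i)) w) =
    \int[pushforward P (tuple_rv (fun i => X (g i)))]_t G t)%E.
  by rewrite (ge0_integral_pushforward (mt g)).
rewrite (key f) (key (fun i => i)).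
apply: eq_measure_integral => A mA _.
apply: tuple_law_unique => //.
(* Independence is given for initial segments only; [N] is a segment containing all the indices
   [f i]. *)
- pose N := (\max_(i < n) f i).+1.
  have fN i : (f i < N)%N by rewrite ltnS; apply: (leq_bigmax i).
  have := @mutually_independent_reindex _ _ _ P n N (fun i : 'I_N => X i)
    (fun i => Ordinal (fN i)).
  by apply => [i j [] /finj|].
- by move=> i B mB; rewrite lawX // [RHS]lawX.
Qed.

(** The cyclic identity is integrated: by exchangeability all [n.+1] rotations have the same mean
    maximum, and so do all shortened rotations. The identity thus holds with a factor [n.+1] on both
    maxima, and dividing by it leaves the weight [n.+1%:R^-1] on the positive part of the sum. *)
Lemma spitzer_step n :
  (\int[P]_w (max_psum (path n.+1 w))%:E =
   \int[P]_w (max_psum (path n w))%:E +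
   (n.+1%:R^-1)%:E * \int[P]_w (Num.max 0 (\sum_(i < n.+1) X i w))%:E)%E.
Proof.
have pathE m w : path m w = tuple_rv (fun i : 'I_m => X i) w :> seq R.
  rewrite /tuple_rv /path /= /mkseq -val_enum_ord -map_comp; exact: eq_map.
have seqE m (g : 'I_m -> nat) w : tuple_rv (fun i : 'I_m => X (g i)) w =
    [seq X (g i) w | i <- enum 'I_m] :> seq R by [].
pose M m : \bar R := (\int[P]_w (max_psum (path m w))%:E)%E.
have ME m (g : 'I_m -> nat) : injective g ->
    (\int[P]_w (max_psum [seq X (g i) w | i <- enum 'I_m])%:E = M m)%E.
  move=> ginj; rewrite /M.
  under [RHS]eq_integral do rewrite pathE.
  rewrite -(integral_exchangeable (G := fun t : m.-tuple R => (max_psum t)%:E) _ _ ginj) //.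
    by apply/measurable_EFinP; exact: measurable_max_psum_tuple.
  by move=> t; rewrite lee_fin max_psum_ge0.
have rotP (k : 'I_n.+1) w : rot k (path n.+1 w) =
    [seq X ((i + k) %% n.+1)%N w | i : 'I_n.+1 <- enum 'I_n.+1].
  apply: (@eq_from_nth _ 0); first by rewrite size_rot size_mkseq size_map size_enum_ord.
  rewrite size_rot size_mkseq => i iN.
  rewrite (nth_map ord0) ?size_enum_ord // nth_enum_ord // /rot nth_cat size_drop size_mkseq.
  have kN := ltn_ord k.
  case: ltnP => h.
    rewrite nth_drop nth_mkseq; last by lia.
    by rewrite addnC modn_small //; lia.
  rewrite nth_take; last by lia.
  rewrite nth_mkseq; last by lia.
  congr (X _ w); rewrite -[in RHS](subnKC (_ : n.+1 <= i + k)%N); last by lia.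
  by rewrite modnDl modn_small; lia.
have brotP (k : 'I_n.+1) w : behead (rot k (path n.+1 w)) =
    [seq X ((i.+1 + k) %% n.+1)%N w | i : 'I_n <- enum 'I_n].
  by rewrite rotP enum_ordSl /= -map_comp; apply: eq_map => i /=.
have inj1 (k : 'I_n.+1) : injective (fun i : 'I_n.+1 => ((i + k) %% n.+1)%N).
  move=> i j /eqP; rewrite eqn_modDr !modn_small // => /eqP; exact: val_inj.
have inj2 (k : 'I_n.+1) : injective (fun i : 'I_n => ((i.+1 + k) %% n.+1)%N).
  move=> i j /eqP; rewrite eqn_modDr !modn_small ?ltnS // => /eqP []; exact: val_inj.
have mS : measurable_fun setT (fun w => Num.max 0 (\sum_(i < n.+1) X i w)).
  by apply: measurable_maxr; [exact: measurable_cst|exact: measurable_sum].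
have mM (k : 'I_n.+1) : measurable_fun setT (fun w => max_psum (rot k (path n.+1 w))).
  by under eq_fun do rewrite rotP; exact: measurable_max_psum.
have mM' (k : 'I_n.+1) : measurable_fun setT (fun w => max_psum (behead (rot k (path n.+1 w)))).
  by under eq_fun do rewrite brotP; exact: measurable_max_psum.
have : (\int[P]_w (\sum_(k < n.+1) (max_psum (rot k (path n.+1 w)))%:E) =
    \int[P]_w ((Num.max 0 (\sum_(i < n.+1) X i w))%:E +
      \sum_(k < n.+1) (max_psum (behead (rot k (path n.+1 w))))%:E))%E.
  apply: eq_integral => w _; rewrite !sumEFin -EFinD; congr (_%:E).
  have := max_psum_rot_sum (path n.+1 w); rewrite size_mkseq => ->.
  by rewrite /path /mkseq big_map -(big_mkord predT (X ^~ w)) /index_iota subn0.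
rewrite ge0_integralD //; last 4 first.
- by move=> w _; rewrite lee_fin le_max lexx.
- exact/measurable_EFinP.
- by move=> w _; apply: sume_ge0 => k _; rewrite lee_fin max_psum_ge0.
- by apply: emeasurable_sum => k; exact/measurable_EFinP.
rewrite ge0_integral_sum //; last 2 first.
- by move=> k; exact/measurable_EFinP.
- by move=> k w _; rewrite lee_fin max_psum_ge0.
rewrite ge0_integral_sum //; last 2 first.
- by move=> k; exact/measurable_EFinP.
- by move=> k w _; rewrite lee_fin max_psum_ge0.
rewrite (eq_bigr (fun _ => M n.+1)); last first.
  by move=> k _; under eq_integral do rewrite rotP; rewrite ME.
rewrite [in RHS](eq_bigr (fun _ => M n)); last first.
  by move=> k _; under eq_integral do rewrite brotP; rewrite ME.
rewrite -/(M n.+1) -/(M n) !sume_const_ord => H.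
have -> : M n.+1 = ((n.+1%:R^-1)%:E * (n.+1%:R%:E * M n.+1))%E.
  by rewrite muleA -EFinM mulVf ?mul1e // pnatr_eq0.
rewrite H ge0_muleDr //.
- by rewrite addeC muleA -EFinM mulVf ?mul1e // pnatr_eq0.
- by apply: integral_ge0 => w _; rewrite lee_fin le_max lexx.
- have n0 : (0 <= (n.+1%:R : R)%:E)%E by rewrite lee_fin.
  apply: (mule_ge0 n0).
  by apply: integral_ge0 => w _; rewrite lee_fin max_psum_ge0.
Qed.

Lemma spitzer n :
  (\int[P]_w (max_psum (path n w))%:E =
   \sum_(k < n) (k.+1%:R^-1)%:E * \int[P]_w (Num.max 0 (\sum_(i < k.+1) X i w))%:E)%E.
Proof.
elim: n => [|n IH]; last by rewrite big_ord_recr /= -IH spitzer_step.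
by rewrite big_ord0 -[RHS](integral0 P setT).
Qed.

(** [X k] is independent of the path before it, so both correction sums of the pathwise inequality
    integrate to the sum of [M k * c]. They cancel because the mean maxima are finite. *)
Lemma integral_max_psum_sqr_le n (c : R) :
  (forall i, \int[P]_w (Num.max 0 (X i w))%:E = c%:E)%E ->
  (forall i, \int[P]_w (Num.max 0 (- X i w))%:E = c%:E)%E ->
  (forall k, \int[P]_w (max_psum (path k w))%:E < +oo)%E ->
  (\int[P]_w ((max_psum (path n w)) ^+ 2)%:E <=
   4%:E * \int[P]_w ((\sum_(i < n) X i w) ^+ 2)%:E)%E.
Proof.
move=> Xp Xn Mfin.
pose M k : \bar R := (\int[P]_w (max_psum (path k w))%:E)%E.
have mM k : measurable_fun setT (fun w => max_psum (path k w)).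
  rewrite (_ : (fun w => _) = (fun w => max_psum [seq X i w | i : 'I_k <- enum 'I_k])).
    exact: measurable_max_psum.
  by apply/funext => w; rewrite /path /mkseq -val_enum_ord -map_comp.
have mpos (Y : Omega -> R) : measurable_fun setT Y ->
    measurable_fun setT (fun w => Num.max 0 (Y w)).
  by move=> mY; apply: measurable_maxr; [exact: measurable_cst|].
have mS : measurable_fun setT (fun w => (\sum_(i < n) X i w) ^+ 2).
  by apply: measurable_funX; exact: measurable_sum.
have mt k : measurable_fun setT (tuple_rv (fun i : 'I_k => X i)).
  exact: measurable_tuple_rv.
have pathE k w : path k w = tuple_rv (fun i : 'I_k => X i) w :> seq R.
  rewrite /tuple_rv /path /= /mkseq -val_enum_ord -map_comp; exact: eq_map.
have iXk k : indep_rv P (X k) (tuple_rv (fun i : 'I_k => X i)).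
  apply: indep_rv_sym.
  have := @indep_tuple_split _ _ _ P k 1 (fun i => X i) (fun _ => X k).
  move=> /(_ (fun i => mX i) (fun _ => mX k)) H.
  have {}H : indep_rv P (tuple_rv (fun i : 'I_k => X i)) (tuple_rv (fun _ : 'I_1 => X k)).
    apply: H; have := @iX (k + 1)%N; congr mutually_independent; apply/funext => i.
    by case: split_ordP => j ->; rewrite //= (ord1 j) addn0.
  move: H => /(indep_rv_comp (f := fun t => t) (g := fun t : 1.-tuple R => tnth t ord0)).
  move=> /(_ (@measurable_id _ _ _) (measurable_tnth _)).
  rewrite (_ : _ \o tuple_rv _ = X k) //.
  by apply/funext => w /=; rewrite tnth_mktuple.
have pmE (g : R -> R) k : measurable_fun setT g ->
   (\int[P]_w (Num.max 0 (g (X k w)))%:E = c%:E)%E ->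
   (\int[P]_w (max_psum (path k w) * Num.max 0 (g (X k w)))%:E = M k * c%:E)%E.
  move=> mg gc.
  pose f (yt : R * k.-tuple R) := ((max_psum yt.2)%:E * (Num.max 0 (g yt.1))%:E)%E.
  have max0 (x : R) : 0 <= Num.max 0 x by rewrite le_max lexx.
  have mgm : measurable_fun setT (fun x => Num.max 0 (g x)).
    by apply: measurable_maxr; [exact: measurable_cst|].
  transitivity (\int[P]_w f (X k w, tuple_rv (fun i : 'I_k => X i) w))%E.
    by apply: eq_integral => w _; rewrite /f /= pathE EFinM.
  rewrite (indep_rv_tonelli _ (mt k) (iXk k)) //; last 2 first.
  - apply: emeasurable_funM; apply/measurable_EFinP.
      exact: (measurableT_comp (@measurable_max_psum_tuple k) measurable_snd).
    exact: (measurableT_comp mgm measurable_fst).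
  - by move=> x; rewrite mule_ge0 // lee_fin ?max_psum_ge0.
  transitivity (\int[P]_w ((max_psum (path k w))%:E * c%:E))%E.
    apply: eq_integral => w _; rewrite /f /= -gc pathE ge0_integralZl //.
    - by apply/measurable_EFinP; exact: (measurableT_comp mgm).
    - by move=> x _; rewrite lee_fin.
    - by rewrite lee_fin max_psum_ge0.
  have c0 : 0 <= c by rewrite -lee_fin -gc; apply: integral_ge0 => w _; rewrite lee_fin.
  rewrite ge0_integralZr //; first exact/measurable_EFinP.
  by move=> w _; rewrite lee_fin max_psum_ge0.
have c0 : 0 <= c.
  by rewrite -lee_fin -(Xp 0%N); apply: integral_ge0 => w _; rewrite lee_fin le_max lexx.
have XM k := pmE id k (@measurable_id _ _ _) (Xp k).
have XM' k := pmE (fun x => - x) k (@oppr_measurable R setT) (Xn k).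
have term_ge0 (Y : Omega -> R) k w : 0 <= max_psum (path k w) * Num.max 0 (Y w).
  by rewrite mulr_ge0 ?max_psum_ge0 // le_max lexx.
have mterm (Y : Omega -> R) k : measurable_fun setT Y ->
    measurable_fun setT (fun w => max_psum (path k w) * Num.max 0 (Y w)).
  by move=> mY; apply: measurable_funM => //; exact: mpos.
have mXN k : measurable_fun setT (fun w => - X k w).
  by apply: (measurableT_comp (@oppr_measurable R setT)).
have msq : measurable_fun setT (fun w => max_psum (path n w) ^+ 2).
  exact: measurable_funX.
have key : ((4^-1)%:E * \int[P]_w ((max_psum (path n w)) ^+ 2)%:E + \sum_(k < n) M k * c%:E <=
    \int[P]_w ((\sum_(i < n) X i w) ^+ 2)%:E + \sum_(k < n) M k * c%:E)%E.
  rewrite -ge0_integralZl ?lee_fin //; last 2 first.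
  - exact/measurable_EFinP.
  - by move=> w _; rewrite lee_fin sqr_ge0.
  under [X in (_ + X <= _)%E]eq_bigr do rewrite -XM.
  under [X in (_ <= _ + X)%E]eq_bigr do rewrite -XM'.
  rewrite -[X in (_ + X <= _)%E]ge0_integral_sum //; last 2 first.
  - by move=> k; apply/measurable_EFinP; exact: mterm.
  - by move=> k w _; rewrite lee_fin.
  rewrite -[X in (_ <= _ + X)%E]ge0_integral_sum //; last 2 first.
  - by move=> k; apply/measurable_EFinP; exact: mterm.
  - by move=> k w _; rewrite lee_fin (term_ge0 (fun w => - X k w)).
  rewrite -ge0_integralD //; last 4 first.
  - by move=> w _; rewrite -EFinM lee_fin mulr_ge0 // sqr_ge0.
  - by apply: emeasurable_funM => //; exact/measurable_EFinP.
  - by move=> w _; apply: sume_ge0 => k _; rewrite lee_fin.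
  - by apply: emeasurable_sum => k; apply/measurable_EFinP; exact: mterm.
  rewrite -ge0_integralD //; last 4 first.
  - by move=> w _; rewrite lee_fin sqr_ge0.
  - exact/measurable_EFinP.
  - by move=> w _; apply: sume_ge0 => k _; rewrite lee_fin (term_ge0 (fun w => - X k w)).
  - apply: emeasurable_sum => k; apply/measurable_EFinP; exact: (mterm (fun w => - X k w)).
  apply: ge0_le_integral => //.
  - move=> w _; apply: adde_ge0; first by rewrite -EFinM lee_fin mulr_ge0 // sqr_ge0.
    by apply: sume_ge0 => k _; rewrite lee_fin.
  - apply: emeasurable_funD; first by apply: emeasurable_funM => //; exact/measurable_EFinP.
    by apply: emeasurable_sum => k; apply/measurable_EFinP; exact: mterm.
  - apply: emeasurable_funD; first exact/measurable_EFinP.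
    by apply: emeasurable_sum => k; apply/measurable_EFinP; exact: (mterm (fun w => - X k w)).
  - move=> w _; rewrite !sumEFin -EFinM -!EFinD lee_fin.
    have := max_psum_sqr_le (path n w); rewrite size_mkseq mulrC.
    rewrite [\sum_(y <- path n w) y](_ : _ = \sum_(i < n) X i w); last first.
      by rewrite /path /mkseq big_map -(big_mkord predT (X ^~ w)) /index_iota subn0.
    have tk (k : 'I_n) : take k (path n w) = path k w.
      by rewrite /path /mkseq -map_take take_iota (minn_idPl _) // ltnW.
    under eq_bigr do rewrite tk /path nth_mkseq //.
    by under [X in _ <= _ + X -> _]eq_bigr do rewrite tk /path nth_mkseq //.
have fin : (\sum_(k < n) M k * c%:E)%E \is a fin_num.
  apply/sum_fin_numP => k _ _; rewrite fin_numM // ge0_fin_numE //; first exact: Mfin.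
  by apply: integral_ge0 => w _; rewrite lee_fin max_psum_ge0.
rewrite leeD2rE // in key.
rewrite (_ : \int[P]_w (max_psum (path n w) ^+ 2)%:E =
  4%:E * ((4^-1)%:E * \int[P]_w (max_psum (path n w) ^+ 2)%:E))%E; last first.
  by rewrite muleA -EFinM mulfV ?mul1e // pnatr_eq0.
by rewrite lee_pmul2l.
Qed.

End iid_maximum.

(** * Gaussian moments *)

Section gaussian.
Context {R : realType}.
Notation mu := (@lebesgue_measure R).

Lemma integral_normal_prob (s : R) (f : R -> \bar R) :
  measurable_fun setT f -> (forall x, 0 <= f x)%E ->
  (\int[normal_prob 0%R s]_x f x = \int[mu]_x (f x * (normal_pdf 0 s x)%:E))%E.
Proof.
move=> mf f0.
have dom := @normal_prob_dominates R 0 s.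
rewrite -(Radon_Nikodym_SigmaFinite.change_of_variables dom f0 measurableT mf).
apply: ge0_ae_eq_integral => //.
- apply: emeasurable_funM => //; apply: (measurable_int mu).
  exact: Radon_Nikodym_SigmaFinite.f_integrable.
- by apply: emeasurable_funM => //; apply/measurable_EFinP; exact: measurable_normal_pdf.
- by move=> x _; rewrite mule_ge0 //; exact: Radon_Nikodym_SigmaFinite.f_ge0.
- by move=> x _; rewrite mule_ge0 // lee_fin normal_pdf_ge0.
- apply: ae_eqe_mul2l => /=; apply: integral_ae_eq => //=.
  + exact: Radon_Nikodym_SigmaFinite.f_integrable.
  + by apply/measurable_EFinP; exact: measurable_normal_pdf.
  + by move=> E E01 mE; rewrite -Radon_Nikodym_SigmaFinite.f_integral.
Qed.

Lemma normal_pdfN (s x : R) : s != 0 -> normal_pdf 0 s (- x) = normal_pdf 0 s x.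
Proof. by move=> s0; rewrite !normal_pdfE // /normal_fun !subr0 sqrrN. Qed.

Lemma integral_posr_normal_pdf (s : R) : 0 < s ->
  (\int[mu]_(x in `[0%R, +oo[) (x * normal_pdf 0 s x)%:E = (s / Num.sqrt (2 * pi))%:E)%E.
Proof.
move=> s0; have s0' : s != 0 by rewrite gt_eqF.
(* The density has derivative [- x / s ^+ 2] times itself, so [F] is a primitive of the integrand
   and tends to 0 at infinity. *)
pose F x : R := - s ^+ 2 * normal_pdf 0 s x.
have FE : F = fun x => - s ^+ 2 * (normal_peak s * expR (- x ^+ 2 / (s ^+ 2 *+ 2))).
  by apply/funext => x; rewrite /F normal_pdfE // /normal_fun subr0.
have dF (x : R) : is_derive x 1 F (x * normal_pdf 0 s x).
  rewrite FE.
  rewrite normal_pdfE // /normal_fun subr0.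
  apply: is_derive_eq.
  rewrite /GRing.scale /=; set e := expR _.
  rewrite ?mulr1 ?mulr0 ?addr0 ?add0r -mulr_natl.
  by field.
have F0 : F 0 = - (s / Num.sqrt (2 * pi)).
  rewrite /F normal_pdfE // /normal_fun subr0 expr0n /= oppr0 mul0r expR0 mulr1.
  rewrite /normal_peak mulNr -mulrnAr -mulr_natl sqrtrM ?sqr_ge0 // sqrtr_sqr gtr0_norm //.
  by rewrite invfM expr2 mulrA mulfK.
rewrite (ge0_continuous_FTC2y (F := F) (l := 0)).
- by rewrite F0 EFinN oppeK add0e.
- by move=> x x0; rewrite mulr_ge0 // normal_pdf_ge0.
- apply: continuous_subspaceT => x; apply: cvgM; first exact: cvg_id.
  exact: continuous_normal_pdf.
- rewrite FE -[X in _ --> X](mulr0 (- s ^+ 2 * normal_peak s)).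
  rewrite (_ : (fun x => _) = fun x => - s ^+ 2 * normal_peak s *
    (gauss_fun (x * (Num.sqrt (s ^+ 2 *+ 2))^-1))); last first.
    apply/funext => x; rewrite -mulrA /gauss_fun exprMn exprVn sqr_sqrtr ?mulNr //.
    by rewrite mulrn_wge0 // sqr_ge0.
  apply: cvgMr; apply: (cvg_comp _ _ _ (@cvg_gauss_fun R)).
  apply: gt0_cvgMly => //.
  by rewrite invr_gt0 sqrtr_gt0 pmulrn_lgt0 // exprn_even_gt0.
- by move=> x _; have [] := dF x.
- apply: cvg_at_right_filter; apply: differentiable_continuous.
  by apply/derivable1_diffP; have [] := dF 0.
- by move=> x _; rewrite derive1E; have [_ ->] := dF x.
Qed.

Lemma measurable_max0r (f : R -> R) : measurable_fun setT f ->
  measurable_fun setT (fun x => (Num.max 0 (f x))%:E).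
Proof.
by move=> mf; apply/measurable_EFinP/measurable_maxr; [exact: measurable_cst|].
Qed.

Lemma integral_normal_pos (s : R) : 0 < s ->
  (\int[normal_prob 0%R s]_x (Num.max 0 x)%:E = (s / Num.sqrt (2 * pi))%:E)%E.
Proof.
move=> s0; rewrite integral_normal_prob; last 2 first.
- exact: (measurable_max0r (@measurable_id _ _ _)).
- by move=> x; rewrite lee_fin le_max lexx.
rewrite -integral_posr_normal_pdf // [RHS]integral_mkcond; apply: eq_integral => x _.
rewrite patchE; case: ifPn.
  by rewrite inE /= in_itv /= andbT => x0; rewrite (max_idPr x0) EFinM.
rewrite notin_setE /= in_itv /= andbT => /negP; rewrite -ltNge => x0.
by rewrite (max_idPl (ltW x0)) mul0e.
Qed.

Lemma integral_normal_neg (s : R) : 0 < s ->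
  (\int[normal_prob 0%R s]_x (Num.max 0 (- x))%:E = (s / Num.sqrt (2 * pi))%:E)%E.
Proof.
move=> s0; rewrite integral_normal_prob; last 2 first.
- exact: (measurable_max0r (@oppr_measurable R setT)).
- by move=> x; rewrite lee_fin le_max lexx.
rewrite -integral_posr_normal_pdf //.
pose f (x : R) : \bar R := ((Num.max 0 x) * normal_pdf 0 s x)%:E.
have mf : measurable_fun setT f.
  apply/measurable_EFinP/measurable_funM; last exact: measurable_normal_pdf.
  by apply: measurable_maxr; [exact: measurable_cst|exact: measurable_id].
have f0 x : (0 <= f x)%E by rewrite lee_fin mulr_ge0 ?le_max ?lexx // normal_pdf_ge0.
transitivity (\int[mu]_(x in `[0%R, +oo[) f x)%E; last first.
  apply: eq_integral => x; rewrite inE /= in_itv /= andbT => x0.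
  by rewrite /f (max_idPr x0).
rewrite (ge0_integration_by_substitution0 mf f0) [RHS]integral_mkcond.
apply: eq_integral => x _; rewrite patchE /f normal_pdfN ?gt_eqF //.
case: ifPn; first by rewrite EFinM.
rewrite notin_setE /= in_itv /= => /negP; rewrite -ltNge => x0.
by rewrite (max_idPl _) ?mul0e // oppr_le0 ltW.
Qed.

Lemma integral_normal_sqr_le (s : R) : 0 < s ->
  (\int[normal_prob 0%R s]_x (x ^+ 2)%:E <= (8 * s ^+ 2)%:E)%E.
Proof.
move=> s0; rewrite integral_normal_prob; last 2 first.
- by apply/measurable_EFinP; exact: measurable_funX.
- by move=> x; rewrite lee_fin sqr_ge0.
(* A crude comparison replaces the exact value: with [t = x ^+ 2 / (4 * s ^+ 2)], half of the
   exponent absorbs [t] through [t * expR (- t) <= 1], and the other half is the Gaussian of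
   deviation [s']. The constant 8 is 4 from [x ^+ 2] times 2 from the ratio of the peaks. *)
pose s' := Num.sqrt 2 * s.
have s'0 : 0 < s' by rewrite mulr_gt0 // sqrtr_gt0.
have -> : (8 * s ^+ 2)%:E = ((8 * s ^+ 2)%:E * \int[mu]_x (normal_pdf 0 s' x)%:E)%E.
  by rewrite integral_normal_pdf mule1.
rewrite -ge0_integralZl //; last 3 first.
- by apply/measurable_EFinP; exact: measurable_normal_pdf.
- by move=> x _; rewrite lee_fin normal_pdf_ge0.
- by rewrite lee_fin mulr_ge0 // sqr_ge0.
apply: ge0_le_integral => //.
- by move=> x _; rewrite -EFinM lee_fin mulr_ge0 ?sqr_ge0 ?normal_pdf_ge0.
- apply: emeasurable_funM; apply/measurable_EFinP; first exact: measurable_funX.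
  exact: measurable_normal_pdf.
- apply: emeasurable_funM => //; apply/measurable_EFinP; exact: measurable_normal_pdf.
move=> x _; rewrite -!EFinM lee_fin !normal_pdfE ?gt_eqF // /normal_fun subr0.
have s'2 : s' ^+ 2 = 2 * s ^+ 2 by rewrite exprMn sqr_sqrtr.
have pk : normal_peak s <= 2 * normal_peak s'.
  have E : s' ^+ 2 * pi *+ 2 = 2 * (s ^+ 2 * pi *+ 2) by rewrite s'2 mulrnAr mulrA.
  rewrite /normal_peak E.
  rewrite sqrtrM // invfM mulrA ler_peMl ?invr_ge0 ?sqrtr_ge0 //.
  rewrite -[leLHS](mulfV (_ : Num.sqrt 2 != 0 :> R)) ?gt_eqF ?sqrtr_gt0 //.
  rewrite ler_wpM2r ?invr_ge0 ?sqrtr_ge0 //.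
  rewrite -[leRHS](gtr0_norm (_ : 0 < 2)) // -sqrtr_sqr ler_sqrt //; lra.
set t := x ^+ 2 / (s ^+ 2 *+ 4).
have s20 : 0 < s ^+ 2 by rewrite exprn_gt0.
have xt : x ^+ 2 = 4 * s ^+ 2 * t by rewrite /t -mulr_natl; field; rewrite gt_eqF.
have -> : - x ^+ 2 / (s ^+ 2 *+ 2) = - t + - t.
  by rewrite /t -[_ *+ 2]mulr_natl -[_ *+ 4]mulr_natl; field; rewrite gt_eqF.
have -> : - x ^+ 2 / (s' ^+ 2 *+ 2) = - t.
  by rewrite /t s'2 -[_ *+ 2]mulr_natl -[_ *+ 4]mulr_natl; field; rewrite gt_eqF.
have te : t <= expR t by apply: le_trans (expR_ge1Dx t); lra.
have t0 : 0 <= t by rewrite divr_ge0 ?sqr_ge0 // mulrn_wge0 // ltW.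
rewrite xt expRD.
have e1 : t * expR (- t) <= 1 by rewrite expRN ler_pdivrMr ?expR_gt0 // mul1r.
have e0 := expR_gt0 (- t).
have pk0 := normal_peak_ge0 s.
rewrite [leLHS](_ : _ = (4 * s ^+ 2 * normal_peak s * expR (- t)) * (t * expR (- t))); last ring.
apply: (@le_trans _ _ (4 * s ^+ 2 * normal_peak s * expR (- t))).
  by rewrite ler_piMr // !mulr_ge0 // ltW.
rewrite [leRHS](_ : _ = 4 * s ^+ 2 * (2 * normal_peak s') * expR (- t)); last ring.
by rewrite ler_wpM2r ?(ltW e0) // ler_wpM2l // mulr_ge0 // ltW.
Qed.

End gaussian.

(** * Gaussian sums over lattices *)

Section integer_sums.

(* Sum over -K <= r < K, since [Negz k] is [- k.+1]. *)
Definition zsum (V : nmodType) (K : nat) (g : int -> V) : V :=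
  \sum_(0 <= k < K) (g (Posz k) + g (Negz k)).

Lemma zsumS (V : nmodType) K (g : int -> V) :
  zsum K.+1 g = zsum K g + (g (Posz K) + g (Negz K)).
Proof. by rewrite /zsum big_nat_recr. Qed.

Lemma eq_zsum (V : nmodType) K (f g : int -> V) : f =1 g -> zsum K f = zsum K g.
Proof. by move=> fg; apply: eq_bigr => k _; rewrite !fg. Qed.

Lemma count_int_interval (C D : int) K :
  zsum K (fun r => ((C < r) && (r < D))%:R : int) =
  Num.max 0 (Num.min D K%:Z - Num.max (C + 1) (- K%:Z)).
Proof.
elim: K => [|K IH].
  rewrite /zsum big_geq //; lia.
by rewrite zsumS IH; lia.
Qed.

Context {R : realType}.

Lemma zsum_int_interval (c d : R) K :
  zsum K (fun r => ((c < r%:~R) && (r%:~R < d))%:R : R) =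
  (zsum K (fun r => ((Num.floor c < r) && (r < Num.ceil d))%:R : int))%:~R.
Proof.
rewrite /zsum raddf_sum /=; apply: eq_bigr => k _.
by rewrite !floor_lt_int !ceil_gt_int rmorphD /= !mulrz_nat.
Qed.

Lemma count_interval_le (c d : R) K : c <= d ->
  zsum K (fun r => ((c < r%:~R) && (r%:~R < d))%:R) <= d - c + 1.
Proof.
move=> cd; rewrite zsum_int_interval count_int_interval.
have h1 := floorD1_gt c; have h2 := ceilB1_lt d.
set C := Num.floor c in h1 *; set D := Num.ceil d in h2 *.
apply: (@le_trans _ _ ((Num.max 0 (D - (C + 1)))%:~R)).
  by rewrite ler_int; lia.
case: (leP 0 (D - (C + 1))) => _; last by rewrite mulr0z; lra.
rewrite !intrD !intrN /= in h1 h2 *; lra.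
Qed.

Lemma count_interval_ge (c d : R) : exists K0, forall K, (K0 <= K)%N ->
  d - c - 1 <= zsum K (fun r => ((c < r%:~R) && (r%:~R < d))%:R).
Proof.
exists (`|Num.floor c| + `|Num.ceil d| + 1)%N => K K0.
rewrite zsum_int_interval count_int_interval.
have h1 := floor_le c; have h2 := ceil_ge d.
set C := Num.floor c in K0 h1 *; set D := Num.ceil d in K0 h2 *.
apply: (@le_trans _ _ ((D - (C + 1))%:~R)).
  rewrite !intrD !intrN /= in h1 h2 *; lra.
by rewrite ler_int; lia.
Qed.

End integer_sums.

Section gaussian_lattice.
Context {R : realType}.
Notation mu := (@lebesgue_measure R).
Variable s : R.
Hypothesis s0 : 0 < s.
Let s0' : s != 0. Proof. by rewrite gt_eqF. Qed.
Let pk := normal_peak s.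
Let pk0 : 0 < pk. Proof. exact: normal_peak_gt0. Qed.
Let phi := normal_pdf 0 s.

(* Layer cake: [{phi > y}] is an interval of half-width [width y], and the lattice points of
   an interval are counted by its length up to 1. *)
Let width (y : R) : R := Num.sqrt (s ^+ 2 *+ 2 * (ln pk - ln y)).

Let phi_le_pk x : phi x <= pk. Proof. exact: normal_pdf_ub. Qed.

Let lt_phi y x : 0 < y -> y < pk -> (y < phi x) = (`|x| < width y).
Proof.
move=> y0 ypk; rewrite /phi normal_pdfE // /normal_fun subr0 -/pk.
have L0 : 0 < ln pk - ln y by rewrite subr_gt0 ltr_ln.
have s2 : 0 < s ^+ 2 *+ 2 by rewrite pmulrn_lgt0 // exprn_gt0.
rewrite -[in LHS](lnK (_ : y \is Num.pos)) // -[in LHS](lnK (_ : pk \is Num.pos)) //.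
rewrite -expRD ltr_expR mulNr ltrBrDr addrC -ltrBrDr ltr_pdivrMr //.
rewrite [_ * (s ^+ 2 *+ 2)]mulrC /width.
rewrite -[in LHS](sqr_sqrtr (_ : 0 <= s ^+ 2 *+ 2 * (ln pk - ln y))); last first.
  by rewrite mulr_ge0 // ltW.
by rewrite -(real_normK (num_real x)) ltr_pXn2r // nnegrE sqrtr_ge0.
Qed.

Let width_ge0 y : 0 <= width y. Proof. exact: sqrtr_ge0. Qed.

Let measurable_width : measurable_fun setT width.
Proof.
have msqrt : measurable_fun setT (@Num.sqrt R).
  by apply: continuous_measurable_fun => x; exact: sqrt_continuous.
apply: (measurableT_comp msqrt); apply: measurable_funM; first exact: measurable_cst.
by apply: measurable_funB; [exact: measurable_cst|exact: measurable_ln].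
Qed.

Let area (x y : R) : R := ((0 < y) && (y < phi x))%:R.

Let measurable_area : measurable_fun [set: R * R] (fun xy : R * R => area xy.1 xy.2).
Proof.
pose b (xy : R * R) := (0 < xy.2) && (xy.2 < phi xy.1).
rewrite (_ : (fun xy => _) = fun xy => if b xy then 1 else 0); last first.
  by apply/funext => xy; rewrite /area -/(b xy); case: (b xy).
apply: measurable_fun_if => //.
apply: measurable_and; apply: measurable_fun_ltr => //.
apply: (measurableT_comp _ measurable_fst); exact: measurable_normal_pdf.
Qed.

Let integral_area_y (x : R) : (\int[mu]_y (area x y)%:E = (phi x)%:E)%E.
Proof.
rewrite (_ : (fun y => _) = fun y => (\1_(`]0, phi x[%classic) y)%:E); last first.
  by apply/funext => y; rewrite indicE /area mem_setE in_itv.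
rewrite integral_indic //= setIT lebesgue_measure_itv /= lte_fin.
case: ltP => [_|h]; first by rewrite oppr0 adde0.
by congr (_%:E); apply/eqP; rewrite eq_le h /phi normal_pdf_ge0.
Qed.

Let integral_area_x (y : R) : 0 < y -> y < pk ->
  (\int[mu]_x (area x y)%:E = (2 * width y)%:E)%E.
Proof.
move=> y0 ypk.
rewrite (_ : (fun x => _) = fun x => (\1_(`](- width y), (width y)[%classic) x)%:E); last first.
  apply/funext => x; rewrite indicE /area y0 /= lt_phi //.
  by rewrite mem_setE in_itv /= ltr_norml.
rewrite integral_indic //= setIT lebesgue_measure_itv /= lte_fin.
case: ltP => h; first by rewrite -EFinB opprK mulr2n mulrDl mul1r.
have -> : width y = 0 by have := width_ge0 y; lra.
by rewrite mulr0.
Qed.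

(** The unit area under the density, sliced horizontally: [2 * width y] is the length of the slice
    at height [y]. *)
Let integral_width : (\int[mu]_(y in `]0%R, pk[) (2 * width y)%:E = 1)%E.
Proof.
transitivity (\int[mu]_y \int[mu]_x (area x y)%:E)%E; last first.
  have ma : measurable_fun [set: R * R] (fun xy : R * R => (area xy.1 xy.2)%:E).
    exact/measurable_EFinP.
  have a0 (xy : R * R) : (0 <= (area xy.1 xy.2)%:E)%E by rewrite lee_fin.
  have /= <- := @fubini_tonelli _ _ _ _ R mu mu _ ma a0.
  by under eq_integral do rewrite integral_area_y; exact: integral_normal_pdf.
rewrite integral_mkcond; apply: eq_integral => y _; rewrite patchE.
case: ifPn; rewrite ?inE ?notin_setE /= in_itv /=.
  by move=> /andP[y0 ypk]; rewrite integral_area_x.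
move=> h; rewrite integral0_eq // => x _; congr (_%:E).
rewrite /area; case: andP => // -[y0 h2]; case: h; rewrite y0 /=.
exact: lt_le_trans (phi_le_pk x).
Qed.

Let phi_layer (x : R) : ((phi x)%:E = \int[mu]_(y in `]0%R, pk[) (`|x| < width y)%R%:R%:E)%E.
Proof.
rewrite -integral_area_y [RHS]integral_mkcond; apply: eq_integral => y _; rewrite patchE.
case: ifPn; rewrite ?inE ?notin_setE /= in_itv /=.
  by move=> /andP[y0 ypk]; rewrite /area y0 /= lt_phi.
move=> h; congr (_%:E).
rewrite /area; case: andP => // -[y0 h2]; case: h; rewrite y0 /=.
exact: lt_le_trans (phi_le_pk x).
Qed.

Variable q : R.
Hypothesis q0 : 0 < q.
Let cnt (u y : R) (r : int) : R := (`|r%:~R / q - u| < width y)%R%:R.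

Let cntE u y r : cnt u y r =
  ((q * (u - width y) < r%:~R) && (r%:~R < q * (u + width y)))%:R.
Proof.
rewrite /cnt ltr_norml; congr (_%:R); congr nat_of_bool; congr andb.
  by rewrite -ltr_pdivlMl // [q^-1 * _]mulrC; apply/idP/idP; lra.
by rewrite -ltr_pdivrMl // [q^-1 * _]mulrC; apply/idP/idP; lra.
Qed.

Let measurable_cnt u r : measurable_fun setT (fun y => cnt u y r).
Proof.
rewrite (_ : (fun y => _) = fun y => if `|r%:~R / q - u| < width y then 1 else 0); last first.
  by apply/funext => y; rewrite /cnt; case: (_ < _).
by apply: measurable_fun_if => //; apply: measurable_fun_ltr.
Qed.

Let measurable_zcnt u K : measurable_fun setT (fun y => zsum K (cnt u y)).
Proof.
apply: measurable_sum => k.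
by apply: measurable_funD; exact: measurable_cnt.
Qed.

Let zsum_ge0 u y K : 0 <= zsum K (cnt u y).
Proof. by apply: sumr_ge0 => k _; rewrite addr_ge0. Qed.

Let zsum_phi_layer u K : ((zsum K (fun r => phi (r%:~R / q - u)))%:E =
  \int[mu]_(y in `]0%R, pk[) (zsum K (cnt u y))%:E)%E.
Proof.
rewrite /zsum -sumEFin.
under [RHS]eq_integral do rewrite -sumEFin.
rewrite ge0_integral_sum //.
- apply: eq_bigr => k _; rewrite EFinD !phi_layer -ge0_integralD //.
  + by apply/measurable_funTS/measurable_EFinP; exact: measurable_cnt.
  + by apply/measurable_funTS/measurable_EFinP; exact: measurable_cnt.
- move=> k; apply/measurable_funTS/measurable_EFinP.
  by apply: measurable_funD; exact: measurable_cnt.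
- by move=> k y _; rewrite lee_fin addr_ge0.
Qed.

Let integral_pk : (\int[mu]_(y in `]0%R, pk[) 1 = pk%:E)%E.
Proof. by rewrite integral_cst //= lebesgue_measure_itv /= lte_fin pk0 mul1e oppr0 adde0. Qed.

(** A slice of length [2 * width y] contains at most [2 * q * width y + 1] multiples of [1 / q].
    Integrated over the heights from 0 to the peak, the first part gives [q] and the second the
    peak. *)
Lemma gaussian_lattice_le u K :
  zsum K (fun r => normal_pdf 0 s (r%:~R / q - u)) <= q + normal_peak s.
Proof.
rewrite -lee_fin zsum_phi_layer.
have -> : ((q + pk)%:E = \int[mu]_(y in `]0%R, pk[) (q%:E * (2 * width y)%:E + 1))%E.
  rewrite ge0_integralD //; last 2 first.
  - by move=> y _; rewrite -EFinM lee_fin !mulr_ge0 // ltW.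
  - apply/measurable_funTS/emeasurable_funM => //; apply/measurable_EFinP.
    exact: measurable_funM.
  rewrite ge0_integralZl //.
  - by rewrite integral_width mule1 integral_pk.
  - by apply/measurable_funTS/measurable_EFinP; exact: measurable_funM.
  - by move=> y _; rewrite lee_fin mulr_ge0.
  - by rewrite lee_fin ltW.
apply: ge0_le_integral => //.
- by move=> y _; rewrite lee_fin.
- apply/measurable_funTS; apply/measurable_EFinP; exact: measurable_zcnt.
- apply/measurable_funTS/emeasurable_funD => //.
  apply/emeasurable_funM => //; apply/measurable_EFinP; exact: measurable_funM.
move=> y _; rewrite -EFinM -EFinD lee_fin (eq_zsum _ (cntE u y)).
have w0 := width_ge0 y.
apply: (le_trans (count_interval_le _ _)).
  by rewrite ler_pM2l //; lra.
by lra.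
Qed.

(** The same slicing, with at least [2 * q * width y - 1] points per slice. The peak is added on the
    right, which avoids subtracting extended reals. *)
Lemma gaussian_lattice_ge u :
  (q%:E <= \sum_(0 <= k <oo) (normal_pdf 0 s ((Posz k)%:~R / q - u) +
      normal_pdf 0 s ((Negz k)%:~R / q - u))%:E + (normal_peak s)%:E)%E.
Proof.
have mc k : measurable_fun setT (fun y => (cnt u y (Posz k) + cnt u y (Negz k))%:E).
  by apply/measurable_EFinP; apply: measurable_funD; exact: measurable_cnt.
have ms : measurable_fun setT
    (fun y => \sum_(0 <= k <oo) (cnt u y (Posz k) + cnt u y (Negz k))%:E)%E.
  apply: (@ge0_emeasurable_sum _ _ _ _ _ predT) => // k y _ _.
  by rewrite lee_fin addr_ge0.
have -> : (\sum_(0 <= k <oo) (normal_pdf 0 s ((Posz k)%:~R / q - u) +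
      normal_pdf 0 s ((Negz k)%:~R / q - u))%:E =
    \int[mu]_(y in `]0%R, pk[) \sum_(0 <= k <oo) (cnt u y (Posz k) + cnt u y (Negz k))%:E)%E.
  rewrite integral_nneseries //.
  - apply: eq_eseriesr => k _; rewrite EFinD !phi_layer -ge0_integralD //.
      + by apply/measurable_funTS/measurable_EFinP; exact: measurable_cnt.
    + by apply/measurable_funTS/measurable_EFinP; exact: measurable_cnt.
  - by move=> k; apply: measurable_funTS; exact: mc.
  - by move=> k y _; rewrite lee_fin addr_ge0.
rewrite -integral_pk -ge0_integralD //; last 2 first.
- by move=> y _; apply: nneseries_ge0 => k _ _; rewrite lee_fin addr_ge0.
- exact: measurable_funTS.
rewrite -[leLHS]mule1 -[X in (_ * X <= _)%E]integral_width -ge0_integralZl //; last 3 first.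
- by apply/measurable_funTS/measurable_EFinP; exact: measurable_funM.
- by move=> y _; rewrite lee_fin mulr_ge0.
- by rewrite lee_fin ltW.
apply: ge0_le_integral => //.
- by move=> y _; rewrite -EFinM lee_fin !mulr_ge0 // ltW.
- apply/measurable_funTS/emeasurable_funM => //; apply/measurable_EFinP.
  exact: measurable_funM.
- by apply/measurable_funTS; apply: emeasurable_funD.
move=> y _; have w0 := width_ge0 y.
(* The number of terms needed depends on the level [y], hence the infinite sum in the statement. *)
have [K0 /(_ K0 (leqnn _))] := count_interval_ge (q * (u - width y)) (q * (u + width y)).
rewrite -(eq_zsum K0 (cntE u y)) => h.
apply: (@le_trans _ _ ((zsum K0 (cnt u y))%:E + 1)%E).
  by rewrite -EFinM -EFinD lee_fin; lra.
apply: leeD;[|by []]; rewrite /zsum -sumEFin.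
by apply: nneseries_lim_ge => k _ _; rewrite lee_fin addr_ge0.
Qed.

End gaussian_lattice.

(** * Expected number of lattice points in an interval shifted by a Gaussian variable *)

Section lattice_points.
Context {R : realType}.
Notation mu := (@lebesgue_measure R).

Definition npoints (K : nat) (q lo hi : R) : R :=
  zsum K (fun r => ((lo < r%:~R / q) && (r%:~R / q < hi))%:R).

Lemma npoints_ge0 K q lo hi : 0 <= npoints K q lo hi.
Proof. by apply: sumr_ge0 => k _; rewrite addr_ge0. Qed.

Lemma npoints_le K q lo hi : 0 < q -> lo <= hi ->
  npoints K q lo hi <= 1 + q * (hi - lo).
Proof.
move=> q0 lh.
have -> : npoints K q lo hi =
    zsum K (fun r => ((q * lo < r%:~R) && (r%:~R < q * hi))%:R).
  apply: eq_zsum => r; congr (_%:R); congr nat_of_bool; congr andb.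
    by rewrite mulrC ltr_pdivlMl.
  by rewrite mulrC ltr_pdivrMl.
apply: le_trans (count_interval_le _ _) _; first by rewrite ler_pM2l.
by rewrite mulrBr addrC.
Qed.

Lemma measurable_npoints d (T : measurableType d) K q (lo hi : T -> R) :
  measurable_fun setT lo -> measurable_fun setT hi ->
  measurable_fun setT (fun t => npoints K q (lo t) (hi t)).
Proof.
move=> mlo mhi.
have mr (r : int) : measurable_fun setT
    (fun t => ((lo t < r%:~R / q) && (r%:~R / q < hi t))%:R : R).
  pose b t := (lo t < r%:~R / q) && (r%:~R / q < hi t).
  rewrite (_ : (fun t => _) = fun t => if b t then 1 else 0); last first.
    by apply/funext => t; rewrite -/(b t); case: (b t).
  by apply: measurable_fun_if => //; apply: measurable_and; apply: measurable_fun_ltr.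
by apply: measurable_sum => k; exact: measurable_funD.
Qed.

Lemma lebesgue_measure_reflect (c : R) (A : set R) : measurable A ->
  pushforward mu (fun u : measurableTypeR R => c - u : measurableTypeR R) A = mu A.
Proof.
move=> mA.
have mf : measurable_fun setT (fun u : measurableTypeR R => c - u : measurableTypeR R).
  by apply: measurable_funB.
apply/esym/lebesgue_measure_unique => //= _ [[a b]] _ <-.
rewrite /pushforward.
rewrite (_ : _ @^-1` _ = `[c - b, c - a[%classic); last first.
  apply/seteqP; split => u /=; rewrite !in_itv /=; lra.
rewrite /= !lebesgue_measure_itv /= !lte_fin ltrD2l ltrN2.
by case: ifP => // _; rewrite -!EFinB; congr (_%:E); lra.
Qed.

(** The probability that [c] falls between [U + al] and [U + be], for [U] Gaussian, becomes an
    integral over the offset [u]. With [c = r / q] and [u] fixed, summing over [r] produces the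
    Gaussian lattice sums above. *)
Lemma normal_prob_reflect (s c al be : R) :
  (normal_prob 0%R s `](c - be)%R, (c - al)%R[%classic =
   \int[mu]_(u in `]al, be[) (normal_pdf 0 s (c - u))%:E)%E.
Proof.
have mf : measurable_fun setT (fun u : measurableTypeR R => c - u : measurableTypeR R).
  by apply: measurable_funB.
rewrite (_ : `]al, be[%classic = (fun u => c - u) @^-1` `]c - be, c - al[%classic); last first.
  apply/seteqP; split => u /=; rewrite !in_itv /=; lra.
rewrite /normal_prob -(@ge0_integral_pushforward _ _ _ _ _ _ mf mu _
  (fun x => (normal_pdf 0 s x)%:E)) //=.
- by apply: eq_measure_integral => A mA _; apply/esym; exact: lebesgue_measure_reflect.
- apply/measurable_funTS/measurable_EFinP; exact: measurable_normal_pdf.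
- by move=> x _; rewrite lee_fin normal_pdf_ge0.
Qed.

Variables (s q : R).
Hypotheses (s0 : 0 < s) (q0 : 0 < q).
Let pk := normal_peak s.
Let hit (al be : R) (r : int) : \bar R :=
  normal_prob 0%R s `](r%:~R / q - be), (r%:~R / q - al)[%classic.

Let mpdf (c : R) (D : set R) : measurable_fun D (fun u => (normal_pdf 0 s (c - u))%:E).
Proof.
apply/measurable_funTS/measurable_EFinP.
apply: (measurableT_comp (@measurable_normal_pdf R 0 s)); exact: measurable_funB.
Qed.

Let integral_cst_itv (c al be : R) : al <= be ->
  (\int[mu]_(u in `]al, be[) c%:E = (c * (be - al))%:E)%E.
Proof.
move=> ab; rewrite integral_cst //= lebesgue_measure_itv /= lte_fin.
case: ltP => [_|h]; first by rewrite -EFinB.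
have -> : be = al by apply/eqP; rewrite eq_le h ab.
by rewrite mule0 subrr mulr0.
Qed.

Let pdf2_ge0 (k : nat) (u : R) : (0 <= (normal_pdf 0 s ((Posz k)%:~R / q - u) +
  normal_pdf 0 s ((Negz k)%:~R / q - u))%:E)%E.
Proof. by rewrite lee_fin addr_ge0 // normal_pdf_ge0. Qed.

Let mpdf2 (k : nat) (D : set R) : measurable_fun D (fun u =>
  (normal_pdf 0 s ((Posz k)%:~R / q - u) + normal_pdf 0 s ((Negz k)%:~R / q - u))%:E).
Proof. by under eq_fun do rewrite EFinD; apply: emeasurable_funD; exact: mpdf. Qed.

Let hit2E al be (k : nat) : (hit al be (Posz k) + hit al be (Negz k) =
  \int[mu]_(u in `]al, be[) (normal_pdf 0 s ((Posz k)%:~R / q - u) +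
     normal_pdf 0 s ((Negz k)%:~R / q - u))%:E)%E.
Proof.
rewrite /hit !normal_prob_reflect -ge0_integralD //; try exact: mpdf.
all: by move=> u _; rewrite lee_fin normal_pdf_ge0.
Qed.

Lemma sum_normal_prob_le (al be : R) K : al <= be ->
  (\sum_(0 <= k < K) (normal_prob 0%R s `]((Posz k)%:~R / q - be)%R, ((Posz k)%:~R / q - al)%R[%classic +
    normal_prob 0%R s `]((Negz k)%:~R / q - be)%R, ((Negz k)%:~R / q - al)%R[%classic) <=
   ((q + normal_peak s) * (be - al))%:E)%E.
Proof.
move=> ab; under eq_bigr do rewrite [(_ + _)%E]hit2E.
rewrite -ge0_integral_sum //; last by move=> k; exact: mpdf2.
rewrite -integral_cst_itv //; apply: ge0_le_integral => //.
- by move=> u _; apply: sume_ge0.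
- by apply: emeasurable_sum => k; exact: mpdf2.
- by move=> u _; rewrite sumEFin lee_fin; exact: (gaussian_lattice_le s0 q0).
Qed.

Lemma sum_normal_prob_ge (al be : R) : al <= be ->
  ((q * (be - al))%:E <=
   \sum_(0 <= k <oo) (normal_prob 0%R s `]((Posz k)%:~R / q - be)%R, ((Posz k)%:~R / q - al)%R[%classic +
    normal_prob 0%R s `]((Negz k)%:~R / q - be)%R, ((Negz k)%:~R / q - al)%R[%classic)
    + (normal_peak s * (be - al))%:E)%E.
Proof.
move=> ab; under eq_eseriesr do rewrite [(_ + _)%E]hit2E.
rewrite -integral_nneseries //; last by move=> k; exact: mpdf2.
have ms : measurable_fun setT (fun u : R => \sum_(0 <= k <oo)
   (normal_pdf 0 s ((Posz k)%:~R / q - u) + normal_pdf 0 s ((Negz k)%:~R / q - u))%:E)%E.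
  by apply: (@ge0_emeasurable_sum _ _ _ _ _ predT).
rewrite -!integral_cst_itv // -ge0_integralD //.
- apply: ge0_le_integral => //.
  + by move=> u _; rewrite lee_fin ltW.
  + by apply: emeasurable_funD => //; exact: measurable_funTS.
  + by move=> u _; exact: (gaussian_lattice_ge s0 q0).
- by move=> u _; apply: nneseries_ge0.
- exact: measurable_funTS.
- by move=> u _; rewrite lee_fin normal_peak_ge0.
Qed.

End lattice_points.

(** * Counts in a random interval whose base point is an independent Gaussian variable *)

Section independent_gaussian_shift.
Context {R : realType} {d : measure_display} {Omega : measurableType d}.
Variable P : probability Omega R.
Context {d' : measure_display} {T : measurableType d'}.
Variables (U : Omega -> R) (W : Omega -> T).
Hypothesis mU : measurable_fun setT U.
Hypothesis mW : measurable_fun setT W.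
Hypothesis iUW : indep_rv P U W.
Variables (s q : R).
Hypotheses (s0 : 0 < s) (q0 : 0 < q).
Hypothesis lawU : forall A, measurable A -> P (U @^-1` A) = normal_prob 0 s A.
Variables (al be : T -> R).
Hypothesis mal : measurable_fun setT al.
Hypothesis mbe : measurable_fun setT be.
Hypothesis albe : forall t, al t <= be t.

Let ind (u : R) (t : T) (r : int) : R :=
  ((u + al t < r%:~R / q) && (r%:~R / q < u + be t))%:R.

Let measurable_ind r : measurable_fun [set: R * T] (fun x : R * T => ind x.1 x.2 r).
Proof.
pose b (x : R * T) := (x.1 + al x.2 < r%:~R / q) && (r%:~R / q < x.1 + be x.2).
rewrite (_ : (fun x => _) = fun x => if b x then 1 else 0); last first.
  by apply/funext => x; rewrite /ind -/(b x); case: (b x).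
apply: measurable_fun_if => //; apply: measurable_and; apply: measurable_fun_ltr => //;
  by apply: measurable_funD => //; apply: (measurableT_comp _ measurable_snd).
Qed.

Let measurable_ind1 t r : measurable_fun setT (fun w => ind (U w) t r).
Proof.
apply: (measurableT_comp (measurable_ind r) (f := fun x : R * T => ind x.1 x.2 r)
  (g := fun w => (U w, t))).
exact: measurable_fun_pair.
Qed.

Let integral_ind t r : (\int[P]_w (ind (U w) t r)%:E =
  normal_prob 0%R s `](r%:~R / q - be t)%R, (r%:~R / q - al t)%R[%classic)%E.
Proof.
rewrite -lawU //.
rewrite (_ : (fun w => _) = fun w => (\1_(U @^-1` `]r%:~R / q - be t, r%:~R / q - al t[%classic) w)%:E).
  rewrite integral_indic //= ?setIT // -[X in measurable X]setTI; exact: mU.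
apply/funext => w; rewrite indicE /ind; congr (_%:R%:E); congr nat_of_bool.
apply/idP/idP; rewrite inE /= in_itv /=; lra.
Qed.

Let ind2_ge0 u t k : 0 <= ind u t (Posz k) + ind u t (Negz k).
Proof. by rewrite addr_ge0. Qed.

Let measurable_ind2 t k :
  measurable_fun setT (fun w => (ind (U w) t (Posz k) + ind (U w) t (Negz k))%:E).
Proof. by apply/measurable_EFinP; exact: measurable_funD. Qed.

Let integral_ind2 t k : (\int[P]_w (ind (U w) t (Posz k) + ind (U w) t (Negz k))%:E =
  normal_prob 0%R s `]((Posz k)%:~R / q - be t)%R, ((Posz k)%:~R / q - al t)%R[%classic +
  normal_prob 0%R s `]((Negz k)%:~R / q - be t)%R, ((Negz k)%:~R / q - al t)%R[%classic)%E.
Proof.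
rewrite -!integral_ind -ge0_integralD //; try exact/measurable_EFinP.
all: by move=> w _; rewrite lee_fin.
Qed.

(** Freezing [W] leaves a Gaussian lattice sum. The weight [h] lets one estimate serve three times:
    [h = 1] for the mean of a count, an affine function of the range for its square, and the count
    of another window for mixed moments. *)
Lemma integral_npoints_mul_le (h : T -> R) K :
  measurable_fun setT h -> (forall t, 0 <= h t) ->
  (\int[P]_w (npoints K q (U w + al (W w)) (U w + be (W w)) * h (W w))%:E <=
   (q + normal_peak s)%:E * \int[P]_w ((be (W w) - al (W w)) * h (W w))%:E)%E.
Proof.
move=> mh h0.
have mba : measurable_fun setT (fun w => (be (W w) - al (W w)) * h (W w)).
  by apply: measurable_funM; [apply: measurable_funB|]; apply: measurableT_comp.
have c0 : 0 <= q + normal_peak s by rewrite addr_ge0 ?normal_peak_ge0 // ltW.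
pose f (x : R * T) : \bar R := (zsum K (ind x.1 x.2) * h x.2)%:E.
have mz : measurable_fun [set: R * T] (fun x : R * T => zsum K (ind x.1 x.2)).
  by apply: measurable_sum => k; apply: measurable_funD; exact: measurable_ind.
have mf : measurable_fun [set: R * T] f.
  apply/measurable_EFinP; apply: measurable_funM => //.
  exact: (measurableT_comp mh measurable_snd).
have z0 x : 0 <= zsum K (ind x.1 x.2) by apply: sumr_ge0 => k _.
have f0 x : (0 <= f x)%E by rewrite lee_fin mulr_ge0.
rewrite (_ : (fun w => _) = fun w => f (U w, W w)); last by apply/funext.
rewrite (indep_rv_tonelli mU mW iUW mf f0) -ge0_integralZl //; last 2 first.
- exact/measurable_EFinP.
- by move=> w _; rewrite lee_fin mulr_ge0 // subr_ge0.
have inner t : (\int[P]_w f (U w, t) <= ((q + normal_peak s) * (be t - al t) * h t)%:E)%E.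
  rewrite (_ : (fun w => _) = fun w => (h t)%:E *
     \sum_(0 <= k < K) (ind (U w) t (Posz k) + ind (U w) t (Negz k))%:E)%E; last first.
    by apply/funext => w; rewrite /f sumEFin -EFinM mulrC.
  rewrite ge0_integralZl //; last 3 first.
  - by apply: emeasurable_sum.
  - by move=> w _; apply: sume_ge0 => k _; rewrite lee_fin.
  - by rewrite lee_fin.
  rewrite ge0_integral_sum //; last by move=> k w _; rewrite lee_fin.
  rewrite mulrC EFinM lee_wpmul2l ?lee_fin //.
  under eq_bigr do rewrite integral_ind2.
  exact: sum_normal_prob_le.
apply: ge0_le_integral => //.
- by move=> w _; apply: integral_ge0.
- have := measurable_integral_pair P mU mf f0.
  by move=> /measurableT_comp; apply.
- by apply: emeasurable_funM => //; exact/measurable_EFinP.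
- by move=> w _; apply: (le_trans (inner _)); rewrite -EFinM lee_fin mulrA.
Qed.

Lemma sum_npoints_ge :
  (q%:E * \int[P]_w (be (W w) - al (W w))%:E <=
   \sum_(0 <= k <oo) (\int[P]_w (ind (U w) (W w) (Posz k) + ind (U w) (W w) (Negz k))%:E)
   + (normal_peak s)%:E * \int[P]_w (be (W w) - al (W w))%:E)%E.
Proof.
have mba : measurable_fun setT (fun w => (be (W w) - al (W w))%:E).
  by apply/measurable_EFinP; apply: measurable_funB; apply: measurableT_comp.
have ba0 w : (0 <= (be (W w) - al (W w))%:E)%E by rewrite lee_fin subr_ge0.
pose f k (x : R * T) : \bar R := (ind x.1 x.2 (Posz k) + ind x.1 x.2 (Negz k))%:E.
have mf k : measurable_fun [set: R * T] (f k).
  by apply/measurable_EFinP; apply: measurable_funD; exact: measurable_ind.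
have f0 k x : (0 <= f k x)%E by rewrite lee_fin.
have mg k : measurable_fun setT (fun w => \int[P]_w' f k (U w', W w))%E.
  have := measurable_integral_pair P mU (mf k) (f0 k).
  by move=> /measurableT_comp; apply.
have g0 k w : (0 <= \int[P]_w' f k (U w', W w))%E by apply: integral_ge0.
have pk0 : (0 <= (normal_peak s)%:E)%E by rewrite lee_fin normal_peak_ge0.
have Ef k : (\int[P]_w (ind (U w) (W w) (Posz k) + ind (U w) (W w) (Negz k))%:E =
    \int[P]_w \int[P]_w' f k (U w', W w))%E.
  by rewrite -(indep_rv_tonelli mU mW iUW (mf k) (f0 k)).
under eq_eseriesr do rewrite Ef.
rewrite -integral_nneseries // -!ge0_integralZl //; last by rewrite lee_fin ltW.
have ms : measurable_fun setT (fun w => \sum_(0 <= k <oo) \int[P]_w' f k (U w', W w))%E.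
  by apply: (@ge0_emeasurable_sum _ _ _ _ _ predT).
rewrite -ge0_integralD //; last 3 first.
- by move=> w _; apply: nneseries_ge0.
- by move=> w _; rewrite mule_ge0.
- by apply: emeasurable_funM.
apply: ge0_le_integral => //.
- by move=> w _; rewrite mule_ge0 // lee_fin ltW.
- by apply: emeasurable_funM.
- by apply: emeasurable_funD => //; apply: emeasurable_funM.
move=> w _; rewrite -!EFinM; apply: (le_trans (sum_normal_prob_ge s0 q0 (albe (W w)))).
rewrite (eq_eseriesr (g := fun k => \int[P]_w' f k (U w', W w))%E) // => k _.
by rewrite -integral_ind2.
Qed.

(** The lower bound concerns the sum over all integers; its partial sums increase to it, so any
    value strictly below is exceeded once the truncation [K] is large. Finiteness of the mean length
    allows the peak term to be moved to the left. *)
Lemma integral_npoints_ge (r : R) :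
  (\int[P]_w (be (W w) - al (W w))%:E < +oo)%E ->
  (r%:E < (q - normal_peak s)%:E * \int[P]_w (be (W w) - al (W w))%:E)%E ->
  exists K0, forall K, (K0 <= K)%N ->
    (r%:E < \int[P]_w (npoints K q (U w + al (W w)) (U w + be (W w)))%:E)%E.
Proof.
set J := (\int[P]_w (be (W w) - al (W w))%:E)%E.
pose u k : \bar R := (\int[P]_w (ind (U w) (W w) (Posz k) + ind (U w) (W w) (Negz k))%:E)%E.
have H : (q%:E * J <= \sum_(0 <= k <oo) u k + (normal_peak s)%:E * J)%E := sum_npoints_ge.
move=> Joo; have J0 : (0 <= J)%E.
  by apply: integral_ge0 => w _; rewrite lee_fin subr_ge0.
have Jfin : J \is a fin_num by rewrite ge0_fin_numE.
have u0 k : (0 <= u k)%E by apply: integral_ge0 => w _; rewrite lee_fin.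
have npE K : (\int[P]_w (npoints K q (U w + al (W w)) (U w + be (W w)))%:E =
    \sum_(0 <= k < K) u k)%E.
  rewrite -ge0_integral_sum //; last 2 first.
  - move=> k; apply/measurable_EFinP; apply: measurable_funD.
      exact: (measurableT_comp (measurable_ind k) (measurable_fun_pair mU mW)).
    exact: (measurableT_comp (measurable_ind (Negz k)) (measurable_fun_pair mU mW)).
  - by move=> k w _; rewrite lee_fin.
  by apply: eq_integral => w _; rewrite sumEFin.
move=> rJ.
have : (r%:E < \sum_(0 <= k <oo) u k)%E.
  apply: (lt_le_trans rJ); move: H; rewrite -(fineK Jfin) -!EFinM mulrBl EFinB.
  by rewrite leeBlDr.
move=> rlim.
have [K0 rK0] : exists K0, (r%:E < \sum_(0 <= k < K0) u k)%E.
  apply: contrapT => /forallNP nK; move: rlim; apply/negP; rewrite -leNgt.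
  apply: lime_le; first exact: is_cvg_nneseries.
  by apply: nearW => n; rewrite leNgt; apply/negP; exact: nK.
exists K0 => K K0K; rewrite npE; apply: (lt_le_trans rK0).
by apply: lee_sum_nneg_natr.
Qed.

End independent_gaussian_shift.

(** * Sampled Brownian paths *)

Section subfamilies.
Context {R : realType} {d : measure_display} {Omega : measurableType d}.
Variable P : probability Omega R.

Lemma indep_rv_subfamilies N m k (Z : 'I_N -> Omega -> R) (f : 'I_m -> 'I_N) (g : 'I_k -> 'I_N) :
  (forall i, measurable_fun setT (Z i)) -> mutually_independent P Z ->
  injective f -> injective g -> (forall i j, f i != g j) ->
  indep_rv P (tuple_rv (fun i => Z (f i))) (tuple_rv (fun j => Z (g j))).
Proof.
move=> mZ iZ finj ginj fg; apply: indep_tuple_split => //.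
pose u (i : 'I_(m + k)) := match fintype.split i with inl a => f a | inr b => g b end.
have uinj : injective u.
  move=> i j; rewrite /u; case: split_ordP => i' ->; case: split_ordP => j' -> H.
  - by rewrite (finj _ _ H).
  - by have := fg i' j'; rewrite H eqxx.
  - by have := fg j' i'; rewrite H eqxx.
  - by rewrite (ginj _ _ H).
have := mutually_independent_reindex uinj iZ; congr mutually_independent.
by apply/funext => i; rewrite /u; case: (fintype.split i).
Qed.

Lemma tuple_rv_mkseq n (X : nat -> Omega -> R) w :
  tuple_rv (fun i : 'I_n => X i) w = mkseq (X ^~ w) n :> seq R.
Proof. by rewrite /tuple_rv /= /mkseq -val_enum_ord -map_comp. Qed.

Lemma measurable_subtuple n m (f : 'I_m -> 'I_n) :
  measurable_fun setT (fun t : n.-tuple R => [tuple tnth t (f i) | i < m]).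
Proof.
apply/measurable_fun_tnthP => i; rewrite (_ : _ \o _ = (@tnth n R)^~ (f i)).
  exact: measurable_tnth.
by apply/funext => t /=; rewrite tnth_mktuple.
Qed.

Lemma measurable_max_psum_opp n :
  measurable_fun setT (fun t : n.-tuple R => max_psum (map -%R t)).
Proof.
pose o (t : n.-tuple R) := [tuple - tnth t i | i < n].
have mo : measurable_fun setT o.
  apply/measurable_fun_tnthP => i; rewrite (_ : _ \o _ = -%R \o (@tnth n R)^~ i).
    by apply: measurableT_comp => //; exact: measurable_tnth.
  by apply/funext => t /=; rewrite tnth_mktuple.
rewrite (_ : (fun t => _) = (fun t : n.-tuple R => max_psum t) \o o).
  exact: (measurableT_comp (@measurable_max_psum_tuple R n) mo).
apply/funext => t /=; congr max_psum.
by rewrite -[in LHS](map_tnth_enum t) -map_comp.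
Qed.

End subfamilies.

Section brownian_window.
Context {R : realType} {d : measure_display} {Omega : measurableType d}.
Variable P : probability Omega R.
Variable B : R -> {RV P >-> R}.
Hypothesis hB : standard_brownian_motion B.

Definition bm_inc (s t : R) (w : Omega) : R := B t w - B s w.

Lemma measurable_bm_inc s t : measurable_fun setT (bm_inc s t).
Proof. by apply: measurable_funB. Qed.

Lemma bm_inc_law s t A : 0 <= s -> s < t -> measurable A ->
  P (bm_inc s t @^-1` A) = normal_prob 0 (Num.sqrt (t - s)) A.
Proof. by move=> s0 st mA; exact: (bm_gaussian_increments hB). Qed.

Definition grid_inc (a m : R) (i : nat) := bm_inc (a + i%:R * m) (a + i.+1%:R * m).
(* Maximum and minus the minimum of [B t - B a] over the sampled times
   [t = a + i * m], [i <= n]. *)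
Definition grid_max (a m : R) n w := max_psum (mkseq (grid_inc a m ^~ w) n).
Definition grid_min (a m : R) n w := max_psum (map -%R (mkseq (grid_inc a m ^~ w) n)).

Lemma grid_max_ge0 a m n w : 0 <= grid_max a m n w.
Proof. exact: max_psum_ge0. Qed.

Lemma grid_min_ge0 a m n w : 0 <= grid_min a m n w.
Proof. exact: max_psum_ge0. Qed.

Let measurable_grid_tuple a m n : measurable_fun setT (tuple_rv (fun i : 'I_n => grid_inc a m i)).
Proof. by apply: measurable_tuple_rv => i; exact: measurable_bm_inc. Qed.

Lemma measurable_grid_max a m n : measurable_fun setT (grid_max a m n).
Proof.
rewrite (_ : grid_max a m n = (fun t : n.-tuple R => max_psum t) \o
    tuple_rv (fun i : 'I_n => grid_inc a m i)).
  exact: (measurableT_comp (@measurable_max_psum_tuple R n) (@measurable_grid_tuple a m n)).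
by apply/funext => w /=; rewrite tuple_rv_mkseq.
Qed.

Lemma measurable_grid_min a m n : measurable_fun setT (grid_min a m n).
Proof.
rewrite (_ : grid_min a m n = (fun t : n.-tuple R => max_psum (map -%R t)) \o
    tuple_rv (fun i : 'I_n => grid_inc a m i)).
  exact: (measurableT_comp (@measurable_max_psum_opp R n) (@measurable_grid_tuple a m n)).
by apply/funext => w; rewrite [RHS]/comp tuple_rv_mkseq.
Qed.

Section one_grid.
Variables (a m : R).
Hypotheses (a0 : 0 <= a) (m0 : 0 < m).

Let X := grid_inc a m.
Let mX i : measurable_fun setT (X i). Proof. exact: measurable_bm_inc. Qed.

Let a_ge0 i : 0 <= a + i%:R * m. Proof. by rewrite addr_ge0 // mulr_ge0 // ltW. Qed.

Let iX n : mutually_independent P (fun i : 'I_n => X i).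
Proof.
have := @bm_indep_increments _ _ _ _ _ hB n (fun i => a + i%:R * m).
apply; first by rewrite mul0r addr0.
by move=> i j ij; rewrite lerD2l ler_wpM2r // ?ler_nat // ltW.
Qed.

Let lawX0 i A : measurable A -> P (X i @^-1` A) = normal_prob 0 (Num.sqrt m) A.
Proof.
move=> mA.
have E : a + i.+1%:R * m - (a + i%:R * m) = m by rewrite -natr1; ring.
have lt : a + i%:R * m < a + i.+1%:R * m by rewrite ltrD2l ltr_pM2r // ltr_nat.
by have := bm_inc_law (a_ge0 i) lt mA; rewrite E.
Qed.

Let lawX i A : measurable A -> P (X i @^-1` A) = P (X 0%N @^-1` A).
Proof. by move=> mA; rewrite !lawX0. Qed.

Let sumX k w : \sum_(i < k) X i w = bm_inc a (a + k%:R * m) w.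
Proof.
rewrite -(big_mkord predT (X ^~ w)) /X /grid_inc /bm_inc.
by rewrite (telescope_sumr (fun i => B (a + i%:R * m) w)) // mul0r addr0.
Qed.

Let law_integral (U : Omega -> R) (s : R) (f : R -> \bar R) :
  measurable_fun setT U -> (forall A, measurable A -> P (U @^-1` A) = normal_prob 0 s A) ->
  measurable_fun setT f -> (forall x, 0 <= f x)%E ->
  (\int[P]_w f (U w) = \int[normal_prob 0%R s]_x f x)%E.
Proof.
move=> mU lU mf f0.
have mU' : measurable_fun setT (U : Omega -> measurableTypeR R) by exact: mU.
pose mUm := isMeasurableFun.Build _ _ _ _ _ mU'.
pose U' : {mfun Omega >-> measurableTypeR R} := HB.pack (U : Omega -> measurableTypeR R) mUm.
transitivity (\int[distribution P U']_x f x)%E; first by rewrite ge0_integral_distribution.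
by apply: eq_measure_integral => A mA _; exact: lU.
Qed.

Let sqrt_grid k : Num.sqrt (a + k.+1%:R * m - a) = Num.sqrt (k.+1%:R) * Num.sqrt m.
Proof. by rewrite addrAC subrr add0r sqrtrM. Qed.

Let S_law k A : measurable A -> P (bm_inc a (a + k.+1%:R * m) @^-1` A) =
  normal_prob 0 (Num.sqrt k.+1%:R * Num.sqrt m) A.
Proof.
move=> mA; have lt : a < a + k.+1%:R * m by rewrite ltrDl mulr_gt0.
by have := bm_inc_law a0 lt mA; rewrite sqrt_grid.
Qed.

Let s_gt0 k : 0 < Num.sqrt k.+1%:R * Num.sqrt m.
Proof. by rewrite mulr_gt0 // sqrtr_gt0. Qed.

Let c0 : R := Num.sqrt m / Num.sqrt (2 * pi).

Let E_pos k : (\int[P]_w (Num.max 0 (bm_inc a (a + k.+1%:R * m) w))%:E =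
  (Num.sqrt k.+1%:R * c0)%:E)%E.
Proof.
rewrite (law_integral (f := fun x => (Num.max 0 x)%:E) _ (S_law k)).
- by rewrite integral_normal_pos // mulrA.
- exact: measurable_bm_inc.
- exact: (measurable_max0r (@measurable_id _ _ _)).
- by move=> x; rewrite lee_fin le_max lexx.
Qed.

Let E_neg k : (\int[P]_w (Num.max 0 (- bm_inc a (a + k.+1%:R * m) w))%:E =
  (Num.sqrt k.+1%:R * c0)%:E)%E.
Proof.
rewrite (law_integral (f := fun x => (Num.max 0 (- x))%:E) _ (S_law k)).
- by rewrite integral_normal_neg // mulrA.
- exact: measurable_bm_inc.
- exact: (measurable_max0r (@oppr_measurable R setT)).
- by move=> x; rewrite lee_fin le_max lexx.
Qed.

(** The positive part of the sum of [k] increments has mean [sqrt k * c0], so the [k]-th Spitzer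
    term is [c0 / sqrt k]; these sums grow like [2 * sqrt n]. *)
Let harm n : R := \sum_(k < n) (Num.sqrt k.+1%:R)^-1.

Let harm_le n : harm n <= 2 * Num.sqrt n%:R.
Proof.
elim: n => [|n IH]; first by rewrite /harm big_ord0 sqrtr0 mulr0.
rewrite /harm big_ord_recr /= -/(harm n); apply: (le_trans (lerD IH (lexx _))).
set x := Num.sqrt n%:R; set y := Num.sqrt n.+1%:R.
have x0 : 0 <= x by exact: sqrtr_ge0.
have y0 : 0 < y by rewrite sqrtr_gt0.
have x2 : x ^+ 2 = n%:R by rewrite sqr_sqrtr.
have y2 : y ^+ 2 = n%:R + 1 by rewrite sqr_sqrtr // natr1.
rewrite -(ler_pM2r y0) mulrDl mulVf ?gt_eqF //.
have := sqr_ge0 (x - y); nra.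
Qed.

Let harm_ge n : 2 * (Num.sqrt n%:R - 1) <= harm n.
Proof.
(* The induction carries the stronger bound with [n.+1], which the comparison with the integral of
   the inverse square root gives. *)
suff H : 2 * (Num.sqrt n.+1%:R - 1) <= harm n.
  by apply: le_trans H; rewrite ler_pM2l // lerB // ler_sqrt // ler_nat.
elim: n => [|n IH]; first by rewrite /harm big_ord0 sqrtr1 subrr mulr0.
rewrite /harm big_ord_recr /= -/(harm n); apply: le_trans (lerD IH (lexx _)).
set x := Num.sqrt n.+1%:R; set y := Num.sqrt n.+2%:R.
have x0 : 0 < x by rewrite sqrtr_gt0.
have y0 : 0 <= y by exact: sqrtr_ge0.
have x2 : x ^+ 2 = n.+1%:R by rewrite sqr_sqrtr.
have y2 : y ^+ 2 = n.+1%:R + 1 by rewrite sqr_sqrtr // natr1.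
rewrite -(ler_pM2r x0) [leRHS]mulrDl mulVf ?gt_eqF //.
have := sqr_ge0 (x - y); nra.
Qed.

Let spitzer_sum n : (\sum_(k < n) (k.+1%:R^-1)%:E * (Num.sqrt k.+1%:R * c0)%:E =
  (c0 * harm n)%:E)%E.
Proof.
under eq_bigr do rewrite -EFinM.
rewrite sumEFin /harm mulr_sumr; congr (_%:E); apply: eq_bigr => k _.
rewrite mulrA [RHS]mulrC; congr (_ * _).
rewrite -{1}(sqr_sqrtr (ler0n R k.+1)) expr2 invfM -mulrA mulVf ?mulr1 //.
Qed.

Lemma integral_grid_max n : (\int[P]_w (grid_max a m n w)%:E = (c0 * harm n)%:E)%E.
Proof.
rewrite /grid_max (spitzer mX iX lawX) -spitzer_sum; apply: eq_bigr => k _.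
by congr (_ * _)%E; under eq_integral do rewrite sumX; exact: E_pos.
Qed.

Let Y i w := - X i w.
Let mY i : measurable_fun setT (Y i).
Proof. by apply: (measurableT_comp (@oppr_measurable R setT)). Qed.

Let mopp (A : set R) : measurable A -> measurable (-%R @^-1` A).
Proof. by move=> mA; rewrite -[X in measurable X]setTI; exact: oppr_measurable. Qed.

Let iY n : mutually_independent P (fun i : 'I_n => Y i).
Proof. by move=> A mA; apply: (@iX n (fun i => -%R @^-1` A i)) => i; exact: mopp. Qed.

Let lawY i A : measurable A -> P (Y i @^-1` A) = P (Y 0%N @^-1` A).
Proof. by move=> mA; apply: (lawX i (mopp mA)). Qed.

Let grid_minE n w : grid_min a m n w = max_psum (mkseq (Y ^~ w) n).
Proof. by rewrite /grid_min /mkseq -map_comp. Qed.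

Let sumY k w : \sum_(i < k) Y i w = - bm_inc a (a + k%:R * m) w.
Proof. by rewrite sumrN sumX. Qed.

Lemma integral_grid_min n : (\int[P]_w (grid_min a m n w)%:E = (c0 * harm n)%:E)%E.
Proof.
under eq_integral do rewrite grid_minE.
rewrite (spitzer mY iY lawY) -spitzer_sum; apply: eq_bigr => k _.
by congr (_ * _)%E; under eq_integral do rewrite sumY; exact: E_neg.
Qed.

Let E_Xpos i : (\int[P]_w (Num.max 0 (X i w))%:E = c0%:E)%E.
Proof.
rewrite (law_integral (f := fun x => (Num.max 0 x)%:E) (mX i) (lawX0 i)).
- by rewrite integral_normal_pos // sqrtr_gt0.
- exact: (measurable_max0r (@measurable_id _ _ _)).
- by move=> x; rewrite lee_fin le_max lexx.
Qed.

Let E_Xneg i : (\int[P]_w (Num.max 0 (- X i w))%:E = c0%:E)%E.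
Proof.
rewrite (law_integral (f := fun x => (Num.max 0 (- x))%:E) (mX i) (lawX0 i)).
- by rewrite integral_normal_neg // sqrtr_gt0.
- exact: (measurable_max0r (@oppr_measurable R setT)).
- by move=> x; rewrite lee_fin le_max lexx.
Qed.

Let E_sqr n : (\int[P]_w ((bm_inc a (a + n%:R * m) w) ^+ 2)%:E <= (8 * (n%:R * m))%:E)%E.
Proof.
case: n => [|n].
  rewrite mul0r mulr0 integral0_eq // => w _; by rewrite addr0 /bm_inc subrr expr0n.
rewrite (law_integral (f := fun x => (x ^+ 2)%:E) _ (S_law n)).
- rewrite (le_trans (integral_normal_sqr_le _)) // lee_fin exprMn !sqr_sqrtr //.
  exact: ltW.
- exact: measurable_bm_inc.
- by apply/measurable_EFinP; exact: measurable_funX.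
- by move=> x; rewrite lee_fin sqr_ge0.
Qed.

Lemma integral_grid_max_sqr_le n :
  (\int[P]_w (grid_max a m n w ^+ 2)%:E <= (32 * (n%:R * m))%:E)%E.
Proof.
apply: (le_trans (integral_max_psum_sqr_le mX iX n E_Xpos E_Xneg _)).
  by move=> k; have := integral_grid_max k; rewrite /grid_max => ->; rewrite ltry.
under eq_integral do rewrite sumX.
(* The factor 4 is the one of Doob's inequality, and 8 that of the crude Gaussian second moment. *)
rewrite (_ : 32 = 4 * 8); last by lra.
by rewrite -mulrA EFinM lee_pmul2l.
Qed.

Lemma integral_grid_min_sqr_le n :
  (\int[P]_w (grid_min a m n w ^+ 2)%:E <= (32 * (n%:R * m))%:E)%E.
Proof.
under eq_integral do rewrite grid_minE.
apply: (le_trans (integral_max_psum_sqr_le mY iY n E_Xneg _ _)).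
- move=> i; rewrite -(E_Xpos i); apply: eq_integral => w _; by rewrite /Y opprK.
- move=> k; have := integral_grid_min k; under eq_integral do rewrite grid_minE.
  by move=> ->; rewrite ltry.
under eq_integral do rewrite sumY sqrrN.
rewrite (_ : 32 = 4 * 8); last by lra.
by rewrite -mulrA EFinM lee_pmul2l.
Qed.

Lemma integral_grid_max_bounds n :
  ((2 * (Num.sqrt n%:R - 1) * (Num.sqrt m / Num.sqrt (2 * pi)))%:E <=
    \int[P]_w (grid_max a m n w)%:E <=
   (2 * Num.sqrt n%:R * (Num.sqrt m / Num.sqrt (2 * pi)))%:E)%E.
Proof.
rewrite integral_grid_max !lee_fin [c0 * _]mulrC.
have c00 : 0 <= c0 by rewrite divr_ge0 // sqrtr_ge0.
by rewrite !ler_wpM2r // ?harm_ge ?harm_le.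
Qed.

Lemma integral_grid_min_bounds n :
  ((2 * (Num.sqrt n%:R - 1) * (Num.sqrt m / Num.sqrt (2 * pi)))%:E <=
    \int[P]_w (grid_min a m n w)%:E <=
   (2 * Num.sqrt n%:R * (Num.sqrt m / Num.sqrt (2 * pi)))%:E)%E.
Proof. by rewrite integral_grid_min -integral_grid_max; exact: integral_grid_max_bounds. Qed.

End one_grid.
End brownian_window.

(** * Counting in the range of a sampled path *)

(** The peak is the lattice error per unit length. In this form it is bounded by a constant for
    windows starting after [T1], and by the inverse root of the gap for a pair of windows. *)
Lemma normal_peak_sqrt_le (R : realType) (v : R) : 0 < v ->
  normal_peak (Num.sqrt v) <= (Num.sqrt v)^-1.
Proof.
move=> v0; rewrite /normal_peak (sqr_sqrtr (ltW v0)) lef_pV2 ?posrE ?sqrtr_gt0 //.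
  rewrite ler_wsqrtr // -mulrnAr (ler_peMr (ltW v0)) //.
  have := pi_ge2 R; rewrite mulr2n => h; apply: (le_trans _ (lerD h h)); lra.
by rewrite pmulrn_lgt0 // mulr_gt0 // pi_gt0.
Qed.

Section brownian_counts.
Context {R : realType} {d : measure_display} {Omega : measurableType d}.
Variable P : probability Omega R.
Variable B : R -> {RV P >-> R}.
Hypothesis hB : standard_brownian_motion B.

Definition range_cst : R := 4 / Num.sqrt (2 * pi).

Lemma range_cst_gt0 : 0 < range_cst.
Proof. by rewrite divr_gt0 // sqrtr_gt0 mulr_gt0 // pi_gt0. Qed.

Definition grid_range (a h : R) (n : nat) (w : Omega) : R :=
  grid_max B a (h / n%:R) n w + grid_min B a (h / n%:R) n w.

(* Number of the [r], [-K <= r < K], such that [r / q] lies in the range of [B] over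
   [[a, a + h]], sampled in [n] steps and widened by [th]. *)
Definition wpoints K q (a h : R) (n : nat) (th : R) (w : Omega) : R :=
  npoints K q (bm_inc B 0 a w - grid_min B a (h / n%:R) n w - th)
     (bm_inc B 0 a w + grid_max B a (h / n%:R) n w + th).

Lemma grid_range_ge0 a h n w : 0 <= grid_range a h n w.
Proof. by rewrite addr_ge0 ?grid_max_ge0 ?grid_min_ge0. Qed.

Lemma measurable_grid_range a h n : measurable_fun setT (grid_range a h n).
Proof. by apply: measurable_funD; [exact: measurable_grid_max|exact: measurable_grid_min]. Qed.

Lemma measurable_wpoints K q a h n th : measurable_fun setT (wpoints K q a h n th).
Proof.
apply: measurable_npoints.
  apply: measurable_funB => //; apply: measurable_funB; first exact: measurable_bm_inc.
  exact: measurable_grid_min.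
apply: measurable_funD => //; apply: measurable_funD; first exact: measurable_bm_inc.
exact: measurable_grid_max.
Qed.

Lemma wpoints_ge0 K q a h n th w : 0 <= wpoints K q a h n th w.
Proof. exact: npoints_ge0. Qed.

Section range.
Variables (a h : R) (n : nat).
Hypotheses (a0 : 0 <= a) (h0 : 0 < h) (n0 : (0 < n)%N).
Let m := h / n%:R.
Let m0 : 0 < m. Proof. by rewrite divr_gt0 // ltr0n. Qed.
Let nm : n%:R * m = h. Proof. by rewrite mulrC divfK // pnatr_eq0 -lt0n. Qed.
Let sqrt_nm : Num.sqrt n%:R * Num.sqrt m = Num.sqrt h.
Proof. by rewrite -sqrtrM // nm. Qed.

Let integralD_range : (\int[P]_w (grid_range a h n w)%:E =
   \int[P]_w (grid_max B a m n w)%:E + \int[P]_w (grid_min B a m n w)%:E)%E.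
Proof.
rewrite -ge0_integralD //.
- by move=> w _; rewrite lee_fin grid_max_ge0.
- by apply/measurable_EFinP; exact: measurable_grid_max.
- by move=> w _; rewrite lee_fin grid_min_ge0.
- by apply/measurable_EFinP; exact: measurable_grid_min.
Qed.

Lemma integral_grid_range_le :
  (\int[P]_w (grid_range a h n w)%:E <= (range_cst * Num.sqrt h)%:E)%E.
Proof.
rewrite integralD_range.
have /andP[_ h1] := integral_grid_max_bounds hB a0 m0 n.
have /andP[_ h2] := integral_grid_min_bounds hB a0 m0 n.
apply: (le_trans (leeD h1 h2)); rewrite -EFinD lee_fin -sqrt_nm /range_cst.
by rewrite le_eqVlt; apply/orP; left; apply/eqP; set x := (Num.sqrt (2 * pi))^-1; ring.
Qed.

(** The Spitzer sum is at least [2 * (sqrt n - 1)]; relative to [2 * sqrt n] this is the factor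
    [1 - 1 / sqrt n], the loss due to sampling. *)
Lemma integral_grid_range_ge :
  ((range_cst * Num.sqrt h * (1 - (Num.sqrt n%:R)^-1))%:E <= \int[P]_w (grid_range a h n w)%:E)%E.
Proof.
rewrite integralD_range.
have /andP[h1 _] := integral_grid_max_bounds hB a0 m0 n.
have /andP[h2 _] := integral_grid_min_bounds hB a0 m0 n.
apply: (le_trans _ (leeD h1 h2)); rewrite -EFinD lee_fin -sqrt_nm /range_cst.
rewrite le_eqVlt; apply/orP; left; apply/eqP; set x := (Num.sqrt (2 * pi))^-1.
have sn0 : Num.sqrt n%:R != 0 :> R by rewrite gt_eqF // sqrtr_gt0 ltr0n.
move: x; set y := Num.sqrt n%:R in sn0 *; move=> x; field.
exact: sn0.
Qed.

Lemma integral_grid_range_sqr_le :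
  (\int[P]_w (grid_range a h n w ^+ 2)%:E <= (128 * h)%:E)%E.
Proof.
have M0 := integral_grid_max_sqr_le hB a0 m0 n.
have N0 := integral_grid_min_sqr_le hB a0 m0 n.
have mM : measurable_fun setT (fun w => (grid_max B a m n w ^+ 2)%:E).
  by apply/measurable_EFinP/measurable_funX; exact: measurable_grid_max.
have mN : measurable_fun setT (fun w => (grid_min B a m n w ^+ 2)%:E).
  by apply/measurable_EFinP/measurable_funX; exact: measurable_grid_min.
(* By [(x + y) ^+ 2 <= 2 * (x ^+ 2 + y ^+ 2)], and each of the two extremes contributes [32 * h]:
   hence 128. *)
apply: (@le_trans _ _ (\int[P]_w (2%:E * ((grid_max B a m n w ^+ 2)%:E + (grid_min B a m n w ^+ 2)%:E)))%E).
  apply: ge0_le_integral => //.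
  - by move=> w _; rewrite lee_fin sqr_ge0.
  - by apply/measurable_EFinP/measurable_funX; exact: measurable_grid_range.
  - by apply: emeasurable_funM => //; exact: emeasurable_funD.
  - move=> w _; rewrite -EFinD -EFinM lee_fin /grid_range -/m.
    have := sqr_ge0 (grid_max B a m n w - grid_min B a m n w); lra.
rewrite ge0_integralZl //; last 2 first.
- exact: emeasurable_funD.
- by move=> w _; rewrite -EFinD lee_fin addr_ge0 // sqr_ge0.
rewrite ge0_integralD //; last 2 first.
- by move=> w _; rewrite lee_fin sqr_ge0.
- by move=> w _; rewrite lee_fin sqr_ge0.
rewrite (_ : 128 * h = 2 * (32 * (n%:R * m) + 32 * (n%:R * m))); last by rewrite nm; ring.
by rewrite EFinM lee_pmul2l // EFinD; exact: leeD.
Qed.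

End range.

(** * Independence between two disjoint windows and the gap separating them *)

Section two_windows.
Variables (a b h : R) (n : nat).
Hypotheses (a0 : 0 <= a) (h0 : 0 < h) (n0 : (0 < n)%N) (ab : a + h <= b).
Let m := h / n%:R.
Let m0 : 0 < m. Proof. by rewrite divr_gt0 // ltr0n. Qed.
Let nm : n%:R * m = h. Proof. by rewrite mulrC divfK // pnatr_eq0 -lt0n. Qed.

(* The times 0, then the grid of [[a, a + h]], then the grid of [[b, b + h]]. *)
Let time (k : nat) : R :=
  if k == 0%N then 0 else if (k <= n.+1)%N then a + k.-1%:R * m
  else b + (k - n.+2)%:R * m.

Let time_nd : nondecreasing_seq time.
Proof.
apply/nondecreasing_seqP => k; rewrite /time.
case: k => [|k] /=; first by rewrite mul0r addr0.
case: (leqP k.+2 n.+1) => h1.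
  by rewrite (ltnW h1) lerD2l (ler_wpM2r (ltW m0)) // ler_nat.
case: (leqP k.+1 n.+1) => h2.
  have -> : k = n by lia.
  by rewrite subnn mul0r addr0 nm.
by rewrite lerD2l (ler_wpM2r (ltW m0)) // ler_nat; lia.
Qed.

Let Z i : Omega -> R := bm_inc B (time i) (time i.+1).
Let mZ i : measurable_fun setT (Z i). Proof. exact: measurable_bm_inc. Qed.
Let iZ N : mutually_independent P (fun i : 'I_N => Z i).
Proof. by have := @bm_indep_increments _ _ _ _ _ hB N time; apply. Qed.

Let Z_first : Z 0%N = bm_inc B 0 a.
Proof. by rewrite /Z /time /= mul0r addr0. Qed.

Let Z_left i : (i < n)%N -> Z i.+1 = grid_inc B a m i.
Proof. by move=> iN; rewrite /Z /time /= !ltnS iN (ltnW iN). Qed.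

Let Z_gap : Z n.+1 = bm_inc B (a + h) b.
Proof. by rewrite /Z /time /= ltnn leqnn subnn mul0r addr0 nm. Qed.

Let Z_right i : Z (n.+2 + i)%N = grid_inc B b m i.
Proof.
rewrite /Z /time /= addSn /=.
have -> : ((n.+1 + i).+1 <= n.+1)%N = false by lia.
have -> : ((n.+1 + i).+2 <= n.+1)%N = false by lia.
have e1 : ((n.+1 + i).+1 - n.+2 = i)%N by lia.
have e2 : ((n.+1 + i).+2 - n.+2 = i.+1)%N by lia.
by rewrite e1 e2.
Qed.

Lemma indep_start_grid :
  indep_rv P (bm_inc B 0 a) (tuple_rv (fun i : 'I_n => grid_inc B a m i)).
Proof.
have H : indep_rv P (tuple_rv (fun _ : 'I_1 => Z 0%N)) (tuple_rv (fun i : 'I_n => Z i.+1)).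
  apply: (@indep_rv_subfamilies _ _ _ P n.+1 1 n (fun i => Z i)
    (fun _ => ord0) (fun i => lift ord0 i)) => //.
  - by move=> i j _; rewrite !ord1.
  - exact: lift_inj.
have -> : bm_inc B 0 a = (fun t : 1.-tuple R => tnth t ord0) \o tuple_rv (fun _ : 'I_1 => Z 0%N).
  by apply/funext => w /=; rewrite tnth_mktuple Z_first.
have -> : tuple_rv (fun i : 'I_n => grid_inc B a m i) = id \o tuple_rv (fun i : 'I_n => Z i.+1).
  congr tuple_rv; by apply/funext => i; rewrite Z_left.
apply: indep_rv_comp H => //; exact: measurable_tnth.
Qed.

(** The increments up to time [a + h], starting from time 0, and those of the second grid; the gap
    increment [Z n.+1] is left out of both. *)
Let past (w : Omega) : n.+1.-tuple R := tuple_rv (fun i : 'I_n.+1 => Z i) w.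
Let future (w : Omega) : n.-tuple R := tuple_rv (fun i : 'I_n => Z (n.+2 + i)%N) w.

Let futureE w : future w = mkseq (grid_inc B b m ^~ w) n :> seq R.
Proof.
rewrite /future -(tuple_rv_mkseq n (grid_inc B b m)); congr tuple_rv.
by apply/funext => i; exact: Z_right.
Qed.

Let past_head w : thead (past w) = bm_inc B 0 a w.
Proof. by rewrite /thead tnth_mktuple Z_first. Qed.

Let past_behead w : behead (past w) = mkseq (grid_inc B a m ^~ w) n :> seq R.
Proof.
rewrite /past tuple_rv_mkseq /mkseq /= (iotaDl 1 0) -map_comp.
apply/eq_in_map => i; rewrite mem_iota add0n => /andP[_ iN] /=.
by rewrite add1n Z_left.
Qed.

Let past_sum w : \sum_(i < n.+1) tnth (past w) i = bm_inc B 0 (a + h) w.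
Proof.
under eq_bigr do rewrite tnth_mktuple.
rewrite -(big_mkord predT (fun i => Z i w)) /Z /bm_inc.
rewrite (telescope_sumr (fun i => B (time i) w)) //.
by rewrite /time /= leqnn nm.
Qed.

Let indep_past_future : indep_rv P past future.
Proof.
have H : indep_rv P (tuple_rv (fun i : 'I_n.+1 => Z (lshift n (lift ord_max i))))
    (tuple_rv (fun i : 'I_n => Z (rshift n.+2 i))).
  apply: (@indep_rv_subfamilies _ _ _ P (n.+2 + n) n.+1 n (fun i => Z i)
      (fun i => lshift n (lift ord_max i)) (fun i => rshift n.+2 i)) => //.
  - by move=> i j /lshift_inj /lift_inj.
  - by move=> i j /rshift_inj.
  - by move=> i j; rewrite eq_lrshift.
rewrite (_ : past = tuple_rv (fun i : 'I_n.+1 => Z (lshift n (lift ord_max i)))) //.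
congr tuple_rv; apply/funext => i; congr Z; rewrite /= /bump.
by rewrite leqNgt ltn_ord.
Qed.

Let all_but_gap (w : Omega) : (n.+1 + n).-tuple R :=
  tuple_rv (fun i : 'I_(n.+1 + n) => Z (bump n.+1 i)) w.

(** All increments except that of the gap are collected in one tuple, whose index is shifted past
    [n.+1] by [bump]; its two halves are then read off as past and future. *)
Let indep_gap : indep_rv P (bm_inc B (a + h) b) (fun w => (past w, future w)).
Proof.
have on : (n.+1 < (n.+1 + n).+1)%N by rewrite ltnS leq_addr.
have H : indep_rv P (tuple_rv (fun _ : 'I_1 => Z n.+1)) all_but_gap.
  apply: (@indep_rv_subfamilies _ _ _ P (n.+1 + n).+1 1 (n.+1 + n) (fun i => Z i)
      (fun _ => Ordinal on) (fun i => lift (Ordinal on) i)) => //.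
  - by move=> i j _; rewrite !ord1.
  - exact: lift_inj.
  - by move=> i j; exact: neq_lift.
pose g (t : (n.+1 + n).-tuple R) := ([tuple tnth t (lshift n i) | i < n.+1],
   [tuple tnth t (rshift n.+1 i) | i < n]).
have mg : measurable_fun setT g.
  by apply: measurable_fun_pair; exact: measurable_subtuple.
have -> : bm_inc B (a + h) b = (fun t : 1.-tuple R => tnth t ord0) \o tuple_rv (fun _ : 'I_1 => Z n.+1).
  by apply/funext => w /=; rewrite tnth_mktuple Z_gap.
have -> : (fun w => (past w, future w)) = g \o all_but_gap.
  apply/funext => w; congr pair; apply: eq_from_tnth => i; rewrite !tnth_mktuple; congr (Z _ w).
    by rewrite /bump /= leqNgt ltn_ord.
  by rewrite /bump /= leq_addr.
apply: indep_rv_comp H => //; exact: measurable_tnth.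
Qed.

(** The count of the first window as a function of the past: the head of the tuple is the position
    at time [a], the tail the grid increments. *)
Let count (K : nat) (q : R) (t : n.+1.-tuple R) : R :=
  npoints K q (thead t - max_psum (map -%R (behead t))) (thead t + max_psum (behead t)).

Let measurable_count K q : measurable_fun setT (count K q).
Proof.
have mh : measurable_fun setT (fun t : n.+1.-tuple R => thead t) by exact: measurable_tnth.
apply: measurable_npoints.
  apply: measurable_funB => //.
  exact: (measurableT_comp (@measurable_max_psum_opp R n) (@measurable_behead _ _ n)).
apply: measurable_funD => //.
exact: (measurableT_comp (@measurable_max_psum_tuple R n) (@measurable_behead _ _ n)).
Qed.

Let count_past K q w : count K q (past w) = wpoints K q a h n 0 w.
Proof. by rewrite /count past_head past_behead /wpoints subr0 addr0. Qed.

Lemma indep_wpoints_range K q :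
  indep_rv P (wpoints K q a h n 0) (grid_range b h n).
Proof.
have -> : wpoints K q a h n 0 = count K q \o past.
  by apply/funext => w; rewrite /comp count_past.
have -> : grid_range b h n = (fun t : n.-tuple R => max_psum t + max_psum (map -%R t)) \o future.
  by apply/funext => w; rewrite [RHS]/comp futureE.
apply: indep_rv_comp indep_past_future => //.
by apply: measurable_funD; [exact: measurable_max_psum_tuple|exact: measurable_max_psum_opp].
Qed.

(** The bundle is all that the product of the two counts depends on besides the gap increment: the
    first count, the position where the gap begins, and the extremes of the second window relative
    to its start. *)
Lemma indep_gap_stats K q :
  indep_rv P (bm_inc B (a + h) b) (fun w =>
    (wpoints K q a h n 0 w, bm_inc B 0 (a + h) w, (grid_min B b m n w, grid_max B b m n w))).
Proof.
pose g (x : n.+1.-tuple R * n.-tuple R) :=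
  (count K q x.1, \sum_(i < n.+1) tnth x.1 i, (max_psum (map -%R x.2), max_psum x.2)).
have mg : measurable_fun [set: n.+1.-tuple R * n.-tuple R] g.
  apply: measurable_fun_pair; apply: measurable_fun_pair.
  - exact: (measurableT_comp (measurable_count K q) measurable_fst).
  - apply: measurable_sum => i.
    exact: (measurableT_comp (@measurable_tnth _ R n.+1 i) measurable_fst).
  - exact: (measurableT_comp (@measurable_max_psum_opp R n) measurable_snd).
  - exact: (measurableT_comp (@measurable_max_psum_tuple R n) measurable_snd).
have -> : (fun w =>
    (wpoints K q a h n 0 w, bm_inc B 0 (a + h) w, (grid_min B b m n w, grid_max B b m n w))) =
    g \o (fun w => (past w, future w)).
  by apply/funext => w; rewrite /g /comp /= count_past past_sum futureE.
exact: (indep_rv_comp (f := id) _ mg indep_gap).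
Qed.

End two_windows.

(** * Moments of the count of a single window *)

Section one_window.
Variables (a h q : R) (n : nat).
Hypotheses (a0 : 0 < a) (h0 : 0 < h) (q0 : 0 < q) (n0 : (0 < n)%N).

Let grid (w : Omega) : n.-tuple R := tuple_rv (fun i : 'I_n => grid_inc B a (h / n%:R) i) w.
Let mgrid : measurable_fun setT grid.
Proof. by apply: measurable_tuple_rv => i; exact: measurable_bm_inc. Qed.
Let igrid : indep_rv P (bm_inc B 0 a) grid.
Proof. exact: (indep_start_grid (b := a + h) (ltW a0) h0 n0 (lexx _)). Qed.
Let law0 A : measurable A -> P (bm_inc B 0 a @^-1` A) = normal_prob 0 (Num.sqrt a) A.
Proof. by move=> mA; have := bm_inc_law hB (lexx 0) a0 mA; rewrite subr0. Qed.
Let sa0 : 0 < Num.sqrt a. Proof. by rewrite sqrtr_gt0. Qed.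

(** The ends of the widened range relative to the position at time [a], which is the independent
    Gaussian shift. *)
Let lo th (t : n.-tuple R) := - max_psum (map -%R t) - th.
Let hi th (t : n.-tuple R) := max_psum t + th.
Let mlo th : measurable_fun setT (lo th).
Proof.
apply: measurable_funB => //.
by apply: (measurableT_comp (@oppr_measurable R setT)); exact: measurable_max_psum_opp.
Qed.
Let mhi th : measurable_fun setT (hi th).
Proof. by apply: measurable_funD => //; exact: measurable_max_psum_tuple. Qed.
Let lohi th t : 0 <= th -> lo th t <= hi th t.
Proof.
move=> th0; rewrite /lo /hi.
have := max_psum_ge0 t; have := max_psum_ge0 (map -%R t); lra.
Qed.
Let gridE w : grid w = mkseq (grid_inc B a (h / n%:R) ^~ w) n :> seq R.
Proof. exact: tuple_rv_mkseq. Qed.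
Let wpointsE K th w : wpoints K q a h n th w =
  npoints K q (bm_inc B 0 a w + lo th (grid w)) (bm_inc B 0 a w + hi th (grid w)).
Proof. by rewrite /wpoints /lo /hi gridE !addrA. Qed.
Let rangeE th w : hi th (grid w) - lo th (grid w) = grid_range a h n w + 2 * th.
Proof. rewrite /hi /lo gridE /grid_range /grid_max /grid_min; lra. Qed.

Let integral_range_le th : 0 <= th ->
  (\int[P]_w (grid_range a h n w + 2 * th)%:E <= (range_cst * Num.sqrt h + 2 * th)%:E)%E.
Proof.
move=> th0; under eq_integral do rewrite EFinD.
rewrite ge0_integralD //; last 3 first.
- by move=> w _; rewrite lee_fin grid_range_ge0.
- by apply/measurable_EFinP; exact: measurable_grid_range.
- by move=> w _; rewrite lee_fin mulr_ge0.
rewrite integral_cst // [X in (_ * X)%E](_ : _ = 1)%E; last exact: probability_setT.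
rewrite mule1 EFinD.
by apply: leeD => //; exact: (integral_grid_range_le (ltW a0) h0 n0).
Qed.

Let pk_le : q + normal_peak (Num.sqrt a) <= q + (Num.sqrt a)^-1.
Proof. by rewrite lerD2l normal_peak_sqrt_le. Qed.

Lemma integral_wpoints_le K th : 0 <= th ->
  (\int[P]_w (wpoints K q a h n th w)%:E <=
   ((q + (Num.sqrt a)^-1) * (range_cst * Num.sqrt h + 2 * th))%:E)%E.
Proof.
move=> th0.
have := @integral_npoints_mul_le _ _ _ P _ _ _ _ (measurable_bm_inc B 0 a) mgrid igrid _ _
  sa0 q0 law0 _ _ (mlo th) (mhi th) (fun t => lohi t th0) (fun _ => 1) K
  (measurable_cst _) (fun _ => ler01).
under eq_integral do rewrite mulr1 -wpointsE.
under [X in (_ <= _ * X)%E -> _]eq_integral do rewrite mulr1 rangeE.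
move=> H; apply: (le_trans H); rewrite EFinM; apply: lee_pmul => //.
- by rewrite lee_fin addr_ge0 ?normal_peak_ge0 // ltW.
- by apply: integral_ge0 => w _; rewrite lee_fin addr_ge0 ?grid_range_ge0 // mulr_ge0.
- exact: integral_range_le.
Qed.

Lemma integral_wpoints_ge r : (Num.sqrt a)^-1 <= q ->
  r < (q - (Num.sqrt a)^-1) * (range_cst * Num.sqrt h * (1 - (Num.sqrt n%:R)^-1)) ->
  exists K0, forall K, (K0 <= K)%N -> (r%:E < \int[P]_w (wpoints K q a h n 0 w)%:E)%E.
Proof.
move=> qa hr.
have := @integral_npoints_ge _ _ _ P _ _ _ _ (measurable_bm_inc B 0 a) mgrid igrid _ _
  sa0 q0 law0 _ _ (mlo 0) (mhi 0) (fun t => lohi t (lexx 0)) r.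
have -> : (\int[P]_w (hi 0 (grid w) - lo 0 (grid w))%:E = \int[P]_w (grid_range a h n w)%:E)%E.
  by apply: eq_integral => w _; rewrite rangeE mulr0 addr0.
have J1 := integral_grid_range_le (ltW a0) h0 n0.
have J2 := integral_grid_range_ge (ltW a0) h0 n0.
move=> /(_ (le_lt_trans J1 (ltry _))).
have pk1 : normal_peak (Num.sqrt a) <= (Num.sqrt a)^-1 by exact: normal_peak_sqrt_le.
have h1 : (r%:E < (q - normal_peak (Num.sqrt a))%:E * \int[P]_w (grid_range a h n w)%:E)%E.
  apply: (@lt_le_trans _ _ ((q - (Num.sqrt a)^-1)%:E * \int[P]_w (grid_range a h n w)%:E)%E).
    apply: (@lt_le_trans _ _ (((q - (Num.sqrt a)^-1) *
       (range_cst * Num.sqrt h * (1 - (Num.sqrt n%:R)^-1)))%:E)); first by rewrite lte_fin.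
    by rewrite EFinM lee_wpmul2l // lee_fin subr_ge0.
  rewrite lee_wpmul2r //; last by rewrite lee_fin lerD2l lerN2.
  by apply: integral_ge0 => w _; rewrite lee_fin grid_range_ge0.
move=> /(_ h1) [K0 HK]; exists K0 => K /HK.
by under eq_integral do rewrite -wpointsE.
Qed.

(** One factor of the square is bounded pathwise by [1 + q * grid_range]; the other is left to the
    weighted lattice estimate. This yields the mean range plus [q] times its second moment. *)
Lemma integral_wpoints_sqr_le K :
  (\int[P]_w (wpoints K q a h n 0 w ^+ 2)%:E <=
   ((q + (Num.sqrt a)^-1) * (range_cst * Num.sqrt h + q * (128 * h)))%:E)%E.
Proof.
pose g (t : n.-tuple R) := 1 + q * (hi 0 t - lo 0 t).
have mg : measurable_fun setT g.
  apply: measurable_funD => //; apply: measurable_funM => //; exact: measurable_funB.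
have g0 t : 0 <= g t by rewrite addr_ge0 // mulr_ge0 ?subr_ge0 ?lohi // ltW.
have mw : measurable_fun setT (wpoints K q a h n 0) by exact: measurable_wpoints.
have gE w : g (grid w) = 1 + q * grid_range a h n w by rewrite /g rangeE mulr0 addr0.
have mgw : measurable_fun setT (fun w => g (grid w)) by apply: (measurableT_comp mg).
apply: (@le_trans _ _ (\int[P]_w (wpoints K q a h n 0 w * g (grid w))%:E)%E).
  apply: ge0_le_integral => //.
  - by move=> w _; rewrite lee_fin sqr_ge0.
  - by apply/measurable_EFinP; exact: measurable_funX.
  - by apply/measurable_EFinP; exact: measurable_funM.
  - move=> w _; rewrite lee_fin expr2 ler_wpM2l ?wpoints_ge0 //.
    rewrite wpointsE; apply: (le_trans (npoints_le _ q0 _)).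
      by rewrite lerD2l lohi.
    by rewrite /g opprD addrACA subrr add0r.
have := @integral_npoints_mul_le _ _ _ P _ _ _ _ (measurable_bm_inc B 0 a) mgrid igrid _ _
  sa0 q0 law0 _ _ (mlo 0) (mhi 0) (fun t => lohi t (lexx 0)) g K mg g0.
under eq_integral do rewrite -wpointsE.
move=> H; apply: (le_trans H) => {H}.
rewrite EFinM; apply: lee_pmul => //.
- by rewrite lee_fin addr_ge0 ?normal_peak_ge0 // ltW.
- by apply: integral_ge0 => w _; rewrite lee_fin mulr_ge0 // subr_ge0 lohi.
rewrite (_ : (fun w => _) = fun w => ((grid_range a h n w)%:E + q%:E * (grid_range a h n w ^+ 2)%:E)%E); last first.
  by apply/funext => w; rewrite gE rangeE mulr0 addr0 -EFinM -EFinD; congr (_%:E); ring.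
have mr : measurable_fun setT (fun w => (grid_range a h n w ^+ 2)%:E).
  by apply/measurable_EFinP/measurable_funX; exact: measurable_grid_range.
rewrite ge0_integralD //; last 4 first.
- by move=> w _; rewrite lee_fin grid_range_ge0.
- by apply/measurable_EFinP; exact: measurable_grid_range.
- by move=> w _; rewrite -EFinM lee_fin mulr_ge0 ?sqr_ge0 // ltW.
- exact: emeasurable_funM.
rewrite EFinD; apply: leeD; first exact: (integral_grid_range_le (ltW a0) h0 n0).
rewrite ge0_integralZl //; last 2 first.
- by move=> w _; rewrite lee_fin sqr_ge0.
- by rewrite lee_fin ltW.
rewrite EFinM lee_wpmul2l ?lee_fin ?(ltW q0) //.
exact: (integral_grid_range_sqr_le (ltW a0) h0 n0).
Qed.

End one_window.

(* The increment over the gap [[a + h, b]] is independent of the first count, of the path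
   before the gap and of the second window, so it smooths the second count. *)
Lemma integral_wpoints_mul_le K q q' a b h n :
  0 < a -> 0 < h -> 0 < q -> 0 < q' -> (0 < n)%N -> a + h < b ->
  (\int[P]_w (wpoints K q a h n 0 w * wpoints K q' b h n 0 w)%:E <=
   ((q + (Num.sqrt a)^-1) * (q' + (Num.sqrt (b - (a + h)))^-1) *
     (range_cst * Num.sqrt h) ^+ 2)%:E)%E.
Proof.
move=> a0 h0 q0 q'0 n0 ab.
have s0 : 0 < Num.sqrt (b - (a + h)) by rewrite sqrtr_gt0 subr_gt0.
have ah0 : 0 <= a + h by rewrite addr_ge0 // ltW.
have law A : measurable A -> P (bm_inc B (a + h) b @^-1` A) =
    normal_prob 0 (Num.sqrt (b - (a + h))) A.
  by move=> mA; exact: (bm_inc_law hB ah0 ab).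
pose T : Type := (R * R * (R * R))%type.
pose W w : R * R * (R * R) :=
    (wpoints K q a h n 0 w, bm_inc B 0 (a + h) w,
    (grid_min B b (h / n%:R) n w, grid_max B b (h / n%:R) n w)).
have mW : measurable_fun setT W.
  apply: measurable_fun_pair; apply: measurable_fun_pair.
  - exact: measurable_wpoints.
  - exact: measurable_bm_inc.
  - exact: measurable_grid_min.
  - exact: measurable_grid_max.
have iW : indep_rv P (bm_inc B (a + h) b) W.
  exact: (indep_gap_stats (ltW a0) h0 n0 (ltW ab)).
(* The absolute values make [lo <= hi] and [0 <= g] hold for all tuples; on the values taken by [W]
   they change nothing. *)
pose lo (t : R * R * (R * R)) := t.1.2 - `|t.2.1|.
pose hi (t : R * R * (R * R)) := t.1.2 + `|t.2.2|.
pose g (t : R * R * (R * R)) := `|t.1.1|.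
have m12 : measurable_fun [set: R * R * (R * R)] (fun t : R * R * (R * R) => t.1.2).
  exact: (measurableT_comp measurable_snd measurable_fst).
have m11 : measurable_fun [set: R * R * (R * R)] (fun t : R * R * (R * R) => t.1.1).
  exact: (measurableT_comp measurable_fst measurable_fst).
have m21 : measurable_fun [set: R * R * (R * R)] (fun t : R * R * (R * R) => t.2.1).
  exact: (measurableT_comp measurable_fst measurable_snd).
have m22 : measurable_fun [set: R * R * (R * R)] (fun t : R * R * (R * R) => t.2.2).
  exact: (measurableT_comp measurable_snd measurable_snd).
have mlo : measurable_fun setT lo by apply: measurable_funB => //; exact: measurableT_comp.
have mhi : measurable_fun setT hi by apply: measurable_funD => //; exact: measurableT_comp.
have mg : measurable_fun setT g by exact: measurableT_comp.
have lohi t : lo t <= hi t.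
  rewrite /lo /hi; have := normr_ge0 t.2.1; have := normr_ge0 t.2.2; lra.
have := @integral_npoints_mul_le _ _ _ P _ _ _ _ (measurable_bm_inc B (a + h) b) mW iW _ _
  s0 q'0 law _ _ mlo mhi lohi g K mg (fun t => normr_ge0 _).
(* The position at [b] is the position at [a + h] plus the gap increment, so the second count is a
   count around an independent Gaussian. *)
have E1 w : npoints K q' (bm_inc B (a + h) b w + lo (W w)) (bm_inc B (a + h) b w + hi (W w)) * g (W w)
    = wpoints K q a h n 0 w * wpoints K q' b h n 0 w.
  rewrite mulrC /g /= ger0_norm ?wpoints_ge0 //; congr (_ * _).
  rewrite [RHS]/wpoints subr0 addr0 /lo /hi /= !ger0_norm ?grid_min_ge0 ?grid_max_ge0 //.
  by congr npoints; rewrite /bm_inc; ring.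
have E2 w : (hi (W w) - lo (W w)) * g (W w) = wpoints K q a h n 0 w * grid_range b h n w.
  rewrite mulrC /g /= ger0_norm ?wpoints_ge0 //; congr (_ * _).
  rewrite /lo /hi /= !ger0_norm ?grid_min_ge0 ?grid_max_ge0 // /grid_range; ring.
under eq_integral do rewrite E1.
under [X in (_ <= _ * X)%E -> _]eq_integral do rewrite E2.
move=> H; apply: (le_trans H) => {H}.
have mw : measurable_fun setT (wpoints K q a h n 0) by exact: measurable_wpoints.
have mr : measurable_fun setT (grid_range b h n) by exact: measurable_grid_range.
have w0 := wpoints_ge0 K q a h n 0.
have r0 := grid_range_ge0 b h n.
have b0 : 0 < b by lra.
(* A second use of independence: the first count depends on times up to [a + h], the second range on
   increments after [b]. *)
have -> : (\int[P]_w (wpoints K q a h n 0 w * grid_range b h n w)%:E =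
   \int[P]_w (wpoints K q a h n 0 w)%:E * \int[P]_w (grid_range b h n w)%:E)%E.
  pose f (x : R * R) : \bar R := (`|x.1|%:E * `|x.2|%:E)%E.
  have mf : measurable_fun [set: R * R] f.
    by apply: emeasurable_funM; apply/measurable_EFinP; apply: measurableT_comp.
  have f0 x : (0 <= f x)%E by rewrite /f -EFinM lee_fin mulr_ge0.
  have ir := indep_wpoints_range (ltW a0) h0 n0 (ltW ab) K q.
  transitivity (\int[P]_w f (wpoints K q a h n 0 w, grid_range b h n w))%E.
    by apply: eq_integral => w _; rewrite /f /= !ger0_norm.
  rewrite (indep_rv_tonelli mw mr ir mf f0).
  transitivity (\int[P]_w (\int[P]_w' (wpoints K q a h n 0 w')%:E * (grid_range b h n w)%:E))%E.
    apply: eq_integral => w _; rewrite /f /= (ger0_norm (r0 w)).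
    under eq_integral do rewrite (ger0_norm (w0 _)).
    rewrite ge0_integralZr //.
    - exact/measurable_EFinP.
    - by move=> x _; rewrite lee_fin.
    - by rewrite lee_fin.
  rewrite ge0_integralZl //.
  - exact/measurable_EFinP.
  - by move=> x _; rewrite lee_fin.
  - by apply: integral_ge0 => w _; rewrite lee_fin.
have h1 := integral_wpoints_le a0 h0 q0 n0 K (lexx 0).
rewrite mulr0 addr0 in h1.
have h2 := integral_grid_range_le (ltW b0) h0 n0.
rewrite (_ : _ * _ * _ = (q' + (Num.sqrt (b - (a + h)))^-1) *
   ((q + (Num.sqrt a)^-1) * (range_cst * Num.sqrt h) * (range_cst * Num.sqrt h))); last by rewrite expr2; ring.
rewrite EFinM; apply: lee_pmul => //.
- by rewrite lee_fin addr_ge0 ?normal_peak_ge0 // ltW.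
- by rewrite mule_ge0 //; apply: integral_ge0 => w _; rewrite lee_fin.
- by rewrite lee_fin lerD2l normal_peak_sqrt_le // subr_gt0.
rewrite EFinM; apply: lee_pmul => //; by apply: integral_ge0 => w _; rewrite lee_fin.
Qed.

End brownian_counts.

(** * Properties of a continuous path *)

Section path.
Context {R : realType}.
Variable f : R -> R.
Hypothesis cf : {within `[0, +oo[, continuous f}.

Lemma path_ivt (s t y a b : R) : 0 <= a -> s \in `[a, b] -> t \in `[a, b] ->
  f s < y -> y < f t -> exists2 u, u \in `[a, b] & f u = y.
Proof.
move=> a0 sab tab sy yt.
have key (s' t' : R) : s' <= t' -> s' \in `[a, b] -> t' \in `[a, b] ->
    Num.min (f s') (f t') <= y <= Num.max (f s') (f t') -> exists2 u, u \in `[a, b] & f u = y.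
  move=> st sI tI yI.
  have sub : `[s', t']%classic `<=` `[0, +oo[%classic.
    move=> u /=; rewrite !in_itv /= andbT => /andP[su _]; apply: le_trans su.
    by apply: (le_trans a0); move: sI; rewrite in_itv => /andP[].
  have [u uI fu] := IVT st (continuous_subspaceW sub cf) yI.
  exists u => //; move: uI sI tI; rewrite !in_itv /=; lra.
have [st|ts] := leP s t.
  by apply: (key s t) => //; rewrite ge_min le_max (ltW sy) (ltW yt) orbT.
by apply: (key t s) => //; [exact: ltW|]; rewrite ge_min le_max (ltW sy) (ltW yt) orbT.
Qed.

Lemma dist_graph_le (T1 T2 x y e t : R) : t \in `[T1, T2] -> `|t - x| <= e -> f t = y ->
  dist_graph f T1 T2 (x, y) <= e.
Proof.
move=> tI tx fty; apply: (@le_trans _ _ (Num.max `|t - x| `|f t - y|)).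
  apply: ge_inf; last by exists t.
  by exists 0 => _ [u _ <-]; rewrite le_max normr_ge0.
by rewrite fty subrr normr0 ge_max tx (le_trans _ tx).
Qed.

Lemma dist_graph_lt (T1 T2 x y e : R) : T1 <= T2 -> dist_graph f T1 T2 (x, y) < e ->
  exists t, [/\ t \in `[T1, T2], `|t - x| < e & `|f t - y| < e].
Proof.
move=> T12 h.
have [//|z [t tI <-] zl] := @inf_lt _ [set Num.max `|t - x| `|f t - y| | t in `[T1, T2]] e _ h.
  exists (Num.max `|T1 - x| `|f T1 - y|); exists T1 => //=.
  by rewrite in_itv /= lexx.
by exists t; move: zl; rewrite gt_max => /andP[].
Qed.

Lemma grid_approx (a h t y e : R) : 0 < a -> 0 < h -> t \in `[a, a + h] ->
  `|f t - y| < e ->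
  exists n0, forall n, (n0 <= n)%N ->
    exists2 i, (i <= n)%N & `|f (a + i%:R * (h / n%:R)) - y| < e.
Proof.
move=> a0 h0; rewrite in_itv /= => /andP[at_ th] fty.
have t0 : 0 < t by exact: lt_le_trans at_.
pose e' := e - `|f t - y|.
have e'0 : 0 < e' by rewrite subr_gt0.
(* As [t > 0], continuity within the closed half-line is two-sided continuity at [t]. *)
have [d d0 Hd] : exists2 d, 0 < d & forall u, `|u - t| < d -> `|f u - f t| < e'.
  have /continuous_within_itvcyP[cf0 _] := cf.
  have /cf0 : t \in `]0, +oo[ by rewrite in_itv /= andbT.
  move=> /cvgrPdist_lt /(_ _ e'0) /nbhs_ballP[d /= d0 Hd].
  by exists d => // u ut; rewrite distrC; apply: Hd; rewrite /ball /= distrC.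
exists (Num.truncn (h / d)).+1 => n nn.
have hd0 : 0 <= h / d by rewrite divr_ge0 // ltW.
have n_gt : h / d < n%:R.
  apply: (lt_le_trans (truncnS_gt _)); by rewrite ler_nat.
have n0 : 0 < n%:R :> R by apply: le_lt_trans n_gt.
(* The position of [t] in units of the grid step; its integer part is the index of the last grid
   point not after [t]. *)
pose z := (t - a) * n%:R / h.
have z0 : 0 <= z by rewrite divr_ge0 ?(ltW h0) // mulr_ge0 ?subr_ge0 // ltW.
have zn : z <= n%:R by rewrite ler_pdivrMr // mulrC ler_pM2l //; lra.
have [i1 i2] : (Num.truncn z)%:R <= z /\ z < (Num.truncn z).+1%:R.
  by have /andP[] := truncn_itv z0.
exists (Num.truncn z); first by rewrite -(ler_nat R) (le_trans i1).
set i := (Num.truncn z)%:R in i1 *.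
have i2' : z < i + 1 by rewrite natr1.
set u := a + i * (h / n%:R).
have hn0 : 0 < h / n%:R by rewrite divr_gt0.
have tz : t = a + z * (h / n%:R) by rewrite /z; field; rewrite !gt_eqF.
have ut : `|u - t| < d.
  rewrite tz /u ler0_norm; last by rewrite subr_le0 lerD2l ler_pM2r.
  have hnd : h / n%:R < d by rewrite ltr_pdivrMr // mulrC -ltr_pdivrMr.
  by apply: lt_trans hnd; nra.
have fu := Hd u ut.
rewrite -(subrK (f t) (f u)) -addrA (le_lt_trans (ler_normD _ _)) //.
by rewrite -ltrBrDr.
Qed.

End path.

Section sampled_path.
Context {R : realType} {d : measure_display} {Omega : measurableType d}.
Variable P : probability Omega R.
Variable B : R -> {RV P >-> R}.
Variables (a h : R) (n : nat) (w : Omega).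
Hypothesis B0 : B 0 w = 0.
Let t i := a + i%:R * (h / n%:R).

Lemma grid_max_gt y : (y < bm_inc B 0 a w + grid_max B a (h / n%:R) n w) <->
  exists2 i, (i <= n)%N & y < B (t i) w.
Proof.
have := @lt_max_psum R (fun i => B (t i) w) n y.
by rewrite /t mul0r addr0 /bm_inc B0 subr0.
Qed.

Lemma grid_min_lt y : (bm_inc B 0 a w - grid_min B a (h / n%:R) n w < y) <->
  exists2 i, (i <= n)%N & B (t i) w < y.
Proof.
have := @lt_max_psum R (fun i => - B (t i) w) n (- y).
rewrite /t mul0r addr0.
have -> : max_psum (mkseq (fun i => - B (a + i.+1%:R * (h / n%:R)) w -
    - B (a + i%:R * (h / n%:R)) w) n) = grid_min B a (h / n%:R) n w.
  rewrite /grid_min /mkseq -map_comp; congr max_psum; apply: eq_map => i.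
  by rewrite /= /grid_inc /bm_inc opprB opprK addrC.
move=> H; split.
  move=> h1; have /H [i li h2] : - y < - B a w + grid_min B a (h / n%:R) n w.
    move: h1; rewrite /bm_inc B0; lra.
  by exists i => //; rewrite /t; lra.
move=> [i li h1].
have /H : exists2 i, (i <= n)%N & - y < - B (a + i%:R * (h / n%:R)) w.
  by exists i => //; move: h1; rewrite /t; lra.
rewrite /bm_inc B0; lra.
Qed.

End sampled_path.

(** * Finite lists of triples and the counting measure *)

Section triples.
Context {R : realType}.

Definition zlist (K : nat) : seq int := [seq Posz k | k <- iota 0 K] ++ [seq Negz k | k <- iota 0 K].

Lemma zlist_uniq K : uniq (zlist K).
Proof.
rewrite cat_uniq !map_inj_uniq ?iota_uniq ?andbT //; try by move=> i j [].
by apply/hasPn => _ /mapP[k _ ->]; apply/mapP => -[].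
Qed.

Lemma mem_zlist K (r : int) : (`|r| < K)%N -> r \in zlist K.
Proof.
rewrite mem_cat; case: r => k kK; apply/orP; [left|right]; rewrite map_f // mem_iota /=.
  by rewrite add0n.
by rewrite add0n; move: kK; lia.
Qed.

Definition triples (Q M K : nat) : seq (int * int * int) :=
  [seq (Posz pq.2, Posz pq.1, r) | pq <- [seq (q, p) | q <- iota 1 Q, p <- iota 0 M], r <- zlist K].

Lemma triples_uniq Q M K : uniq (triples Q M K).
Proof.
apply: allpairs_uniq; last by move=> [[q p] r] [[q' p'] r'] _ _ /= [-> -> ->].
  by apply: allpairs_uniq; rewrite ?iota_uniq // => -[q p] [q' p'] _ _ /= [-> ->].
exact: zlist_uniq.
Qed.

Lemma mem_triples Q M K (p q : nat) (r : int) : (1 <= q <= Q)%N -> (p < M)%N -> (`|r| < K)%N ->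
  (Posz p, Posz q, r) \in triples Q M K.
Proof.
move=> /andP[q1 qQ] pM rK.
apply/allpairsP; exists ((q, p), r); split => //=; last exact: mem_zlist.
by apply/allpairsP; exists (q, p); split; rewrite //= mem_iota ?add0n // q1 add1n ltnS.
Qed.

Lemma triplesP Q M K x : x \in triples Q M K ->
  exists p q : nat, exists r : int, [/\ (1 <= q <= Q)%N, (p < M)%N & x = (Posz p, Posz q, r)].
Proof.
move=> /allpairsP[[[q p] r] /= [/allpairsP[[q' p'] /= [qI pI [-> ->]]] rI ->]].
exists p', q', r; split => //; last by rewrite mem_iota add0n in pI.
by rewrite mem_iota add1n ltnS in qI.
Qed.

Lemma count_triples Q M K (E : pred (int * int * int)) :
  (count E (triples Q M K))%:R = \sum_(1 <= q < Q.+1) \sum_(0 <= p < M)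
    zsum K (fun r => (E (Posz p, Posz q, r))%:R) :> R.
Proof.
rewrite -sum1_count natr_sum big_mkcond /=.
rewrite (eq_bigr (fun x => (E x)%:R : R)); last by move=> x _; case: (E x).
rewrite big_allpairs_dep /= big_allpairs_dep /= /index_iota subSS !subn0.
apply: eq_bigr => q _; apply: eq_bigr => p _.
rewrite big_cat /= !big_map /zsum /index_iota subn0 big_split /=.
by [].
Qed.

Lemma count_triples_le_counting Q M K (E : pred (int * int * int)) (A : set (int * int * int)) :
  (forall x, x \in triples Q M K -> E x -> A x) ->
  ((count E (triples Q M K))%:R%:E <= counting A :> \bar R)%E.
Proof.
move=> EA; rewrite /counting; case: asboolP => fA; last by rewrite leey.
rewrite lee_fin ler_nat -size_filter; apply: uniq_leq_size.
  by rewrite filter_uniq // triples_uniq.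
move=> x; rewrite mem_filter => /andP[Ex xt].
by rewrite in_fset_set //; apply/mem_set; exact: EA.
Qed.

Lemma le_limn_einf (u : nat -> \bar R) (c : \bar R) n0 :
  (forall n, (n0 <= n)%N -> (c <= u n)%E) -> (c <= limn_einf u)%E.
Proof.
move=> cu; rewrite limn_einf_lim; apply: lime_ge; first exact: is_cvg_einfs.
exists n0 => // n /= n0n; apply: le_ereal_inf_tmp => _ [k /= nk <-].
by apply: cu; exact: leq_trans nk.
Qed.

(** Every finite subset of [A] is eventually contained in the lists, so its cardinality bounds the
    lower limit from below. Arguing by finite subsets also covers an infinite [A], for which the
    lower limit is infinite. *)
Lemma counting_le_limn_einf Q M (E : nat -> pred (int * int * int)) (A : set (int * int * int)) :
  (forall x, A x -> exists n0, forall n, (n0 <= n)%N -> x \in triples Q M n /\ E n x) ->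
  (counting A <= limn_einf (fun n => (count (E n) (triples Q M n))%:R%:E) :> \bar R)%E.
Proof.
move=> AE.
have key (F : {fset int * int * int}) : [set` F] `<=` A ->
    exists n0, forall n, (n0 <= n)%N -> (#|` F | <= count (E n) (triples Q M n))%N.
  move=> FA.
  have gen (s : seq (int * int * int)) : (forall x, x \in s -> A x) ->
      exists n0, forall n, (n0 <= n)%N -> forall x, x \in s -> x \in triples Q M n /\ E n x.
    elim: s => [_|x s IH sA]; first by exists 0%N.
    have [n1 H1] := IH (fun y ys => sA y (mem_behead (s := x :: s) ys)).
    have [n2 H2] := AE x (sA x (mem_head _ _)).
    exists (maxn n1 n2) => n; rewrite geq_max => /andP[n1n n2n] y.
    by rewrite inE => /orP[/eqP ->|ys]; [exact: H2|exact: H1].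
  have [n0 Hn0] := gen (enum_fset F) FA.
  exists n0 => n n0n; rewrite -size_filter; apply: uniq_leq_size; first exact: fset_uniq.
  by move=> x xF; have [xt Ex] := Hn0 n n0n x xF; rewrite mem_filter Ex.
have key2 (F : {fset int * int * int}) : [set` F] `<=` A ->
    ((#|` F |)%:R%:E <= limn_einf (fun n => (count (E n) (triples Q M n))%:R%:E) :> \bar R)%E.
  move=> /key[n0 H]; apply: (le_limn_einf (n0 := n0)) => n /H.
  by rewrite lee_fin ler_nat.
rewrite /counting; case: asboolP => fA.
  by apply: key2; rewrite fset_setK.
rewrite leye_eq; apply/eqP/eq_infty => t.
have [F FA tF] := infinite_set_fset (Num.truncn t).+1 fA.
apply: le_trans (key2 F FA); rewrite lee_fin; apply/ltW/(lt_le_trans (truncnS_gt _)).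
by rewrite ler_nat.
Qed.

End triples.

(** * Fractions with bounded denominator *)

Section fractions.
Context {R : realType}.

Definition pairs (Q M : nat) : seq (nat * nat) := [seq (q, p) | q <- iota 1 Q, p <- iota 0 M].

Definition slope (z : nat * nat) : R := z.2%:R / z.1%:R.

Lemma big_pairs Q M (C : pred (nat * nat)) (F : nat * nat -> R) :
  \sum_(z <- pairs Q M | C z) F z =
  \sum_(1 <= q < Q.+1) \sum_(0 <= p < M | C (q, p)) F (q, p).
Proof.
rewrite big_mkcond big_allpairs_dep /= /index_iota subSS !subn0.
by apply: eq_bigr => q _; rewrite [RHS]big_mkcond.
Qed.

Lemma pairsP Q M z : z \in pairs Q M -> (1 <= z.1 <= Q)%N /\ (z.2 < M)%N.
Proof.
move=> /allpairsP[[q p] /= [+ + ->]] /=.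
by rewrite !mem_iota add0n add1n ltnS.
Qed.

Lemma count_nat_interval (C D : int) M :
  \sum_(0 <= p < M) (((C <= p%:Z) && (p%:Z <= D))%:R : int) =
  Num.max 0 (Num.min D (M%:Z - 1) - Num.max C 0 + 1).
Proof.
elim: M => [|M IH]; first by rewrite big_geq //; lia.
by rewrite big_nat_recr //= IH; lia.
Qed.

Let in_itv_frac (q : nat) (c d : R) (p : nat) : (0 < q)%N ->
  ((c <= p%:R / q%:R) && (p%:R / q%:R <= d))%:R =
  (((Num.ceil (c * q%:R) <= p%:Z) && (p%:Z <= Num.floor (d * q%:R)))%:R : int)%:~R :> R.
Proof.
move=> q0; have q0' : 0 < q%:R :> R by rewrite ltr0n.
rewrite ceil_le_int floor_ge_int ler_pdivlMr // ler_pdivrMr //.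
by rewrite mulrz_nat.
Qed.

Let count_fracE (q M : nat) (c d : R) : (0 < q)%N ->
  \sum_(0 <= p < M) ((c <= p%:R / q%:R) && (p%:R / q%:R <= d))%:R =
  (Num.max 0 (Num.min (Num.floor (d * q%:R)) (M%:Z - 1) -
      Num.max (Num.ceil (c * q%:R)) 0 + 1))%:~R :> R.
Proof.
move=> q0; rewrite -count_nat_interval raddf_sum /=; apply: eq_bigr => p _.
exact: in_itv_frac.
Qed.

Lemma count_frac_le (q M : nat) (c d : R) : (0 < q)%N -> c <= d ->
  \sum_(0 <= p < M) ((c <= p%:R / q%:R) && (p%:R / q%:R <= d))%:R <= q%:R * (d - c) + 1 :> R.
Proof.
move=> q0 cd; rewrite count_fracE //.
have q0' : 0 < q%:R :> R by rewrite ltr0n.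
have h1 := floor_le (d * q%:R); have h2 := ceil_ge (c * q%:R).
set D := Num.floor _ in h1 *; set C := Num.ceil _ in h2 *.
apply: (@le_trans _ _ ((Num.max 0 (D - C + 1))%:~R)); first by rewrite ler_int; lia.
case: (leP 0 (D - C + 1)) => _; last by rewrite mulr0z addr_ge0 // mulr_ge0 ?subr_ge0 // ltW.
rewrite intrD intrD intrN /=; lra.
Qed.

Lemma count_frac_ge (q M : nat) (c d : R) : (0 < q)%N -> 0 <= c -> d * q%:R < M%:R ->
  q%:R * (d - c) - 1 <= \sum_(0 <= p < M) ((c <= p%:R / q%:R) && (p%:R / q%:R <= d))%:R :> R.
Proof.
move=> q0 c0 dM; rewrite count_fracE //.
have q0' : 0 < q%:R :> R by rewrite ltr0n.
have h1 := floorD1_gt (d * q%:R); have h2 := ceilB1_lt (c * q%:R).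
have h3 : Num.floor (d * q%:R) < M%:Z by rewrite floor_lt_int.
have h4 : 0 <= Num.ceil (c * q%:R) by rewrite ceil_ge0 // (lt_le_trans (ltrN10 R)) // mulr_ge0 // ltW.
set D := Num.floor _ in h1 h3 *; set C := Num.ceil _ in h2 h4 *.
apply: (@le_trans _ _ ((D - C + 1)%:~R)); last by rewrite ler_int; lia.
rewrite !intrD !intrN /= in h1 h2 *; lra.
Qed.

Lemma sum_id_le (Q : nat) : \sum_(1 <= q < Q.+1) q%:R <= Q%:R ^+ 2 :> R.
Proof.
elim: Q => [|Q IH]; first by rewrite big_geq // expr0n.
rewrite big_nat_recr //= -natr1; have Q0 : 0 <= Q%:R :> R by rewrite ler0n.
by move: IH; set S := \sum_(_ <= _ < _) _; set x := Q%:R in Q0 *; nra.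
Qed.

Lemma sum_sqr_le (Q : nat) : \sum_(1 <= q < Q.+1) q%:R ^+ 2 <= Q%:R ^+ 3 / 3 + Q%:R ^+ 2 :> R.
Proof.
elim: Q => [|Q IH]; first by rewrite big_geq // !expr0n /= mul0r addr0.
rewrite big_nat_recr //= -natr1; have Q0 : 0 <= Q%:R :> R by rewrite ler0n.
by move: IH; set S := \sum_(_ <= _ < _) _; set x := Q%:R in Q0 *; nra.
Qed.

Lemma sum_sqr_ge (Q : nat) : Q%:R ^+ 3 / 3 <= \sum_(1 <= q < Q.+1) q%:R ^+ 2 :> R.
Proof.
elim: Q => [|Q IH]; first by rewrite big_geq // !expr0n /= mul0r.
rewrite big_nat_recr //= -natr1; have Q0 : 0 <= Q%:R :> R by rewrite ler0n.
by move: IH; set S := \sum_(_ <= _ < _) _; set x := Q%:R in Q0 *; nra.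
Qed.

Definition in_strip (c d : R) (z : nat * nat) : bool := (c <= slope z) && (slope z <= d).

Lemma sum_strip_le Q M (c d : R) (F : nat -> R) : c <= d -> (forall q, 0 <= F q) ->
  \sum_(z <- pairs Q M | in_strip c d z) F z.1 <=
  \sum_(1 <= q < Q.+1) F q * (q%:R * (d - c) + 1).
Proof.
move=> cd F0; rewrite big_pairs; apply: ler_sum_nat => q /andP[q1 _].
rewrite big_mkcond /=.
rewrite (eq_bigr (fun p => F q * ((c <= p%:R / q%:R) && (p%:R / q%:R <= d))%:R)); last first.
  by move=> p _; rewrite /in_strip /slope /=; case: ifP; rewrite ?mulr1 ?mulr0.
by rewrite -mulr_sumr ler_wpM2l // count_frac_le.
Qed.

Lemma count_strip_le Q M (c d : R) : c <= d ->
  \sum_(z <- pairs Q M) (in_strip c d z)%:R <= Q%:R ^+ 2 * (d - c) + Q%:R :> R.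
Proof.
move=> cd.
rewrite (eq_bigr (fun z => if in_strip c d z then 1 else 0 : R)); last first.
  by move=> z _; case: (in_strip c d z).
rewrite -big_mkcond /=; apply: (le_trans (sum_strip_le Q M (F := fun _ => 1) cd _)) => //.
under eq_bigr do rewrite mul1r.
rewrite big_split /= -mulr_suml big_const_nat subSS subn0 iter_addr_0.
by rewrite lerD // ler_wpM2r ?subr_ge0 // sum_id_le.
Qed.

Lemma sum_multiples (k m : nat) (g : nat -> R) : (0 < k)%N ->
  \sum_(0 <= p < k * m | (k %| p)%N) g p = \sum_(0 <= a < m) g (k * a)%N.
Proof.
move=> k0; elim: m => [|m IH]; first by rewrite muln0 !big_geq.
rewrite big_nat_recr //= -IH mulnS addnC.
rewrite (big_cat_nat _ _ (n := (k * m)%N)) //= ?leq_addr //; congr (_ + _).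
have lt : (k * m < k * m + k)%N by lia.
rewrite big_ltn_cond // dvdn_mulr //.
rewrite big_nat_cond big1 ?addr0 // => p /andP[/andP[p1 p2] /dvdnP[j pj]].
by move: p1 p2; rewrite pj [(j * k)%N]mulnC ltn_pmul2l // -mulnSr ltn_pmul2l //; lia.
Qed.

Lemma sum_multiples_le (k M : nat) (g : nat -> R) : (0 < k)%N -> (forall p, 0 <= g p) ->
  \sum_(0 <= p < M | (k %| p)%N) g p <= \sum_(0 <= a < M) g (k * a)%N.
Proof.
move=> k0 g0; rewrite -sum_multiples //.
(* The range of [p] is extended from [M] to [k * M], where the multiples of [k] are enumerated
   exactly. *)
rewrite [leRHS](big_cat_nat _ _ (n := M)) //= ?leq_pmull //.
by rewrite lerDl sumr_ge0.
Qed.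

Lemma count_dvd_le (b Q : nat) : (0 < b)%N ->
  \sum_(1 <= q < Q.+1) (b %| q)%N%:R <= Q%:R / b%:R :> R.
Proof.
move=> b0; rewrite -natr_sum -divn_count_dvd ler_pdivlMr ?ltr0n //.
by rewrite -natrM ler_nat leq_divM.
Qed.

(** The numerator [p * q' - p' * q] of the difference is a nonzero integer, and the denominator
    [q * q'] is at most [Q ^+ 2]. *)
Lemma frac_sep Q M z z' : z \in pairs Q M -> z' \in pairs Q M -> slope z != slope z' ->
  (Q%:R ^+ 2)^-1 <= `|slope z - slope z'|.
Proof.
case: z z' => [q p] [q' p'] /pairsP /= [/andP[q1 qQ] _] /pairsP /= [/andP[q1' qQ'] _].
rewrite /slope /= => ne.
have q0 : 0 < q%:R :> R by rewrite ltr0n.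
have q0' : 0 < q'%:R :> R by rewrite ltr0n.
have E : p%:R / q%:R - p'%:R / q'%:R = (p%:Z * q'%:Z - p'%:Z * q%:Z)%:~R / (q%:R * q'%:R) :> R.
  rewrite intrD intrN !intrM /=; field; by rewrite !gt_eqF.
rewrite -subr_eq0 E in ne; rewrite E normrM normfV (ger0_norm (_ : 0 <= q%:R * q'%:R)); last first.
  by rewrite mulr_ge0 // ltW.
have nz : 1 <= `|(p%:Z * q'%:Z - p'%:Z * q%:Z)%:~R| :> R.
  rewrite -intr_norm (ler_int R 1) -gtz0_ge1 normr_gt0.
  by apply: contra_neq ne => ->; rewrite mul0r.
have hv : 0 <= (Q%:R ^+ 2)^-1 :> R by rewrite invr_ge0 sqr_ge0.
rewrite -[leLHS]mul1r; apply: ler_pM => //.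
have Q0 : 0 < Q%:R :> R by rewrite ltr0n; lia.
rewrite lef_pV2 ?posrE ?mulr_gt0 ?exprn_gt0 //.
by rewrite expr2; apply: ler_pM; rewrite ?ler_nat // ltW.
Qed.

(* [z.1 / gcd (z.1, z.2)] is the denominator of [slope z] in lowest terms. *)
Definition low_denominator (x : R) (z : nat * nat) : bool :=
  z.1%:R <= x * (gcdn z.1 z.2)%:R.

(* Sum over the reduced denominators [b <= x]; those [q] are multiples of [b]. *)
Lemma sum_low_denominator_le Q M (c d x : R) : c <= d -> 0 <= x -> (0 < M)%N ->
  \sum_(z <- pairs Q M | in_strip c d z && low_denominator x z) z.1%:R <=
  (d - c + 1) * Q%:R ^+ 2 * x.
Proof.
move=> cd x0 M0.
pose N := Num.truncn x.
(* The pair [z] is charged to every [b] for which [slope z] can be written with denominator [b]; its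
   reduced denominator is among them, so each low pair is covered. *)
pose t b z : R := if [&& (b %| z.1)%N, (z.1 %/ b %| z.2)%N & in_strip c d z] then z.1%:R else 0.
have step z : z \in pairs Q M -> in_strip c d z && low_denominator x z ->
    z.1%:R <= \sum_(1 <= b < N.+1) t b z.
  case: z => q p /pairsP /= [/andP[q1 _] _] /andP[zs]; rewrite /low_denominator /= => lq.
  have g0 : (0 < gcdn q p)%N by rewrite gcdn_gt0 q1.
  pose b := (q %/ gcdn q p)%N.
  have qb : (b * gcdn q p = q)%N by rewrite divnK // dvdn_gcdl.
  have b0 : (0 < b)%N by move: q1; rewrite -qb; case: (b).
  have bN : (b < N.+1)%N.
    rewrite ltnS /N truncn_ge_nat // -(ler_pM2r (_ : 0 < (gcdn q p)%:R)) ?ltr0n //.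
    by rewrite -natrM qb.
  rewrite (big_cat_nat (n := b)) //= ?(ltnW bN) // (big_ltn bN).
  have -> : t b (q, p) = q%:R.
    rewrite /t /= zs andbT /b dvdn_div // ?dvdn_gcdl //.
    have -> : (q %/ (q %/ gcdn q p) = gcdn q p)%N by rewrite divnA ?dvdn_gcdl // mulKn.
    by rewrite dvdn_gcdr.
  rewrite addrCA lerDl addr_ge0 //; apply: sumr_ge0 => j _; rewrite /t; by case: ifP.
rewrite big_seq_cond.
apply: (@le_trans _ _ (\sum_(z <- pairs Q M | (z \in pairs Q M) && (in_strip c d z && low_denominator x z))
   \sum_(1 <= b < N.+1) t b z)).
  by apply: ler_sum => z /andP[zP zs]; exact: step.
rewrite -big_seq_cond.
have t0 b z : 0 <= t b z by rewrite /t; case: ifP.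
apply: (@le_trans _ _ (\sum_(z <- pairs Q M) \sum_(1 <= b < N.+1) t b z)).
  rewrite big_mkcond /=; apply: ler_sum => z _; case: ifP => // _.
  by apply: sumr_ge0.
rewrite exchange_big /=.
(* With [q = k * b] and [p = k * a] the slope is [a / b]. There are at most [Q / b] values of [q],
   each of weight at most [Q], and [b * (d - c) + 1] values of [a]; the product is
   [Q ^+ 2 * (d - c + 1 / b)]. *)
have tb b : (0 < b)%N -> \sum_(z <- pairs Q M) t b z <= (d - c + 1) * Q%:R ^+ 2.
  move=> b0; rewrite (big_pairs Q M predT).
  apply: (@le_trans _ _ (\sum_(1 <= q < Q.+1) (b %| q)%N%:R * (Q%:R * (b%:R * (d - c) + 1)))).
    apply: ler_sum_nat => q /andP[q1 qQ].
    case: (boolP (b %| q)%N) => bq; last first.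
      rewrite mul0r big1 // => p _; by rewrite /t /= (negbTE bq).
    rewrite mul1r; pose k := (q %/ b)%N.
    have qk : (k * b = q)%N by rewrite divnK.
    have k0 : (0 < k)%N by move: q1; rewrite -qk; case: (k).
    rewrite (eq_bigr (fun p => if (k %| p)%N then
        (q%:R * (in_strip c d (q, p))%:R) else 0)); last first.
      move=> p _; rewrite /t /= bq /= -/k; case: (k %| p)%N => //=.
      by case: in_strip; rewrite ?mulr1 ?mulr0.
    rewrite -big_mkcond /=; apply: (le_trans (sum_multiples_le M k0 (g := fun p => q%:R * (in_strip c d (q, p))%:R) _)).
      by move=> p; rewrite mulr_ge0.
    rewrite -mulr_sumr; apply: ler_pM => //.
    - by apply: sumr_ge0.
    - by rewrite ler_nat -ltnS.
    rewrite (eq_bigr (fun p => ((c <= p%:R / b%:R) && (p%:R / b%:R <= d))%:R)).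
      exact: count_frac_le.
    move=> p _; rewrite /in_strip /slope /= -qk !natrM.
    rewrite (_ : k%:R * p%:R / (k%:R * b%:R) = p%:R / b%:R :> R) //.
    by rewrite -mulf_div divff ?mul1r // pnatr_eq0 -lt0n.
  rewrite -mulr_suml; apply: (@le_trans _ _ (Q%:R / b%:R * (Q%:R * (b%:R * (d - c) + 1)))).
    apply: ler_wpM2r (count_dvd_le Q b0).
    by rewrite mulr_ge0 // addr_ge0 // mulr_ge0 ?subr_ge0.
  have b1 : 1 <= b%:R :> R by rewrite (ler_nat R 1).
  have bb : b%:R^-1 <= 1 :> R by rewrite invf_le1 // (lt_le_trans ltr01).
  rewrite [leLHS](_ : _ = Q%:R ^+ 2 * (d - c + b%:R^-1)); last first.
    by field; rewrite gt_eqF // (lt_le_trans ltr01).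
  rewrite mulrC ler_wpM2r ?sqr_ge0 // lerD2l //.
apply: (@le_trans _ _ (\sum_(1 <= b < N.+1) ((d - c + 1) * Q%:R ^+ 2))).
  by apply: ler_sum_nat => b /andP[b1 _]; exact: tb.
rewrite big_const_nat subSS subn0 iter_addr_0 -[_ *+ N]mulr_natr ler_wpM2l //.
  by rewrite mulr_ge0 ?sqr_ge0 // addr_ge0 ?subr_ge0.
by have /andP[] := truncn_itv x0.
Qed.

(** A pair with the same slope has a first entry divisible by the reduced denominator [b], and that
    entry determines the pair; there are at most [Q / b] such entries, and [b] exceeds [x * Q]. *)
Lemma count_same_frac_le Q M (x : R) z : 0 < x -> z \in pairs Q M ->
  ~~ low_denominator (x * Q%:R) z ->
  \sum_(z' <- pairs Q M) (slope z == slope z')%:R <= x^-1 :> R.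
Proof.
case: z => q p x0 /pairsP /= [/andP[q1 qQ] _].
rewrite /low_denominator /= -ltNge => lq.
have g0 : (0 < gcdn q p)%N by rewrite gcdn_gt0 q1.
pose b := (q %/ gcdn q p)%N.
have qb : (b * gcdn q p = q)%N by rewrite divnK // dvdn_gcdl.
have b0 : (0 < b)%N by move: q1; rewrite -qb; case: (b).
have xb : x * Q%:R < b%:R.
  have E : q%:R = b%:R * (gcdn q p)%:R :> R by rewrite -natrM qb.
  by move: lq; rewrite E ltr_pM2r // ltr0n.
rewrite (big_pairs Q M predT).
apply: (@le_trans _ _ (\sum_(1 <= q' < Q.+1) (b %| q')%N%:R)); last first.
  apply: (le_trans (count_dvd_le Q b0)); rewrite ler_pdivrMr ?ltr0n //.
  by rewrite -ler_pdivrMl ?invr_gt0 // invrK ltW.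
apply: ler_sum_nat => q' /andP[q'1 _].
case: (boolP (b %| q')%N) => bq'.
  (* At most one [p'] goes with a given [q']: this is the count of fractions in an interval reduced
     to a point. *)
  apply: (@le_trans _ _ (q'%:R * (slope (q, p) - slope (q, p)) + 1)); last first.
    by rewrite subrr mulr0 add0r.
  apply: le_trans (count_frac_le M (q := q') q'1 (lexx _)).
  apply: ler_sum_nat => p' _; rewrite ler_nat /slope /=.
  by case: eqP => // ->; rewrite !lexx.
rewrite big1_seq // => p' _; case: eqP => //; rewrite /slope /= => E; case/negP: bq'.
have q0 : q%:R != 0 :> R by rewrite pnatr_eq0 -lt0n.
have q0' : q'%:R != 0 :> R by rewrite pnatr_eq0 -lt0n.
have /eqP : p%:R * q'%:R = p'%:R * q%:R :> R.
  by rewrite -[p%:R](divfK q0) E mulrAC divfK.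
rewrite -!natrM eqr_nat => /eqP E2.
have : (b %| (p %/ gcdn q p) * q')%N.
  rewrite -(dvdn_pmul2r g0) mulnAC divnK ?dvdn_gcdr // qb E2.
  exact: dvdn_mull.
rewrite Gauss_dvdr // /coprime /b -(eqn_pmul2r g0) muln_gcdl mul1n.
by rewrite !divnK ?dvdn_gcdl ?dvdn_gcdr.
Qed.

End fractions.

(** * Sampled bounds for the number of near points *)

Lemma near_window (R : realFieldType) (T1 T2 e t u : R) :
  0 < T1 -> T1 <= t -> t <= T2 -> - e < t - u -> t - u < e ->
  [/\ - e < u, u < T2 + e, (T1 - e <= u) && (u <= T2 + e) &
      (Num.max (u - e) T1 <= t) && (t <= Num.max (u - e) T1 + 2 * e)].
Proof.
move=> T10 t1 t2 tu1 tu2; split; [lra|lra|apply/andP; split; lra|].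
by rewrite -lerBlDr ge_max le_max t1 andbT; apply/andP; split; [|apply/orP; left]; lra.
Qed.

Lemma half_width_le (R : realFieldType) (e q N : R) :
  0 < e -> q <= N -> 2 * e * N <= 1 -> e * q <= 2^-1.
Proof. by move=> e0 qN h; have := ler_wpM2l (ltW e0) qN; lra. Qed.

Lemma width_le1 (R : realFieldType) (e N : R) : 0 < e -> 1 <= N -> 2 * e * N <= 1 -> e <= 1.
Proof. by move=> e0 N1 h; nra. Qed.

Lemma gtN1_of_half (R : realFieldType) (x y : R) : x <= 2^-1 -> - x < y -> -1 < y.
Proof. lra. Qed.

Lemma shift_ball (R : realFieldType) (F Y e : R) : - e < F - Y -> F - Y < e ->
  F < Y + e /\ Y - e < F.
Proof. by move=> h1 h2; split; lra. Qed.

Section sampled_counts.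
Context {R : realType} {d : measure_display} {Omega : measurableType d}.
Variable P : probability Omega R.
Variable B : R -> {RV P >-> R}.

(** Triples [(p, q, r)] consist of integers, fractions are pairs [(q, p)] of naturals. The absolute
    values convert between them, faithfully on [triples], where [p] and [q] are nonnegative. *)
Definition hits (cond : pred (nat * nat)) (lo hi : nat * nat -> R) (x : int * int * int) : bool :=
  let z := (`|x.1.2|%N, `|x.1.1|%N) in
  [&& cond z, lo z < x.2%:~R / z.1%:R & x.2%:~R / z.1%:R < hi z].

Lemma count_hits Q M K cond lo hi :
  (count (hits cond lo hi) (triples Q M K))%:R =
  \sum_(z <- pairs Q M | cond z) npoints K z.1%:R (lo z) (hi z) :> R.
Proof.
rewrite count_triples big_pairs; apply: eq_bigr => q _; rewrite [RHS]big_mkcond /=.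
apply: eq_bigr => p _; case: ifP => cz.
  by apply: eq_zsum => r; rewrite /hits /= cz.
by rewrite /zsum big1 // => k _; rewrite /hits /= cz addr0.
Qed.

(* Every [p] with [p / q <= T2 + 1] and [q <= Q] is smaller than [pmax T2 Q]. *)
Definition pmax (T2 : R) (Q : nat) : nat := (Q * (Num.truncn T2).+2)%N.

Lemma pmax_gt T2 Q : 0 < T2 -> (0 < Q)%N -> (T2 + 1) * Q%:R < (pmax T2 Q)%:R.
Proof.
move=> T20 Q0; rewrite /pmax natrM mulrC ltr_pM2l ?ltr0n // -natr1 ltrD2r.
exact: truncnS_gt.
Qed.

(** The clamp at [T1] keeps all windows at times bounded away from 0, hence the Gaussian peaks
    bounded; a near time is at least [T1], so it is still in the clamped window. *)
Definition upper_start (T1 e : R) (z : nat * nat) : R := Num.max (slope z - e) T1.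

(** The index [n] both refines the grid and truncates [r], so every near point is eventually
    counted. The path need only come within [e] of a near point, not hit its height, hence the
    vertical widening by [e]. *)
Definition upper_count (T1 T2 e : R) Q n w : R :=
  \sum_(z <- pairs Q (pmax T2 Q) | in_strip (T1 - e) (T2 + e) z)
     wpoints B n z.1%:R (upper_start T1 e z) (2 * e) n e w.

(** Shrinking the strip by [eta] puts the whole window inside the time interval from [T1] to [T2],
    where hitting the height [r / q] certifies a near point. *)
Definition interior_pair (T1 T2 eta x : R) (z : nat * nat) : bool :=
  in_strip (T1 + eta) (T2 - eta) z && ~~ low_denominator x z.

Definition lower_count (T1 T2 eta x : R) Q K n w : R :=
  \sum_(z <- pairs Q (pmax T2 Q) | interior_pair T1 T2 eta x z)
     wpoints B K z.1%:R (slope z - eta) (2 * eta) n 0 w.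

Section at_path.
Variables (T1 T2 : R) (T10 : 0 < T1) (T12 : T1 < T2).
Variables (delta : nat -> R) (Q : nat) (Q0 : (0 < Q)%N).
Let eta := delta Q / Q%:R.
Hypothesis eta0 : 0 < eta.
Variable w : Omega.
Hypothesis B0 : B 0 w = 0.
Hypothesis cB : {within `[0, +oo[, continuous (fun t => B t w)}.

Let near_pointsE (p q r : int) :
  near_points (fun t => B t w) T1 T2 delta Q (p, q, r) <->
  (1 <= q <= Q%:Z)%R /\
  dist_graph (fun t => B t w) T1 T2 (p%:~R / q%:~R, r%:~R / q%:~R) <= eta.
Proof.
rewrite /near_points /=.
have key : (1 <= q <= Q%:Z)%R -> xi delta Q q%:~R / (2 * q%:~R) = eta.
  move=> /andP[q1 qQ].
  have Qp : 0 < Q%:R :> R by rewrite ltr0n.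
  have q0 : 0 < q%:~R :> R by rewrite ltr0z; lia.
  have qQ' : q%:~R <= Q%:R :> R by rewrite -[Q%:R]/(Q%:Z%:~R) ler_int.
  rewrite /xi min_l; last by rewrite ler_pdivrMr // mul1r.
  by rewrite /eta; field; rewrite !gt_eqF.
by split => -[qI h]; split => //; move: h; rewrite key.
Qed.

(** Sampled values on both sides of [r / q] force, by the intermediate value theorem, a time of the
    window at which the path equals [r / q]; that time is within [eta] of [p / q]. *)
Lemma lower_count_le x K n : (0 < n)%N ->
  ((lower_count T1 T2 eta x Q K n w)%:E <= count_near (fun t => B t w) T1 T2 delta Q)%E.
Proof.
move=> n0; rewrite /lower_count /wpoints -count_hits /count_near.
apply: count_triples_le_counting => y /triplesP[p [q [r [/andP[q1 qQ] pM ->]]]].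
rewrite /hits /= subr0 addr0 => /and3P[/andP[/andP[s1 s2] _] lo hi].
apply/near_pointsE; split; first by lia.
have h0 : 0 < 2 * eta by rewrite mulr_gt0.
set a : R := slope (q, p) - eta in s1 s2 lo hi.
have a1 : T1 <= a by rewrite /a; lra.
have [i li fi] := (grid_min_lt a (2 * eta) n B0 (r%:~R / q%:R)).1 lo.
have [j lj fj] := (grid_max_gt a (2 * eta) n B0 (r%:~R / q%:R)).1 hi.
have tI k : (k <= n)%N -> a + k%:R * (2 * eta / n%:R) \in `[a, a + 2 * eta].
  move=> kn; rewrite in_itv /= lerDl mulr_ge0 //=; last by rewrite divr_ge0 // ltW.
  rewrite lerD2l mulrA ler_pdivrMr ?ltr0n // mulrC ler_wpM2l ?ler_nat // ltW //.
have [u uI fu] := path_ivt cB (le_trans (ltW T10) a1) (tI i li) (tI j lj) fi fj.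
move: uI; rewrite in_itv /= => /andP[u1 u2].
apply: (@dist_graph_le _ _ _ _ _ _ _ u) => //.
- by rewrite in_itv /=; move: s2; rewrite /a in u1 u2 a1 *; move=> s2; apply/andP; split; lra.
- rewrite -[p%:~R / q%:~R]/(slope (q, p)) ler_norml; rewrite /a in u1 u2.
  by apply/andP; split; lra.
Qed.

(* The margin between [eta] and [e] turns the distance bound into strict inequalities, which
   persist at all sufficiently fine sampled times. *)
Lemma count_near_le e : eta < e -> 2 * e * Q%:R <= 1 ->
  (count_near (fun t => B t w) T1 T2 delta Q <=
   limn_einf (fun n => (upper_count T1 T2 e Q n w)%:E))%E.
Proof.
move=> eta_e eQ; have e0 : 0 < e by exact: lt_trans eta_e.
have Qp : 0 < Q%:R :> R by rewrite ltr0n.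
rewrite /count_near /upper_count /wpoints.
rewrite (_ : (fun n => _) = fun n => (count (hits (in_strip (T1 - e) (T2 + e))
    (fun z => bm_inc B 0 (upper_start T1 e z) w -
       grid_min B (upper_start T1 e z) (2 * e / n%:R) n w - e)
    (fun z => bm_inc B 0 (upper_start T1 e z) w +
       grid_max B (upper_start T1 e z) (2 * e / n%:R) n w + e))
    (triples Q (pmax T2 Q) n))%:R%:E); last by apply/funext => n; rewrite count_hits.
apply: counting_le_limn_einf => -[[p q] r] /near_pointsE[/andP[q1 qQ] dg].
have [t [tI tx ty]] := dist_graph_lt (ltW T12) (le_lt_trans dg eta_e).
move: tI; rewrite in_itv /= => /andP[t1 t2].
have q0 : 0 < q%:~R :> R by rewrite ltr0z (lt_le_trans ltr01).
have qQ' : q%:~R <= Q%:R :> R by rewrite -[Q%:R]/(Q%:Z%:~R) ler_int.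
move: tx; rewrite ltr_norml => /andP[tx1 tx2].
have [u1 u2 u3 u4] := near_window T10 t1 t2 tx1 tx2.
have e1 := half_width_le e0 qQ' eQ.
(* [p > - e * q >= - 1 / 2], so the integer [p] is nonnegative and the enumeration may use
   naturals. *)
have p0 : 0 <= p.
  have : -1 < p%:~R :> R.
    by apply: (gtN1_of_half e1); move: u1; rewrite ltr_pdivlMr // mulNr.
  by rewrite -[-1]/((-1)%:~R) ltr_int; clear; lia.
have pM : p < (pmax T2 Q)%:Z.
  rewrite -(ltr_int R); apply: lt_trans (pmax_gt (lt_trans T10 T12) Q0).
  move: u2; rewrite ltr_pdivrMr // => /lt_le_trans; apply.
  have Q1 : 1 <= Q%:R :> R by rewrite (ler_nat R 1).
  have e2 := width_le1 e0 Q1 eQ.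
  apply: ler_pM => //; rewrite ?(ltW q0) ?lerD2l //.
  by rewrite addr_ge0 ?(ltW e0) // ltW // (lt_trans T10).
have [p' pE] : exists p' : nat, p = Posz p' by move: p0; case: (p) => // k _; exists k.
have [q' qE] : exists q' : nat, q = Posz q' by move: q1; case: (q) => // k _; exists k.
subst p q.
set z := (q', p').
set a := upper_start T1 e z.
have tI : t \in `[a, a + 2 * e] by rewrite in_itv.
have a0 : 0 < a by rewrite /a /upper_start lt_max T10 orbT.
have [n1 Hn1] := grid_approx cB a0 (mulr_gt0 (ltr0n R 2) e0) tI ty.
exists (maxn n1 (`|r|.+1)) => n; rewrite geq_max => /andP[n1n rn]; split.
  apply: mem_triples.
  - by apply/andP; split; rewrite -lez_nat.
  - by rewrite -ltz_nat.
  - exact: rn.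
have [i li] := Hn1 n n1n; rewrite ltr_norml => /andP[f1 f2].
have [g1 g2] := shift_ball f1 f2.
rewrite /hits /= -/z -/a; apply/and3P; split.
- exact: u3.
- by rewrite ltrBlDr; apply/(grid_min_lt a (2 * e) n B0); exists i.
- by rewrite -ltrBlDr; apply/(grid_max_gt a (2 * e) n B0); exists i.
Qed.

End at_path.
End sampled_counts.

(** * First and second moments *)

Section finite_sums.
Context {R : realType} {d : measure_display} {Omega : measurableType d}.
Variable P : probability Omega R.

Lemma integral_sumR (I : eqType) (s : seq I) (X : I -> Omega -> R) :
  (forall i, measurable_fun setT (X i)) -> (forall i w, 0 <= X i w) ->
  (\int[P]_w (\sum_(i <- s) X i w)%:E = \sum_(i <- s) \int[P]_w (X i w)%:E)%E.
Proof.
move=> mX X0; rewrite -ge0_integral_sum //.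
- by apply: eq_integral => w _; rewrite sumEFin.
- by move=> i; exact/measurable_EFinP.
- by move=> i w _; rewrite lee_fin.
Qed.

Lemma integral_sumR_le (I : eqType) (s : seq I) (X : I -> Omega -> R) (c : I -> R) :
  (forall i, measurable_fun setT (X i)) -> (forall i w, 0 <= X i w) ->
  (forall i, i \in s -> (\int[P]_w (X i w)%:E <= (c i)%:E)%E) ->
  (\int[P]_w (\sum_(i <- s) X i w)%:E <= (\sum_(i <- s) c i)%:E)%E.
Proof.
move=> mX X0 Xc; rewrite integral_sumR // -sumEFin big_seq [leRHS]big_seq.
exact: lee_sum.
Qed.

Lemma integral_sumR_ge (I : eqType) (s : seq I) (X : I -> Omega -> R) (c : I -> R) :
  (forall i, measurable_fun setT (X i)) -> (forall i w, 0 <= X i w) ->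
  (forall i, i \in s -> ((c i)%:E <= \int[P]_w (X i w)%:E)%E) ->
  ((\sum_(i <- s) c i)%:E <= \int[P]_w (\sum_(i <- s) X i w)%:E)%E.
Proof.
move=> mX X0 Xc; rewrite integral_sumR // -sumEFin big_seq [leRHS]big_seq.
exact: lee_sum.
Qed.

Lemma integral_sqr_sumR_le (I : eqType) (s : seq I) (X : I -> Omega -> R) (c : I -> I -> R) :
  (forall i, measurable_fun setT (X i)) -> (forall i w, 0 <= X i w) ->
  (forall i j, i \in s -> j \in s -> (\int[P]_w (X i w * X j w)%:E <= (c i j)%:E)%E) ->
  (\int[P]_w ((\sum_(i <- s) X i w) ^+ 2)%:E <=
   (\sum_(i <- s) \sum_(j <- s) c i j)%:E)%E.
Proof.
move=> mX X0 Xc.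
rewrite (eq_integral (fun w => (\sum_(i <- s) \sum_(j <- s) X i w * X j w)%:E)); last first.
  move=> w _; congr (_%:E); rewrite expr2 mulr_suml; apply: eq_bigr => i _.
  by rewrite mulr_sumr.
apply: (integral_sumR_le (X := fun i w => \sum_(j <- s) X i w * X j w)).
- by move=> i; apply: measurable_sum => j; exact: measurable_funM.
- by move=> i w; apply: sumr_ge0 => j _; rewrite mulr_ge0.
move=> i si; apply: (integral_sumR_le (X := fun j w => X i w * X j w)).
- by move=> j; exact: measurable_funM.
- by move=> j w; rewrite mulr_ge0.
- by move=> j sj; exact: Xc.
Qed.

Lemma integral_mulR_le (X Y : Omega -> R) (v : R) :
  measurable_fun setT X -> measurable_fun setT Y ->
  (forall w, 0 <= X w) -> (forall w, 0 <= Y w) ->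
  (\int[P]_w (X w ^+ 2)%:E <= v%:E)%E -> (\int[P]_w (Y w ^+ 2)%:E <= v%:E)%E ->
  (\int[P]_w (X w * Y w)%:E <= v%:E)%E.
Proof.
move=> mX mY X0 Y0 hX hY.
apply: (@le_trans _ _ (\int[P]_w ((2^-1)%:E * ((X w ^+ 2)%:E + (Y w ^+ 2)%:E)))%E).
  apply: ge0_le_integral => //.
  - by move=> w _; rewrite lee_fin mulr_ge0.
  - by apply/measurable_EFinP; exact: measurable_funM.
  - apply: emeasurable_funM => //; apply: emeasurable_funD;
      by apply/measurable_EFinP; exact: measurable_funX.
  - move=> w _; rewrite -EFinD -EFinM lee_fin.
    have := sqr_ge0 (X w - Y w); set x := X w; set y := Y w; nra.
have mX2 : measurable_fun setT (fun w => (X w ^+ 2)%:E).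
  by apply/measurable_EFinP; exact: measurable_funX.
have mY2 : measurable_fun setT (fun w => (Y w ^+ 2)%:E).
  by apply/measurable_EFinP; exact: measurable_funX.
rewrite ge0_integralZl //; last 2 first.
- exact: emeasurable_funD.
- by move=> w _; rewrite -EFinD lee_fin addr_ge0 // sqr_ge0.
rewrite ge0_integralD //; last 2 first.
- by move=> w _; rewrite lee_fin sqr_ge0.
- by move=> w _; rewrite lee_fin sqr_ge0.
rewrite [v%:E](_ : _ = (2^-1)%:E * (v%:E + v%:E))%E; last first.
  by rewrite -EFinD -EFinM; congr (_%:E); lra.
by rewrite lee_pmul2l //; exact: leeD.
Qed.

End finite_sums.

Section arithmetic.
Variable R : realFieldType.
Implicit Types (T Q C q e : R).

Lemma upper_term_le T Q C q e : 0 <= C -> 0 <= q -> q <= Q -> 2 * e * Q <= 1 -> 0 < e ->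
  (q + C) * (q * (T + 2 * e) + 1) <= T * q ^+ 2 + (2 + C * T) * q + 2 * C.
Proof.
move=> C0 q0 qQ eQ e0.
have h : q * (2 * e) <= 1 by nra.
have : (q + C) * (q * (2 * e)) <= (q + C) * 1 by rewrite ler_wpM2l // addr_ge0.
nra.
Qed.

Lemma cross_term_le C q q' Q s : 0 <= C -> 0 <= q -> q <= Q -> 0 <= q' -> q' <= Q -> 0 <= s ->
  (q + C) * (q' + s) <= q * q' + C * Q + (Q + C) * s.
Proof. nra. Qed.

Lemma inv_sqrt_le_of_sqr (K : rcfType) (g y : K) : 0 < y -> 1 <= y ^+ 2 * g -> (Num.sqrt g)^-1 <= y.
Proof.
move=> y0 h; have g0 : 0 < g.
  by rewrite -(pmulr_rgt0 _ (_ : 0 < y ^+ 2)) ?exprn_gt0 // (lt_le_trans ltr01).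
rewrite -[leLHS]mul1r ler_pdivrMr ?sqrtr_gt0 //.
rewrite -(ler_pXn2r (_ : 0 < 2)%N) ?nnegrE ?mulr_ge0 ?sqrtr_ge0 // ?(ltW y0) //.
by rewrite expr1n exprMn sqr_sqrtr // ltW.
Qed.

(** Here [t] is the distance of two fractions and [t - 2 * eta], at least [t / 2], the gap between
    their windows. For [t <= eps] the separation of fractions gives [2 * Q]; for [t > eps] the bound
    is [2 / sqrt eps]. *)
Lemma gap_inv_sqrt_le (K : rcfType) (t eta eps Q : K) : 0 < eps -> 0 < Q -> 0 < eta ->
  (Q ^+ 2)^-1 <= t -> 4 * eta < t ->
  (Num.sqrt (t - 2 * eta))^-1 <= 2 * Q * (t <= eps)%R%:R + 2 * (Num.sqrt eps)^-1.
Proof.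
move=> e0 Q0 eta0 tQ t4.
have tt : t / 2 <= t - 2 * eta by lra.
have s0 : 0 <= 2 * (Num.sqrt eps)^-1 by rewrite mulr_ge0 // invr_ge0 sqrtr_ge0.
case: (leP t eps) => h; rewrite ?mulr1 ?mulr0 ?add0r.
  rewrite ler_wpDr // inv_sqrt_le_of_sqr ?mulr_gt0 //.
  have h1 : 1 <= Q ^+ 2 * t by rewrite mulrC -ler_pdivrMr ?exprn_gt0 // mul1r.
  have h2 : 0 <= Q ^+ 2 by rewrite sqr_ge0.
  by have := ler_wpM2l h2 tt; rewrite exprMn; lra.
apply: inv_sqrt_le_of_sqr; first by rewrite mulr_gt0 // invr_gt0 sqrtr_gt0.
rewrite exprMn exprVn sqr_sqrtr ?(ltW e0) // mulrAC ler_pdivlMr // mul1r; lra.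
Qed.

End arithmetic.

Section expected_counts.
Context {R : realType} {d : measure_display} {Omega : measurableType d}.
Variable P : probability Omega R.
Variable B : R -> {RV P >-> R}.
Hypothesis hB : standard_brownian_motion B.
Variables (T1 T2 : R) (T10 : 0 < T1) (T12 : T1 < T2).

Let C1 : R := (Num.sqrt T1)^-1.
Let C1_gt0 : 0 < C1. Proof. by rewrite invr_gt0 sqrtr_gt0. Qed.

Let C1_le a : T1 <= a -> (Num.sqrt a)^-1 <= C1.
Proof.
move=> Ta; rewrite lef_pV2 ?posrE ?sqrtr_gt0 //; last exact: lt_le_trans Ta.
by rewrite ler_wsqrtr.
Qed.

Variables (Q : nat) (Q0 : (0 < Q)%N).
Let Q1 : 1 <= Q%:R :> R. Proof. by rewrite (ler_nat R 1). Qed.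

Lemma sum_upper_le (e : R) M : 0 < e -> 2 * e * Q%:R <= 1 ->
  \sum_(z <- pairs Q M | in_strip (T1 - e) (T2 + e) z) (z.1%:R + C1) <=
  (T2 - T1) * (Q%:R ^+ 3 / 3) + ((T2 - T1) + 2 + C1 * (T2 - T1) + 2 * C1) * Q%:R ^+ 2.
Proof.
move=> e0 eQ; have TT : 0 < T2 - T1 by rewrite subr_gt0.
have cd : T1 - e <= T2 + e.
  by rewrite lerBlDr (le_trans (ltW T12)) // -addrA lerDl addr_ge0 // ltW.
apply: (le_trans (sum_strip_le Q M (F := fun q => q%:R + C1) cd _)).
  by move=> q; rewrite addr_ge0 // ltW.
have -> : T2 + e - (T1 - e) = (T2 - T1) + 2 * e by ring.
set T := T2 - T1 in TT *.
apply: (@le_trans _ _ (\sum_(1 <= q < Q.+1) (T * q%:R ^+ 2 + (2 + C1 * T) * q%:R + 2 * C1))).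
  apply: ler_sum_nat => q /andP[_ qQ].
  by apply: (upper_term_le _ _ _ _ eQ e0); rewrite ?ler_nat ?(ltW C1_gt0).
rewrite !big_split /= -!mulr_sumr big_const_nat subSS subn0 iter_addr_0.
have s1 := @sum_id_le R Q; have s2 := @sum_sqr_le R Q.
rewrite -[_ *+ Q]mulr_natr.
have c2 : 0 <= 2 + C1 * T by rewrite addr_ge0 // mulr_ge0 // ltW.
have QQ : Q%:R <= Q%:R ^+ 2 :> R by rewrite expr2 ler_peMl.
have h1 := ler_wpM2l (ltW TT) s2.
have h2 := ler_wpM2l c2 s1.
have h3 : 2 * C1 * Q%:R <= 2 * C1 * Q%:R ^+ 2 by rewrite ler_wpM2l // mulr_ge0 // ltW.
rewrite [2 * (C1 * _)]mulrA; apply: (le_trans (lerD (lerD h1 h2) h3)).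
rewrite le_eqVlt; apply/orP; left; apply/eqP; ring.
Qed.

Lemma integral_upper_count_le (e : R) n : 0 < e -> 2 * e * Q%:R <= 1 -> (0 < n)%N ->
  (\int[P]_w (upper_count B T1 T2 e Q n w)%:E <=
   (((T2 - T1) * (Q%:R ^+ 3 / 3) + ((T2 - T1) + 2 + C1 * (T2 - T1) + 2 * C1) * Q%:R ^+ 2) *
    (range_cst * Num.sqrt (2 * e) + 2 * e))%:E)%E.
Proof.
move=> e0 eQ n0; have e20 : 0 < 2 * e by rewrite mulr_gt0.
have A0 : 0 <= range_cst * Num.sqrt (2 * e) + 2 * e.
  by rewrite addr_ge0 ?(ltW e20) // mulr_ge0 ?sqrtr_ge0 // ltW // range_cst_gt0.
rewrite /upper_count; under eq_integral do rewrite -big_filter.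
apply: (le_trans (integral_sumR_le (c := fun z => (z.1%:R + C1) * (range_cst * Num.sqrt (2 * e) + 2 * e)) _ _ _)).
- by move=> z; exact: measurable_wpoints.
- by move=> z w; exact: wpoints_ge0.
- move=> [q p]; rewrite mem_filter => /andP[_ /pairsP /= [/andP[q1 _] _]].
  have a1 : T1 <= upper_start T1 e (q, p) by rewrite /upper_start le_max lexx orbT.
  apply: (le_trans (integral_wpoints_le hB (lt_le_trans T10 a1) e20 _ n0 n (ltW e0))).
    by rewrite ltr0n.
  by rewrite lee_fin ler_wpM2r // lerD2l C1_le.
rewrite lee_fin -mulr_suml ler_wpM2r // big_filter; exact: sum_upper_le.
Qed.

Variables (eta eps : R) (eta0 : 0 < eta) (eps0 : 0 < eps).

Let a : R := range_cst * Num.sqrt (2 * eta).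
Let a_ge0 : 0 <= a. Proof. by rewrite mulr_ge0 ?sqrtr_ge0 // ltW // range_cst_gt0. Qed.
Let M := pmax T2 Q.
Let good := [seq z <- pairs Q M | interior_pair T1 T2 eta (eps * Q%:R) z].
(** Bound for the second moment of one count, uniform over the kept fractions. Through
    [2 * x * y <= x ^+ 2 + y ^+ 2] it also bounds every mixed moment, and so serves for equal and
    overlapping windows. *)
Let V : R := (Q%:R + C1) * (a + Q%:R * (128 * (2 * eta))).
Let V_ge0 : 0 <= V.
Proof.
rewrite mulr_ge0 // ?addr_ge0 ?ler0n ?(ltW C1_gt0) // mulr_ge0 // !mulr_ge0 //; exact: ltW.
Qed.

Let X K n z := wpoints B K z.1%:R (slope z - eta) (2 * eta) n 0.

Let lower_countE K n w : lower_count B T1 T2 eta (eps * Q%:R) Q K n w =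
  \sum_(z <- good) X K n z w.
Proof. by rewrite /lower_count big_filter. Qed.

Let goodP z : z \in good -> [/\ z \in pairs Q M, 0 < z.1%:R :> R, z.1%:R <= Q%:R :> R,
  T1 <= slope z - eta & ~~ low_denominator (eps * Q%:R) z].
Proof.
rewrite mem_filter => /andP[/andP[/andP[h1 h2] h3] zP].
have [/andP[q1 qQ] _] := pairsP zP; split => //.
- by rewrite ltr0n.
- by rewrite ler_nat.
- by rewrite lerBrDr.
Qed.

(* Four regimes: far apart, within [eps], equal, and overlapping windows; the latter needs
   [1 <= 4 * eta * Q ^+ 2], as distinct fractions are at least [Q ^- 2] apart. *)
Let pair_bound z z' : R := a ^+ 2 * (z.1%:R * z'.1%:R + C1 * Q%:R) +
  (Q%:R + C1) * a ^+ 2 *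
    (2 * Q%:R * (`|slope z - slope z'| <= eps)%R%:R + 2 * (Num.sqrt eps)^-1) +
  V * (slope z == slope z' :> R)%:R +
  V * ((1 <= 4 * eta * Q%:R ^+ 2)%R%:R * (`|slope z - slope z'| <= 4 * eta)%R%:R).

Let eta20 : 0 < 2 * eta. Proof. by rewrite mulr_gt0. Qed.

Let sqr_le K n z : (0 < n)%N -> z \in good -> (\int[P]_w (X K n z w ^+ 2)%:E <= V%:E)%E.
Proof.
move=> n0 /goodP[_ q0 qQ Ta _].
have a0 := lt_le_trans T10 Ta.
apply: (le_trans (integral_wpoints_sqr_le hB a0 eta20 q0 n0 K)); rewrite lee_fin -/a.
have c0 : 0 <= 128 * (2 * eta) by rewrite mulr_ge0 // ltW.
apply: ler_pM.
- by rewrite addr_ge0 ?(ltW q0) // invr_ge0 sqrtr_ge0.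
- by rewrite addr_ge0 // mulr_ge0 // ltW.
- by apply: lerD => //; exact: C1_le.
- by rewrite lerD2l ler_wpM2r.
Qed.

Let mul_far_le K n z z' : (0 < n)%N -> z \in good -> z' \in good ->
  slope z < slope z' :> R -> 4 * eta < `|slope z - slope z'| ->
  (\int[P]_w (X K n z w * X K n z' w)%:E <=
   (a ^+ 2 * (z.1%:R * z'.1%:R + C1 * Q%:R) + (Q%:R + C1) * a ^+ 2 *
    (2 * Q%:R * (`|slope z - slope z'| <= eps)%R%:R + 2 * (Num.sqrt eps)^-1))%:E)%E.
Proof.
move=> n0 gz gz' lt far.
have [zP q0 qQ Ta _] := goodP gz; have [zP' q0' qQ' Ta' _] := goodP gz'.
have a0 := lt_le_trans T10 Ta.
have sep := frac_sep zP zP' (negbT (lt_eqF lt)).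
have E : `|slope z - slope z'| = slope z' - slope z :> R.
  by rewrite distrC ger0_norm // subr_ge0 ltW.
have gapE : slope z' - eta - (slope z - eta + 2 * eta) = `|slope z - slope z'| - 2 * eta.
  by rewrite E; ring.
have ab : slope z - eta + 2 * eta < slope z' - eta.
  by rewrite -subr_gt0 gapE subr_gt0; apply: le_lt_trans far; rewrite ler_pM2r //; lra.
apply: (le_trans (integral_wpoints_mul_le hB K a0 eta20 q0 q0' n0 ab)).
rewrite gapE -/a lee_fin.
have Qp : 0 < Q%:R :> R by rewrite ltr0n.
have g := gap_inv_sqrt_le eps0 Qp eta0 sep far.
set s := (Num.sqrt (_ - 2 * eta))^-1 in g *.
have s0 : 0 <= s by rewrite invr_ge0 sqrtr_ge0.
set u := 2 * Q%:R * _ + _ in g *.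
apply: (@le_trans _ _ ((z.1%:R + C1) * (z'.1%:R + s) * a ^+ 2)).
  rewrite ler_wpM2r ?sqr_ge0 // ler_wpM2r // ?addr_ge0 ?(ltW q0') //.
  by rewrite lerD2l C1_le.
rewrite [_ * a ^+ 2]mulrC -mulrA [_ * (a ^+ 2 * u)]mulrCA -mulrDr ler_wpM2l ?sqr_ge0 //.
apply: (le_trans (cross_term_le (ltW C1_gt0) (ltW q0) qQ (ltW q0') qQ' s0)).
by rewrite lerD2l ler_wpM2l // addr_ge0 // ltW.
Qed.

Let mul_le K n z z' : (0 < n)%N -> z \in good -> z' \in good ->
  (\int[P]_w (X K n z w * X K n z' w)%:E <= (pair_bound z z')%:E)%E.
Proof.
move=> n0 gz gz'.
have [zP q0 qQ Ta _] := goodP gz; have [zP' q0' qQ' Ta' _] := goodP gz'.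
have mX y : measurable_fun setT (X K n y) by exact: measurable_wpoints.
have X0 y w : 0 <= X K n y w by exact: wpoints_ge0.
have near := integral_mulR_le (mX z) (mX z') (X0 z) (X0 z')
  (sqr_le K n0 gz) (sqr_le K n0 gz').
have Qp : 0 < Q%:R :> R by rewrite ltr0n.
have c1 : 0 <= a ^+ 2 * (z.1%:R * z'.1%:R + C1 * Q%:R).
  by rewrite mulr_ge0 ?sqr_ge0 // addr_ge0 ?mulr_ge0 // ltW.
have c2 : 0 <= (Q%:R + C1) * a ^+ 2 *
    (2 * Q%:R * (`|slope z - slope z'| <= eps)%R%:R + 2 * (Num.sqrt eps)^-1).
  apply: mulr_ge0; first by rewrite mulr_ge0 ?sqr_ge0 // addr_ge0 // ltW.
  by rewrite addr_ge0 // mulr_ge0 ?invr_ge0 ?sqrtr_ge0 // mulr_ge0.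
rewrite /pair_bound.
have four (x1 x2 x3 x4 v : R) : 0 <= x1 -> 0 <= x2 -> 0 <= x3 -> 0 <= x4 ->
    v <= x1 + x2 \/ v <= x3 \/ v <= x4 -> v <= x1 + x2 + x3 + x4.
  move=> h1 h2 h3 h4 [h|[h|h]]; apply: (le_trans h).
  - by rewrite -addrA lerDl addr_ge0.
  - by rewrite -addrA addrCA lerDl addr_ge0 // addr_ge0.
  - by rewrite lerDr !addr_ge0.
have [E|ne] := eqVneq (slope z : R) (slope z').
  apply: (le_trans near); rewrite lee_fin; apply: (four _ _ _ _ _ c1 c2); [by rewrite mulr_ge0|by rewrite mulr_ge0 // mulr_ge0|]; right; left.
  by rewrite mulr1.
case: (leP (`|slope z - slope z'| : R) (4 * eta)) => [close|far].
  apply: (le_trans near); rewrite lee_fin; apply: (four _ _ _ _ _ c1 c2); [by rewrite mulr_ge0|by rewrite mulr_ge0 // mulr_ge0|]; right; right.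
  have sep := frac_sep zP zP' ne.
  rewrite (_ : (1 <= 4 * eta * Q%:R ^+ 2)%R) ?mulr1 //.
  by rewrite -ler_pdivrMr ?exprn_gt0 // mul1r (le_trans sep).
have h : (\int[P]_w (X K n z w * X K n z' w)%:E <=
   (a ^+ 2 * (z.1%:R * z'.1%:R + C1 * Q%:R) + (Q%:R + C1) * a ^+ 2 *
    (2 * Q%:R * (`|slope z - slope z'| <= eps)%R%:R + 2 * (Num.sqrt eps)^-1))%:E)%E.
  case: (ltgtP (slope z : R) (slope z')) ne => // lt _; first exact: mul_far_le.
  under eq_integral do rewrite mulrC.
  have := mul_far_le K n0 gz' gz lt; rewrite distrC [z'.1%:R * _]mulrC; exact.
apply: (le_trans h); rewrite lee_fin; apply: (four _ _ _ _ _ c1 c2); [by rewrite mulr_ge0|by rewrite mulr_ge0 // mulr_ge0|]; by left.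
Qed.

Let T : R := T2 - T1.
Let T_gt0 : 0 < T. Proof. by rewrite subr_gt0. Qed.
(** [N0] bounds the number of kept fractions, [S1] the sum of their denominators, and [near_eta] the
    contribution of the kept fractions within [4 * eta] of a given one. *)
Let N0 : R := (T + 1) * Q%:R ^+ 2.
Let S1 : R := T * (Q%:R ^+ 3 / 3) + (T + 1) * Q%:R ^+ 2.
Let near_eta : R := (1 <= 4 * eta * Q%:R ^+ 2)%R%:R * (8 * eta * Q%:R ^+ 2 + Q%:R).

Let QQ : Q%:R <= Q%:R ^+ 2 :> R. Proof. by rewrite expr2 ler_peMl. Qed.

Let N0_ge0 : 0 <= N0. Proof. by rewrite mulr_ge0 ?sqr_ge0 // addr_ge0 // ltW. Qed.

Let S1_ge0 : 0 <= S1.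
Proof. by rewrite addr_ge0 // mulr_ge0 ?divr_ge0 ?exprn_ge0 ?(ltW T_gt0). Qed.

Let sum_good_le (f : nat * nat -> R) : (forall z, 0 <= f z) ->
  \sum_(z <- good) f z <= \sum_(z <- pairs Q M) f z.
Proof.
move=> f0; rewrite big_filter big_mkcond; apply: ler_sum => z _; by case: ifP.
Qed.

Let sum_good_strip_le (f : nat * nat -> R) : (forall z, 0 <= f z) ->
  \sum_(z <- good) f z <= \sum_(z <- pairs Q M | in_strip T1 T2 z) f z.
Proof.
move=> f0; rewrite big_filter big_mkcond [leRHS]big_mkcond; apply: ler_sum => z _.
case: ifP => [/andP[/andP[h1 h2] _]|_]; last by case: ifP.
rewrite /in_strip (le_trans _ h1) ?lerDl ?(ltW eta0) // (le_trans h2) //.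
by rewrite gerBl ltW.
Qed.

Let size_good_le : \sum_(z <- good) 1 <= N0.
Proof.
apply: (le_trans (sum_good_strip_le (f := fun=> 1) _)) => //.
apply: (@le_trans _ _ (Q%:R ^+ 2 * T + Q%:R)).
  rewrite big_mkcond /=; apply: le_trans (count_strip_le Q M (ltW T12)).
  by apply: ler_sum => z _; case: in_strip.
by rewrite /N0 mulrDl mul1r [T * _]mulrC lerD2l.
Qed.

Let sum_good_fst_le : \sum_(z <- good) z.1%:R <= S1.
Proof.
apply: (le_trans (sum_good_strip_le (f := fun z => z.1%:R) _)) => //.
apply: (le_trans (sum_strip_le Q M (F := fun q => q%:R) (ltW T12) _)) => //.
rewrite -/T.
apply: (@le_trans _ _ (\sum_(1 <= q < Q.+1) (T * q%:R ^+ 2 + q%:R))).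
  apply: ler_sum_nat => q _; rewrite le_eqVlt; apply/orP; left; apply/eqP; ring.
rewrite big_split /= -mulr_sumr.
apply: (le_trans (lerD (ler_wpM2l (ltW T_gt0) (sum_sqr_le Q)) (sum_id_le Q))).
rewrite /S1 le_eqVlt; apply/orP; left; apply/eqP; ring.
Qed.

Let close_good_le z (t : R) : 0 <= t ->
  \sum_(z' <- good) (`|slope z - slope z'| <= t)%R%:R <= 2 * t * Q%:R ^+ 2 + Q%:R :> R.
Proof.
move=> t0; apply: (le_trans (sum_good_le (f := fun z' => (`|slope z - slope z'| <= t)%R%:R) _)).
  by move=> z'; exact: ler0n.
have h : slope z - t <= slope z + t by rewrite lerD2l (le_trans _ t0) // oppr_le0.
apply: (le_trans _ (le_trans (count_strip_le Q M h) _)).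
  apply: ler_sum => z' _; rewrite ler_nat /in_strip distrC ler_distl.
  by case: (_ && _).
by rewrite (_ : _ - _ = 2 * t) ?[_ * (2 * t)]mulrC //; ring.
Qed.

Let same_good_le z : z \in good ->
  \sum_(z' <- good) (slope z == slope z' :> R)%:R <= eps^-1 :> R.
Proof.
move=> /goodP[zP _ _ _ zl]; apply: (le_trans (sum_good_le _)) => //.
exact: count_same_frac_le zl.
Qed.

Let inner_sum_le z : z \in good -> \sum_(z' <- good) pair_bound z z' <=
  a ^+ 2 * (z.1%:R * S1 + C1 * Q%:R * N0) +
  (Q%:R + C1) * a ^+ 2 * (2 * Q%:R * (2 * eps * Q%:R ^+ 2 + Q%:R) + 2 * (Num.sqrt eps)^-1 * N0) +
  V * eps^-1 + V * near_eta.
Proof.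
move=> gz; rewrite /pair_bound !big_split /= -!mulr_sumr.
have Ca : 0 <= (Q%:R + C1) * a ^+ 2 by rewrite mulr_ge0 ?sqr_ge0 // addr_ge0 // ltW.
have CQ : 0 <= C1 * Q%:R by rewrite mulr_ge0 // ltW.
apply: lerD; [apply: lerD; [apply: lerD|]|].
- rewrite ler_wpM2l ?sqr_ge0 // big_split /= -mulr_sumr lerD //.
    by rewrite ler_wpM2l.
  rewrite (eq_bigr (fun=> C1 * Q%:R * 1)) -?mulr_sumr ?ler_wpM2l // => i _.
  by rewrite mulr1.
- rewrite ler_wpM2l // big_split /= -mulr_sumr lerD //.
    by rewrite ler_wpM2l ?mulr_ge0 // close_good_le // ltW.
  rewrite (eq_bigr (fun=> 2 * (Num.sqrt eps)^-1 * 1)); last by move=> i _; rewrite mulr1.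
  by rewrite -mulr_sumr ler_wpM2l // mulr_ge0 // invr_ge0 sqrtr_ge0.
- by rewrite ler_wpM2l // same_good_le.
- rewrite ler_wpM2l // ler_wpM2l //.
  apply: (le_trans (close_good_le _ _)); first by rewrite mulr_ge0 // ltW.
  by rewrite lerD2r ler_wpM2r ?sqr_ge0 // mulrA ler_wpM2r ?(ltW eta0) // -natrM ler_nat.
Qed.

Lemma integral_lower_count_sqr_le K n : (0 < n)%N ->
  (\int[P]_w (lower_count B T1 T2 eta (eps * Q%:R) Q K n w ^+ 2)%:E <=
  (a ^+ 2 * (S1 ^+ 2 + C1 * Q%:R * N0 ^+ 2) +
   (Q%:R + C1) * a ^+ 2 *
     (2 * Q%:R * (2 * eps * Q%:R ^+ 2 + Q%:R) * N0 + 2 * (Num.sqrt eps)^-1 * N0 ^+ 2) +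
   V * N0 * eps^-1 + V * N0 * near_eta)%:E)%E.
Proof.
move=> n0; under eq_integral do rewrite lower_countE.
apply: (le_trans (integral_sqr_sumR_le (c := pair_bound) _ _ _)).
- by move=> z; exact: measurable_wpoints.
- by move=> z w; exact: wpoints_ge0.
- by move=> z z' gz gz'; exact: mul_le.
rewrite lee_fin; set U := (X in _ <= X).
(* The part of [inner_sum_le] that does not depend on [z]; it is multiplied by the number of kept
   fractions, while the remaining term is proportional to the denominator and sums to
   [a ^+ 2 * S1 ^+ 2]. *)
pose E0 : R := C1 * Q%:R * N0 * a ^+ 2 +
  (Q%:R + C1) * a ^+ 2 * (2 * Q%:R * (2 * eps * Q%:R ^+ 2 + Q%:R) + 2 * (Num.sqrt eps)^-1 * N0) +
  V * eps^-1 + V * near_eta.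
have E00 : 0 <= E0.
  rewrite !addr_ge0 //; last 1 first.
  - by rewrite mulr_ge0 // mulr_ge0 // addr_ge0 // mulr_ge0 ?sqr_ge0 // mulr_ge0 // ltW.
  - by rewrite mulr_ge0 ?sqr_ge0 // mulr_ge0 // mulr_ge0 // ltW.
  - rewrite mulr_ge0 //; first by rewrite mulr_ge0 ?sqr_ge0 // addr_ge0 // ltW.
    rewrite addr_ge0 //; first by rewrite mulr_ge0 // ?mulr_ge0 // addr_ge0 // mulr_ge0 ?sqr_ge0 // mulr_ge0 // ltW.
    by rewrite mulr_ge0 // mulr_ge0 // invr_ge0 sqrtr_ge0.
  - by rewrite mulr_ge0 // invr_ge0 ltW.
apply: (@le_trans _ _ (\sum_(z <- good) (a ^+ 2 * S1 * z.1%:R + E0 * 1))).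
  rewrite big_seq [leRHS]big_seq; apply: ler_sum => z gz.
  apply: (le_trans (inner_sum_le gz)); rewrite le_eqVlt; apply/orP; left; apply/eqP.
  by rewrite /E0; ring.
rewrite big_split /= -!mulr_sumr.
have aS : 0 <= a ^+ 2 * S1 by rewrite mulr_ge0 ?sqr_ge0.
apply: (le_trans (lerD (ler_wpM2l aS sum_good_fst_le) (ler_wpM2l E00 size_good_le))).
by rewrite /U /E0 le_eqVlt; apply/orP; left; apply/eqP; ring.
Qed.

Let sum_good_gap_ge : 2 * eta * Q%:R <= 1 ->
  T * (Q%:R ^+ 3 / 3) - 2 * Q%:R ^+ 2 - (T + 1) * Q%:R ^+ 2 * (eps * Q%:R) - C1 * N0 <=
  \sum_(z <- good) (z.1%:R - C1).
Proof.
move=> etaQ; rewrite big_split /= sumrN.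
have -> : \sum_(z <- good) C1 = C1 * \sum_(z <- good) 1.
  by rewrite mulr_sumr; apply: eq_bigr => z _; rewrite mulr1.
apply: lerB; last by rewrite ler_wpM2l // ltW.
have T20 : 0 < T2 by exact: lt_trans T12.
have M0 : (0 < M)%N by rewrite muln_gt0 Q0.
(* Low reduced denominators are subtracted over the full strip, a superset of the pairs actually
   discarded. *)
apply: (@le_trans _ _ (\sum_(z <- pairs Q M | in_strip (T1 + eta) (T2 - eta) z) z.1%:R -
    \sum_(z <- pairs Q M | in_strip T1 T2 z && low_denominator (eps * Q%:R) z) z.1%:R)).
  apply: lerB; last first.
    by apply: sum_low_denominator_le => //; [exact: ltW|rewrite mulr_ge0 // ltW].
  rewrite big_pairs.
  apply: (@le_trans _ _ (\sum_(1 <= q < Q.+1) (T * q%:R ^+ 2 - 2 * q%:R))).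
    rewrite sumrB -!mulr_sumr; apply: lerB; first by rewrite ler_wpM2l ?(ltW T_gt0) // sum_sqr_ge.
    by rewrite ler_wpM2l // sum_id_le.
  apply: ler_sum_nat => q /andP[q1 qQ].
  have q0 : 0 < q%:R :> R by rewrite ltr0n.
  have qQ' : q%:R <= Q%:R :> R by rewrite ler_nat -ltnS.
  apply: (@le_trans _ _ (q%:R * (q%:R * (T2 - eta - (T1 + eta)) - 1))).
    (* Shrinking the strip costs [2 * eta * q ^+ 2 <= q], rounding costs another [q]: hence the
       coefficient 2. *)
    rewrite -subr_ge0 (_ : _ - _ = q%:R * (1 - 2 * eta * q%:R)); last by rewrite /T; ring.
    rewrite mulr_ge0 ?(ltW q0) // subr_ge0 (le_trans _ etaQ) // ler_wpM2l // ltW //.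
  apply: (le_trans (ler_wpM2l (ltW q0) (@count_frac_ge R q M (T1 + eta) (T2 - eta) q1 _ _))).
  - by rewrite addr_ge0 // ltW.
  - apply: le_lt_trans (pmax_gt T20 Q0); apply: (@le_trans _ _ (T2 * q%:R)).
      by rewrite ler_wpM2r ?(ltW q0) // gerBl ltW.
    by apply: ler_pM => //; [exact: ltW|by rewrite lerDl].
  rewrite mulr_sumr [leRHS]big_mkcond /=; apply: ler_sum => p _.
  by rewrite /in_strip /slope /=; case: ifP; rewrite ?mulr1 ?mulr0.
rewrite lerBlDr big_filter [leLHS]big_mkcond [X in _ <= X + _]big_mkcond [X in _ <= _ + X]big_mkcond -big_split /=.
apply: ler_sum => z _; rewrite /interior_pair.
case: (boolP (in_strip (T1 + eta) _ z)) => [/andP[h1 h2]|_] /=; last first.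
  by rewrite add0r; case: ifP.
rewrite (_ : in_strip T1 T2 z); last first.
  rewrite /in_strip (le_trans _ h1) ?lerDl ?(ltW eta0) // (le_trans h2) //.
  by rewrite gerBl ltW.
by case: low_denominator; rewrite /= ?addr0 ?add0r.
Qed.

Lemma integral_lower_count_ge lam : 0 < lam -> lam < 1 -> 2 * eta * Q%:R <= 1 ->
  C1 <= eps * Q%:R ->
  exists n K, (0 < n)%N /\
  (((1 - lam) * (a * (T * (Q%:R ^+ 3 / 3) - 2 * Q%:R ^+ 2 -
     (T + 1) * Q%:R ^+ 2 * (eps * Q%:R) - C1 * N0)))%:E <=
   \int[P]_w (lower_count B T1 T2 eta (eps * Q%:R) Q K n w)%:E)%E.
Proof.
move=> lam0 lam1 etaQ CQ.
have a0 : 0 < a by rewrite mulr_gt0 ?range_cst_gt0 // sqrtr_gt0.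
(* The number of steps is chosen so that the sampling loss [1 / sqrt n] stays below [lam]. *)
have [n n0 nlam] : exists2 n : nat, (0 < n)%N & (Num.sqrt n%:R)^-1 < lam.
  exists (Num.truncn (lam^-1 ^+ 2)).+1 => //.
  rewrite invf_plt ?posrE ?sqrtr_gt0 ?ltr0n //.
  rewrite -(ltr_pXn2r (_ : 0 < 2)%N) ?nnegrE ?sqrtr_ge0 ?invr_ge0 ?(ltW lam0) //.
  by rewrite sqr_sqrtr ?ler0n // truncnS_gt.
have hz z : z \in good -> exists K0, forall K, (K0 <= K)%N ->
    (((1 - lam) * a * (z.1%:R - C1))%:E < \int[P]_w (X K n z w)%:E)%E.
  move=> /goodP[zP q0 qQ Ta zl].
  have a0' := lt_le_trans T10 Ta.
  (* A kept fraction has a reduced denominator above [eps * Q], hence [q > C1], and the lower bound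
     for its mean is positive. *)
  have Cq : C1 < z.1%:R.
    have [/andP[q1 _] _] := pairsP zP.
    apply: (le_lt_trans CQ); move: zl; rewrite /low_denominator -ltNge; apply: le_lt_trans.
    by rewrite ler_peMr ?(le_trans (ltW C1_gt0)) // (ler_nat R 1) gcdn_gt0 q1.
  have aC := C1_le Ta.
  apply: (integral_wpoints_ge hB a0' eta20 q0 n0); first exact: le_trans (ltW Cq).
  rewrite -/a; apply: (@le_lt_trans _ _ ((1 - lam) * a * (z.1%:R - (Num.sqrt (slope z - eta))^-1))).
    by rewrite ler_wpM2l ?lerD2l ?lerN2 // mulr_ge0 // subr_ge0 ltW.
  rewrite mulrC ltr_pM2l; last by rewrite subr_gt0 (le_lt_trans aC).
  by rewrite mulrC ltr_pM2l // ltrD2l ltrN2.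
have [K hK] : exists K, forall z, z \in good ->
    (((1 - lam) * a * (z.1%:R - C1))%:E <= \int[P]_w (X K n z w)%:E)%E.
  have [f hf] : exists f : nat * nat -> nat, forall z, z \in good -> forall K, (f z <= K)%N ->
      (((1 - lam) * a * (z.1%:R - C1))%:E < \int[P]_w (X K n z w)%:E)%E.
    have /choice[f hf] z : exists K0, z \in good -> forall K, (K0 <= K)%N ->
        (((1 - lam) * a * (z.1%:R - C1))%:E < \int[P]_w (X K n z w)%:E)%E.
      case: (boolP (z \in good)) => [/hz[K0 hK0]|_]; last by exists 0%N.
      by exists K0.
    by exists f.
  (* The truncation required depends on the fraction; the list is finite, so the largest one suits
     all. *)
  exists (\max_(z <- good) f z)%N => z gz; apply/ltW/hf => //.
  exact: leq_bigmax_seq.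
exists n, K; split => //.
under eq_integral do rewrite lower_countE.
apply: le_trans; last first.
  apply: (@integral_sumR_ge _ _ _ P _ good (X K n) (fun z => (1 - lam) * a * (z.1%:R - C1))) => //.
  - by move=> z; exact: measurable_wpoints.
  - by move=> z w; exact: wpoints_ge0.
rewrite lee_fin -mulr_sumr [leLHS]mulrA ler_wpM2l ?mulr_ge0 ?subr_ge0 ?(ltW lam1) //.
exact: sum_good_gap_ge.
Qed.

End expected_counts.

(** * Asymptotics of the moments *)

(* Below [s = sqrt (2 * eta)], [u = 1 / Q] and [y = 1 / (Q ^+ 3 * s)]. *)
Section asymptotics.
Variable R : realFieldType.
Variables (T C Q s u y eps rc : R).
Hypotheses (T0 : 0 < T) (C0 : 0 <= C) (Q1 : 1 <= Q) (s0 : 0 < s) (rc0 : 0 < rc).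
Hypotheses (eps0 : 0 < eps) (eps1 : eps <= 1).
Hypotheses (Qu : Q * u = 1) (ue : u <= eps ^+ 2) (se : s <= eps ^+ 2).

Let u0 : 0 < u. Proof. by rewrite -(pmulr_rgt0 u (lt_le_trans ltr01 Q1)) Qu. Qed.
Let Q0 : 0 < Q. Proof. exact: lt_le_trans ltr01 Q1. Qed.
Let eps2 : eps ^+ 2 <= eps. Proof. by rewrite expr2 ler_piMl // ltW. Qed.
Let u_eps : u <= eps. Proof. exact: le_trans eps2. Qed.
Let s_eps : s <= eps. Proof. exact: le_trans eps2. Qed.
Let T1_0 : 0 <= T + 1. Proof. by rewrite addr_ge0 // ltW. Qed.

Lemma upper_asymptotics (C3 sq : R) : 0 <= C3 -> 0 <= sq -> sq <= (1 + eps) * s ->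
  (T * (Q ^+ 3 / 3) + C3 * Q ^+ 2) * (rc * sq + (1 + eps) * s ^+ 2) <=
  Q ^+ 3 * s * (T / 3 * rc + eps * (T / 3 * (rc + 2) + C3 * (2 * rc + 2))).
Proof.
move=> C30 sq0 sqs.
have E1 : T * (Q ^+ 3 / 3) + C3 * Q ^+ 2 <= Q ^+ 3 * (T / 3 + C3 * eps).
  rewrite (_ : C3 * Q ^+ 2 = Q ^+ 3 * (C3 * u)); last first.
    by rewrite exprS -[in LHS](mulr1 C3) -Qu; ring.
  rewrite (_ : T * _ = Q ^+ 3 * (T / 3)); last by ring.
  by rewrite -mulrDr ler_wpM2l ?exprn_ge0 ?(ltW Q0) // lerD2l ler_wpM2l.
have E2 : rc * sq + (1 + eps) * s ^+ 2 <= s * ((1 + eps) * (rc + eps)).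
  have h1 := ler_wpM2l (ltW rc0) sqs.
  have h2 : (1 + eps) * s * s <= (1 + eps) * s * eps.
    by rewrite ler_wpM2l // mulr_ge0 ?addr_ge0 // ltW.
  by rewrite expr2; lra.
have E3 : (1 + eps) * (rc + eps) <= rc + eps * (rc + 2).
    by rewrite -subr_ge0 (_ : _ - _ = eps - eps ^+ 2) ?subr_ge0 //; ring.
have L0 : 0 <= T * (Q ^+ 3 / 3) + C3 * Q ^+ 2.
  by rewrite addr_ge0 // mulr_ge0 ?divr_ge0 ?exprn_ge0 // ltW.
have R0 : 0 <= rc * sq + (1 + eps) * s ^+ 2.
  by rewrite addr_ge0 ?mulr_ge0 ?sqr_ge0 ?addr_ge0 // ltW.
apply: (le_trans (ler_pM L0 R0 E1 E2)).
rewrite mulrACA ler_wpM2l ?mulr_ge0 ?exprn_ge0 ?(ltW s0) ?(ltW Q0) //.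
have x0 : 0 < T / 3 by rewrite divr_gt0.
have p0 : 0 <= T / 3 + C3 * eps by rewrite addr_ge0 ?(ltW x0) // mulr_ge0 // ltW.
apply: (le_trans (ler_wpM2l p0 E3)); rewrite -subr_ge0.
rewrite (_ : _ - _ = eps * (C3 * ((1 - eps) * (rc + 2)))); last by ring.
apply: mulr_ge0 (ltW eps0) _; apply: mulr_ge0 => //.
by rewrite mulr_ge0 ?subr_ge0 // addr_ge0 // ltW.
Qed.

Lemma lower_asymptotics :
  Q ^+ 3 * s * (T / 3 * rc - eps * (rc * (T / 3 + (2 + (T + 1) + C * (T + 1))))) <=
  (1 - eps) * (rc * s * (T * (Q ^+ 3 / 3) - 2 * Q ^+ 2 -
     (T + 1) * Q ^+ 2 * (eps * Q) - C * ((T + 1) * Q ^+ 2))).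
Proof.
have QQ : Q ^+ 2 = Q ^+ 3 * u by rewrite -[LHS]mulr1 -Qu exprS; ring.
rewrite (_ : _ - C * _ = Q ^+ 3 * (T / 3 - (2 * u + (T + 1) * eps + C * (T + 1) * u))); last first.
  rewrite (_ : (T + 1) * Q ^+ 2 * (eps * Q) = Q ^+ 3 * (T + 1) * eps); last by ring.
  by rewrite QQ; ring.
rewrite (_ : (1 - eps) * _ = Q ^+ 3 * s * (rc *
  ((1 - eps) * (T / 3 - (2 * u + (T + 1) * eps + C * (T + 1) * u))))); last by ring.
rewrite ler_wpM2l ?mulr_ge0 ?exprn_ge0 ?(ltW s0) ?(ltW Q0) //.
rewrite [_ * rc]mulrC [eps * _]mulrCA -mulrBr ler_wpM2l ?(ltW rc0) //.
have c0 : 0 <= C * (T + 1) by rewrite mulr_ge0.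
have h1 : C * (T + 1) * u <= C * (T + 1) * eps by rewrite ler_wpM2l.
have h2 : 0 <= 2 * u + (T + 1) * eps + C * (T + 1) * u.
  by rewrite !addr_ge0 ?mulr_ge0 // ltW.
have h3 := mulr_ge0 (ltW eps0) h2.
have h4 := u_eps; lra.
Qed.

Hypotheses (ye : y <= eps ^+ 2) (yE : Q ^+ 3 * s * y = 1).

Let Q6 : 0 <= Q ^+ 6 * s ^+ 2. Proof. by rewrite mulr_ge0 ?exprn_ge0 // ltW. Qed.
Let QC : Q + C <= Q * (1 + C).
Proof. by rewrite mulrDr mulr1 lerD2l ler_peMl. Qed.

(** [ie] stands for [1 / sqrt eps] and [near] for [near_eta]. The inverse powers of [eps] are paid
    for by the squares in the bounds on [u] and [y]; the growth of [delta Q * Q ^+ 5] enters through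
    [y] only. *)
Lemma second_moment_asymptotics (ie near a N0 V : R) : 0 <= ie -> u * ie <= eps ->
  0 <= near -> near <= 6 * s * Q ^+ 2 ->
  a = rc * s -> N0 = (T + 1) * Q ^+ 2 -> V = (Q + C) * (a + Q * (128 * s ^+ 2)) ->
  a ^+ 2 * ((T * (Q ^+ 3 / 3) + N0) ^+ 2 + C * Q * N0 ^+ 2) +
  (Q + C) * a ^+ 2 * (2 * Q * (2 * eps * Q ^+ 2 + Q) * N0 + 2 * ie * N0 ^+ 2) +
  V * N0 * eps^-1 + V * N0 * near <=
  Q ^+ 6 * s ^+ 2 * ((T / 3 * rc) ^+ 2 + eps * (rc ^+ 2 *
    (2 * (T / 3) * (T + 1) + (T + 1) ^+ 2 + C * (T + 1) ^+ 2 +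
     (1 + C) * (6 * (T + 1) + 2 * (T + 1) ^+ 2)) +
    7 * ((1 + C) * (T + 1) * (rc + 128)))).
Proof.
move=> ie0 uie near0 nears aE' N0E' VE.
have QQ : Q ^+ 2 = Q ^+ 3 * u by rewrite -[LHS]mulr1 -Qu exprS; ring.
have N0E : N0 = Q ^+ 3 * ((T + 1) * u) by rewrite N0E' QQ; ring.
have N00 : 0 <= N0 by rewrite N0E' mulr_ge0 ?sqr_ge0.
have uu : u ^+ 2 <= u.
  by rewrite expr2 ler_piMl ?(ltW u0) // (le_trans u_eps).
have a2 : 0 <= a ^+ 2 by rewrite sqr_ge0.
have C1 : 0 <= 1 + C by rewrite addr_ge0.
have Tsq : 0 <= (T + 1) ^+ 2 by rewrite sqr_ge0.
have aE : a ^+ 2 * Q ^+ 6 = Q ^+ 6 * s ^+ 2 * rc ^+ 2 by rewrite aE'; ring.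
have t1 : (T * (Q ^+ 3 / 3) + N0) ^+ 2 + C * Q * N0 ^+ 2 <=
    Q ^+ 6 * ((T / 3) ^+ 2 + eps * (2 * (T / 3) * (T + 1) + (T + 1) ^+ 2 + C * (T + 1) ^+ 2)).
  rewrite N0E (_ : _ + _ = Q ^+ 6 * ((T / 3) ^+ 2 + (2 * (T / 3) * (T + 1)) * u +
     (T + 1) ^+ 2 * u ^+ 2 + C * (T + 1) ^+ 2 * ((Q * u) * u))); last by ring.
  rewrite Qu mul1r ler_wpM2l ?exprn_ge0 ?(ltW Q0) //.
  have h1 : 2 * (T / 3) * (T + 1) * u <= 2 * (T / 3) * (T + 1) * eps.
    by rewrite ler_wpM2l // mulr_ge0 // mulr_ge0 // divr_ge0 // ltW.
  have h2 : (T + 1) ^+ 2 * u ^+ 2 <= (T + 1) ^+ 2 * eps.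
    by rewrite ler_wpM2l // (le_trans uu).
  have h3 : C * (T + 1) ^+ 2 * u <= C * (T + 1) ^+ 2 * eps by rewrite ler_wpM2l // mulr_ge0.
  lra.
have t2 : (Q + C) * (2 * Q * (2 * eps * Q ^+ 2 + Q) * N0 + 2 * ie * N0 ^+ 2) <=
    Q ^+ 6 * (eps * ((1 + C) * (6 * (T + 1) + 2 * (T + 1) ^+ 2))).
  have b0 : 0 <= 2 * Q * (2 * eps * Q ^+ 2 + Q) * N0 + 2 * ie * N0 ^+ 2.
    rewrite addr_ge0 ?mulr_ge0 ?addr_ge0 ?sqr_ge0 ?mulr_ge0 ?sqr_ge0 //; exact: ltW.
  apply: (le_trans (ler_wpM2r b0 QC)).
  have Q5 : Q ^+ 5 = Q ^+ 6 * u by rewrite -[LHS]mulr1 -Qu !exprS; ring.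
  rewrite N0E' [leLHS](_ : _ = Q ^+ 6 * ((1 + C) * (4 * (T + 1)) * eps) +
     Q ^+ 5 * ((1 + C) * (2 * (T + 1) + 2 * (T + 1) ^+ 2 * ie))); last by ring.
  rewrite Q5 -[Q ^+ 6 * u * _]mulrA -mulrDr ler_wpM2l ?exprn_ge0 ?(ltW Q0) //.
  have h1 : (1 + C) * (2 * (T + 1)) * u <= (1 + C) * (2 * (T + 1)) * eps.
    by rewrite ler_wpM2l // mulr_ge0 // mulr_ge0.
  have h2 : (1 + C) * (2 * (T + 1) ^+ 2) * (u * ie) <= (1 + C) * (2 * (T + 1) ^+ 2) * eps.
    by rewrite ler_wpM2l // mulr_ge0 // mulr_ge0.
  lra.
have V0 : V * N0 <= (1 + C) * (T + 1) * (Q ^+ 3 * (rc * s + Q * (128 * s ^+ 2))).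
  rewrite VE aE'; set v := rc * s + _.
  have v0 : 0 <= v by rewrite addr_ge0 ?mulr_ge0 ?sqr_ge0 // ltW.
  have h := ler_wpM2r (mulr_ge0 v0 N00) QC.
  by rewrite -mulrA (le_trans h) // le_eqVlt; apply/orP; left; apply/eqP; rewrite N0E'; ring.
have W0 : 0 <= (1 + C) * (T + 1) by rewrite mulr_ge0.
have uu2 : u ^+ 2 <= eps ^+ 2 by rewrite (le_trans uu).
(* The diagonal. Relative to [Q ^+ 6 * s ^+ 2] it is of order [(y + u ^+ 2) / eps], hence at most a
   multiple of [eps]. *)
have t3 : V * N0 * eps^-1 <= Q ^+ 6 * s ^+ 2 * (eps * ((1 + C) * (T + 1) * (rc + 128))).
  rewrite ler_pdivrMr //; apply: (le_trans V0).
  rewrite [leRHS](_ : _ = (1 + C) * (T + 1) * (Q ^+ 6 * s ^+ 2 * ((rc + 128) * eps ^+ 2))); last by ring.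
  rewrite ler_wpM2l //.
  rewrite (_ : Q ^+ 3 * _ = Q ^+ 6 * s ^+ 2 * (rc * y + 128 * u ^+ 2)); last first.
    rewrite (_ : Q ^+ 6 * s ^+ 2 * _ = (Q ^+ 3 * s * y) * (Q ^+ 3 * s) * rc +
      (Q * u) ^+ 2 * Q ^+ 4 * s ^+ 2 * 128); last by ring.
    by rewrite yE Qu; ring.
  rewrite ler_wpM2l // [leRHS]mulrDl lerD // ler_wpM2l // ltW //.
have t4 : V * N0 * near <= Q ^+ 6 * s ^+ 2 * (eps * (6 * ((1 + C) * (T + 1) * (rc + 128)))).
  have VN0 : 0 <= V * N0.
    rewrite VE aE' mulr_ge0 // mulr_ge0 // addr_ge0 ?mulr_ge0 ?sqr_ge0 //; exact: ltW.
  apply: (le_trans (ler_pM VN0 near0 V0 nears)).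
  rewrite [leLHS](_ : _ = (1 + C) * (T + 1) *
    (Q ^+ 5 * s ^+ 2 * (6 * rc) + Q ^+ 6 * s ^+ 2 * (6 * 128 * s))); last by ring.
  rewrite [leRHS](_ : _ = (1 + C) * (T + 1) *
    (Q ^+ 6 * s ^+ 2 * (6 * rc * eps + 6 * 128 * eps))); last by ring.
  rewrite ler_wpM2l // (_ : Q ^+ 5 * s ^+ 2 * _ = Q ^+ 6 * s ^+ 2 * (6 * rc * u)); last first.
    by rewrite -[LHS]mulr1 -Qu; ring.
  rewrite -mulrDr ler_wpM2l // lerD // ler_wpM2l // ?mulr_ge0 // ltW //.
have q1 := ler_wpM2l a2 t1; have q2 := ler_wpM2l a2 t2.
rewrite [leRHS]mulrA aE in q1; rewrite [leRHS]mulrA aE in q2.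
have E2 : (Q + C) * a ^+ 2 * (2 * Q * (2 * eps * Q ^+ 2 + Q) * N0 + 2 * ie * N0 ^+ 2) =
  a ^+ 2 * ((Q + C) * (2 * Q * (2 * eps * Q ^+ 2 + Q) * N0 + 2 * ie * N0 ^+ 2)) by ring.
rewrite E2; apply: (le_trans (lerD (lerD (lerD q1 q2) t3) t4)).
by rewrite le_eqVlt; apply/orP; left; apply/eqP; ring.
Qed.

End asymptotics.

(** * Concentration *)

Section concentration.
Context {R : realType} {d : measure_display} {Omega : measurableType d}.
Variable P : probability Omega R.

(** [A] need not be measurable; it is covered by [C] together with a measurable null set. *)
Lemma mu_ext_le_ae (Q : Omega -> Prop) (A C : set Omega) :
  {ae P, forall w, Q w} -> measurable C -> (forall w, Q w -> A w -> C w) ->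
  (mu_ext P A <= P C)%E.
Proof.
move=> [Z [mZ Z0 QZ]] mC AC.
apply: (@le_trans _ _ (mu_ext P (C `|` Z))).
  apply: le_mu_ext => w Aw; have [Qw|nQ] := pselect (Q w); first by left; exact: AC.
  by right; apply: QZ.
rewrite mu_ext_measurable; last exact: measurableU.
have ZZ : (P Z <= 0)%E by rewrite Z0.
by apply: (le_trans (measureU2 P mC mZ)); rewrite -[leRHS]adde0; exact: leeD.
Qed.

(* Markov's and Chebyshev's inequalities for a nonnegative lower bound [g] of [f], without
   forming the difference of extended reals. *)
Lemma markov_gap (A : set Omega) (f : Omega -> \bar R) (g : Omega -> R) (s b c : R) :
  measurable A -> measurable_fun setT g -> (forall w, 0 <= g w) ->
  measurable_fun setT f -> (forall w, (0 <= f w)%E) -> 0 <= s ->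
  {ae P, forall w, ((s * \1_A w + g w)%:E <= f w)%E} ->
  (c%:E <= \int[P]_w (g w)%:E)%E -> (\int[P]_w f w <= b%:E)%E ->
  (s%:E * P A + c%:E <= b%:E)%E.
Proof.
move=> mA mg g0 mf f0 s0 gf hg hf.
have mE : measurable_fun setT (fun w => (\1_A w)%:E : \bar R).
  by apply/measurable_EFinP; exact: measurable_indic.
apply: le_trans hf; apply: (@le_trans _ _ (\int[P]_w (s * \1_A w + g w)%:E)%E).
  under eq_integral do rewrite EFinD EFinM.
  rewrite ge0_integralD //=; last 4 first.
  - by move=> w _; rewrite mule_ge0 ?lee_fin.
  - exact: emeasurable_funM.
  - by move=> w _; rewrite lee_fin.
  - exact/measurable_EFinP.
  by rewrite ge0_integralZl //= ?integral_indic ?setIT // leeD2l.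
apply: ae_ge0_le_integral => //.
- by move=> w _; rewrite lee_fin addr_ge0 // mulr_ge0.
- apply/measurable_EFinP; apply: measurable_funD => //.
  by apply: measurable_funM => //; exact: measurable_indic.
- by move: gf; apply: filterS => w h _.
Qed.

(** With [s = m * t / 2], a deviation of [N] by more than [m * t] forces [U - L >= s] or
    [|L - m| >= s]. The mean of [U - L] is at most [2 * m * beta], so Markov gives [4 * beta / t].
    The mean of [(L - m) ^+ 2] is at most [3 * m ^+ 2 * beta], so Chebyshev gives
    [12 * beta / t ^+ 2]. *)
Lemma concentration (N U : Omega -> \bar R) (L : Omega -> R) (m beta t : R) :
  {ae P, forall w, ((L w)%:E <= N w)%E /\ (N w <= U w)%E} ->
  measurable_fun setT U -> (forall w, (0 <= U w)%E) ->
  measurable_fun setT L -> (forall w, 0 <= L w) -> 0 < m -> 0 < t ->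
  (\int[P]_w U w <= (m * (1 + beta))%:E)%E ->
  ((m * (1 - beta))%:E <= \int[P]_w (L w)%:E)%E ->
  (\int[P]_w (L w ^+ 2)%:E <= (m ^+ 2 * (1 + beta))%:E)%E ->
  (mu_ext P [set w | (t%:E < `|N w * m^-1%:E - 1%:E|)%E] <=
   (4 * beta / t + 12 * beta / t ^+ 2)%:E)%E.
Proof.
move=> LNU mU U0 mL L0 m0 t0 hU hL hL2.
pose s := m * t / 2.
have s0 : 0 < s by rewrite divr_gt0 // mulr_gt0.
pose A1 := [set w | ((L w + s)%:E <= U w)%E].
pose A2 := [set w | s <= `|L w - m|].
have mA1 : measurable A1.
  rewrite -[A1]setTI; apply: measurable_lee => //.
  by apply/measurable_EFinP; exact: measurable_funD.
have mA2 : measurable A2.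
  rewrite -[A2]setTI; apply: measurable_fun_le => //.
  by apply: measurableT_comp => //; exact: measurable_funB.
apply: (le_trans (mu_ext_le_ae LNU (measurableU _ _ mA1 mA2) _)).
  move=> w [LN NU] /=; have [h1|h1] := leP (L w + s)%:E (U w); first by left.
  have [h2|h2] := leP s `|L w - m|; first by right.
  have {}h1 := le_lt_trans NU h1.
  case: (N w) LN h1 => [r| |] //; rewrite lee_fin lte_fin => LN h1.
  rewrite -EFinM -EFinB /= lte_fin ltNge => /negP[].
  have -> : r * m^-1 - 1 = (r - m) / m by rewrite mulrBl divff ?gt_eqF.
  rewrite normrM normfV (gtr0_norm m0) ler_pdivrMr //.
  move: h2; rewrite /s in h1 *; rewrite ltr_norml => /andP[h2 h3].
  by rewrite ler_norml; apply/andP; split; lra.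
apply: (le_trans (measureU2 _ _ _)) => //.
have fA (A : set Omega) : measurable A -> P A = (fine (P A))%:E.
  by move=> mA; rewrite fineK // fin_num_measure.
have p1 := @markov_gap A1 U L s _ _ mA1 mL L0 mU U0 (ltW s0) _ hL hU.
have {}p1 : (s%:E * P A1 + (m * (1 - beta))%:E <= (m * (1 + beta))%:E)%E.
  apply: p1; move: LNU; apply: filterS => w [LN NU].
  rewrite indicE; case: (boolP (w \in A1)) => [|_]; first by rewrite inE mulr1 addrC.
  by rewrite mulr0 add0r (le_trans LN).
have p2 : ((s ^+ 2)%:E * P A2 + (2 * m * (m * (1 - beta)))%:E <=
           (m ^+ 2 * (1 + beta) + m ^+ 2)%:E)%E.
  have mL2 : measurable_fun setT (fun w => (L w ^+ 2)%:E).
    by apply/measurable_EFinP; exact: measurable_funX.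
  apply: (@markov_gap A2 (fun w => ((L w ^+ 2)%:E + (m ^+ 2)%:E)%E) (fun w => 2 * m * L w)) => //.
  - exact: measurable_funM.
  - by move=> w; rewrite mulr_ge0 // mulr_ge0 // ltW.
  - exact: emeasurable_funD.
  - by move=> w; rewrite -EFinD lee_fin addr_ge0 // sqr_ge0.
  - by rewrite sqr_ge0.
  - apply: aeW => w; rewrite -EFinD lee_fin -subr_ge0 indicE.
    case: (boolP (w \in A2)) => [|_] /=; last first.
      by rewrite mulr0 add0r (_ : _ - _ = (L w - m) ^+ 2) ?sqr_ge0 //; ring.
    rewrite inE /A2 /= => h; rewrite mulr1.
    rewrite (_ : _ - _ = (L w - m) ^+ 2 - s ^+ 2); last by ring.
    by rewrite subr_ge0 -[leRHS]real_normK ?num_real // ler_pXn2r ?nnegrE ?(ltW s0).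
  - under eq_integral do rewrite EFinM.
    rewrite ge0_integralZl //=; last 3 first.
    + exact/measurable_EFinP.
    + by move=> w _; rewrite lee_fin.
    + by rewrite lee_fin mulr_ge0 // ltW.
    by rewrite EFinM lee_pmul2l // lte_fin mulr_gt0.
  - rewrite ge0_integralD //=; last 2 first.
    + by move=> w _; rewrite lee_fin sqr_ge0.
    + by move=> w _; rewrite lee_fin sqr_ge0.
    by rewrite EFinD leeD // integral_cst //= probability_setT mule1.
rewrite (fA _ mA1) -EFinM -EFinD lee_fin in p1.
rewrite (fA _ mA2) -EFinM -EFinD lee_fin in p2.
have q1 : (P A1 <= (4 * beta / t)%:E)%E.
  rewrite (fA _ mA1) lee_fin -(ler_pM2l s0) (_ : s * (4 * beta / t) = 2 * m * beta); first by lra.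
  by rewrite /s; field; rewrite gt_eqF.
have q2 : (P A2 <= (12 * beta / t ^+ 2)%:E)%E.
  rewrite (fA _ mA2) lee_fin -(ler_pM2l (_ : 0 < s ^+ 2)) ?exprn_gt0 //.
  rewrite (_ : s ^+ 2 * (12 * beta / t ^+ 2) = 3 * m ^+ 2 * beta); first by lra.
  by rewrite /s; field; rewrite gt_eqF.
by rewrite EFinD; exact: leeD.
Qed.

End concentration.

(** * The dichotomy *)

Lemma limn_einf_le (R : realType) (u : nat -> \bar R) (c : \bar R) n0 :
  (forall n, (n0 <= n)%N -> (u n <= c)%E) -> (limn_einf u <= c)%E.
Proof.
move=> uc; rewrite limn_einf_lim; apply: lime_le; first exact: is_cvg_einfs.
exists n0 => // n /= n0n; apply: le_trans (uc n n0n).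
by apply: ereal_inf_lbound; exists n => /=.
Qed.

Lemma upper_sqrt_le (R : rcfType) (eps s : R) : 0 <= eps -> 0 <= s ->
  Num.sqrt ((1 + eps) * s ^+ 2) <= (1 + eps) * s.
Proof.
move=> e0 s0; have e1 : 0 <= 1 + eps by rewrite addr_ge0.
rewrite -(ler_pXn2r (_ : 0 < 2)%N) ?nnegrE ?sqrtr_ge0 ?mulr_ge0 //.
rewrite sqr_sqrtr ?mulr_ge0 ?sqr_ge0 // exprMn ler_wpM2r ?sqr_ge0 //.
by rewrite expr2 ler_peMl // lerDl.
Qed.

(** When the indicator is nonzero, [1 <= 2 * s * Q], so the isolated [Q] is at most
    [2 * s * Q ^+ 2]; the other term is at most [4 * s * Q ^+ 2]. *)
Lemma near_eta_le (R : realFieldType) (s Q : R) : 0 <= s -> 0 <= Q -> s <= 1 ->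
  (1 <= 2 * s ^+ 2 * Q ^+ 2)%R%:R * (4 * s ^+ 2 * Q ^+ 2 + Q) <= 6 * s * Q ^+ 2.
Proof.
move=> s0 Q0 s1; have ss : s ^+ 2 <= s by rewrite expr2 ler_piMl.
have Q2 : 0 <= Q ^+ 2 by rewrite sqr_ge0.
case: (leP 1 (2 * s ^+ 2 * Q ^+ 2)) => h; last by rewrite mul0r !mulr_ge0.
rewrite mul1r; have h1 := ler_wpM2r Q2 ss.
have sQ : 1 <= 2 * (s * Q).
  rewrite -(ler_pXn2r (_ : 0 < 2)%N) ?nnegrE ?mulr_ge0 // expr1n (le_trans h) //.
  rewrite !exprMn -subr_ge0 (_ : _ - _ = 2 * (s ^+ 2 * Q ^+ 2)); last by ring.
  by rewrite !mulr_ge0 ?sqr_ge0.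
have h2 := ler_wpM2r Q0 sQ; rewrite mul1r in h2.
have E : 2 * (s * Q) * Q = 2 * (s * Q ^+ 2) by ring.
rewrite E in h2; lra.
Qed.

Lemma cvge0_le (R : realType) (f : nat -> \bar R) : (forall n, (0 <= f n)%E) ->
  (forall c : R, 0 < c -> \forall n \near \oo, (f n <= c%:E)%E) ->
  f @ \oo --> 0%E.
Proof.
move=> f0 fc; apply/fine_cvgP; split.
  have := fc 1 ltr01; apply: filterS => n fn.
  by rewrite ge0_fin_numE // (le_lt_trans fn) // ltry.
apply/cvgrPdist_le => c c0; have := fc c c0; apply: filterS => n fn.
rewrite sub0r normrN /= ger0_norm ?fine_ge0 //.
by rewrite -lee_fin fineK // ge0_fin_numE // (le_lt_trans fn) // ltry.
Qed.

Lemma counting_lt1 (R : realType) (U : choiceType) (A : set U) :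
  (counting A < 1 :> \bar R)%E -> (counting A = 0 :> \bar R)%E.
Proof.
rewrite /counting; case: asboolP => // _; rewrite lte_fin.
by rewrite (ltr_nat R _ 1) ltnS leqn0 => /eqP ->.
Qed.

Lemma main_constant (R : realType) (T D Q eta : R) : 0 <= eta -> 0 <= Q -> D = eta * Q ->
  4 / (3 * Num.sqrt pi) * T * Num.sqrt (D * Q ^+ 5) =
  Q ^+ 3 * Num.sqrt (2 * eta) * (T / 3 * range_cst).
Proof.
move=> eta0 Q0 ->.
have -> : eta * Q * Q ^+ 5 = eta * (Q ^+ 3) ^+ 2 by rewrite -exprM -mulrA -exprS.
rewrite [Num.sqrt (eta * _)]sqrtrM // sqrtr_sqr ger0_norm ?exprn_ge0 // /range_cst.
rewrite [Num.sqrt (2 * eta)]sqrtrM // [Num.sqrt (2 * pi)]sqrtrM //.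
have : Num.sqrt pi != 0 :> R by rewrite gt_eqF // sqrtr_gt0 pi_gt0.
have : Num.sqrt 2 != 0 :> R by rewrite gt_eqF // sqrtr_gt0.
move: (Num.sqrt pi) (Num.sqrt 2) (Num.sqrt eta) => a b c.
clear; move=> b0 a0; field; by rewrite a0 b0.
Qed.

Lemma scale_sqrt (R : rcfType) (D Q eta : R) : 0 <= eta -> 0 <= Q -> D = eta * Q ->
  Q ^+ 3 * Num.sqrt (2 * eta) = Num.sqrt 2 * Num.sqrt (D * Q ^+ 5).
Proof.
move=> eta0 Q0 ->.
have -> : eta * Q * Q ^+ 5 = eta * (Q ^+ 3) ^+ 2 by rewrite -exprM -mulrA -exprS.
by rewrite [Num.sqrt (eta * _)]sqrtrM // sqrtr_sqr ger0_norm ?exprn_ge0 // sqrtrM // mulrCA [_ * Q ^+ 3]mulrC; congr (_ * _).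
Qed.

Section relative_error.
Variable R : realFieldType.
Implicit Types (x c eps X A : R).

(** One constant [A] turns the three additive errors into relative ones, as required by
    [concentration]; the summand 1 in it ensures positivity. *)
Lemma relative_bounds x cU cL cS : 0 < x -> 0 <= cU -> 0 <= cL -> 0 <= cS ->
  exists2 A, 0 < A & forall eps X, 0 <= eps -> 0 <= X ->
  [/\ X * (x + eps * cU) <= X * x * (1 + A * eps),
      X * x * (1 - A * eps) <= X * (x - eps * cL) &
      X ^+ 2 * (x ^+ 2 + eps * cS) <= (X * x) ^+ 2 * (1 + A * eps)].
Proof.
move=> x0 U0 L0 S0.
have u0 : 0 <= cU / x by rewrite divr_ge0 // ltW.
have l0 : 0 <= cL / x by rewrite divr_ge0 // ltW.
have s0 : 0 <= cS / x ^+ 2 by rewrite divr_ge0 // sqr_ge0.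
pose A := 1 + cU / x + cL / x + cS / x ^+ 2.
exists A => [|eps X e0 X0].
  by rewrite /A -!addrA ltr_pwDl // !addr_ge0.
have aU : cU <= x * A.
  by rewrite -ler_pdivrMl // [leLHS]mulrC /A; lra.
have aL : cL <= x * A by rewrite -ler_pdivrMl // [leLHS]mulrC /A; lra.
have aS : cS <= x ^+ 2 * A by rewrite -ler_pdivrMl ?exprn_gt0 // [leLHS]mulrC /A; lra.
have gU := ler_wpM2l e0 aU; have gL := ler_wpM2l e0 aL; have gS := ler_wpM2l e0 aS.
split.
- by rewrite -mulrA ler_wpM2l //; lra.
- by rewrite -mulrA ler_wpM2l //; lra.
- by rewrite exprMn -[leRHS]mulrA ler_wpM2l ?sqr_ge0 //; lra.
Qed.

End relative_error.

Section dichotomy.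
Context {R : realType} {d : measure_display} {Omega : measurableType d}.
Variable P : probability Omega R.
Variable B : R -> {RV P >-> R}.
Hypothesis hB : standard_brownian_motion B.
Variables (T1 T2 : R) (T10 : 0 < T1) (T12 : T1 < T2).
Variable delta : nat -> R.
Hypothesis hdelta : forall Q : nat, (0 < Q)%N -> 0 < delta Q < 4^-1.

Definition upper_limit e Q w := limn_einf (fun n => (upper_count B T1 T2 e Q n w)%:E).

Lemma measurable_upper_count e Q n : measurable_fun setT (upper_count B T1 T2 e Q n).
Proof.
rewrite /upper_count; under eq_fun do rewrite -big_filter.
by apply: measurable_sum => z; exact: measurable_wpoints.
Qed.

Lemma measurable_upper_limit e Q : measurable_fun setT (upper_limit e Q).
Proof.
rewrite /upper_limit /limn_einf.
apply: measurableT_comp => //; apply: measurable_fun_limn_esup => n.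
by apply: measurableT_comp => //; apply/measurable_EFinP; exact: measurable_upper_count.
Qed.

Lemma upper_limit_ge0 e Q w : (0 <= upper_limit e Q w)%E.
Proof.
apply: (le_limn_einf (n0 := 0)) => n _; rewrite lee_fin.
by apply: sumr_ge0 => z _; exact: wpoints_ge0.
Qed.

Lemma integral_upper_limit_le e Q c :
  (forall n, (0 < n)%N -> (\int[P]_w (upper_count B T1 T2 e Q n w)%:E <= c%:E)%E) ->
  (\int[P]_w upper_limit e Q w <= c%:E)%E.
Proof.
move=> h; apply: (@le_trans _ _ (limn_einf (fun n => \int[P]_w (upper_count B T1 T2 e Q n w)%:E)%E)).
  apply: fatou => //.
  - by move=> n; apply/measurable_EFinP; exact: measurable_upper_count.
  - by move=> n w _; rewrite lee_fin; apply: sumr_ge0 => z _; exact: wpoints_ge0.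
by apply: (limn_einf_le (n0 := 1)) => n n0; exact: h.
Qed.

Let N Q w : \bar R := count_near (fun t => B t w) T1 T2 delta Q.
Let eta Q : R := delta Q / Q%:R.
Let s Q : R := Num.sqrt (2 * eta Q).
Let C1 : R := (Num.sqrt T1)^-1.
Let T : R := T2 - T1.
Let T_gt0 : 0 < T. Proof. by rewrite subr_gt0. Qed.
Let C1_gt0 : 0 < C1. Proof. by rewrite invr_gt0 sqrtr_gt0. Qed.

Let eta_gt0 Q : (0 < Q)%N -> 0 < eta Q.
Proof. by move=> Q0; have /andP[d0 _] := hdelta Q0; rewrite divr_gt0 ?ltr0n. Qed.

Let s_gt0 Q : (0 < Q)%N -> 0 < s Q.
Proof. by move=> Q0; rewrite sqrtr_gt0 mulr_gt0 ?eta_gt0. Qed.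

Let sqr_s Q : (0 < Q)%N -> s Q ^+ 2 = 2 * eta Q.
Proof. by move=> Q0; rewrite sqr_sqrtr // mulr_ge0 // ltW // eta_gt0. Qed.

(** This form of [delta Q < 1 / 4] leaves room to enlarge [eta] by a factor up to 2 while keeping
    [2 * e * Q <= 1]. *)
Let etaQ Q : (0 < Q)%N -> 4 * eta Q * Q%:R <= 1.
Proof.
move=> Q0; have /andP[_ d1] := hdelta Q0.
rewrite /eta -mulrA divfK ?pnatr_eq0 -?lt0n //; lra.
Qed.

Let good_paths : {ae P, forall w, B 0 w = 0 /\ {within `[0, +oo[, continuous (fun t => B t w)}}.
Proof.
have [h1 _ _ h2] := hB.
by move: h1 h2; apply: filterS2 => w h1 h2; split.
Qed.

Let N_le e Q : (0 < Q)%N -> eta Q < e -> 2 * e * Q%:R <= 1 ->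
  {ae P, forall w, (N Q w <= upper_limit e Q w)%E}.
Proof.
move=> Q0 he eQ; move: good_paths; apply: filterS => w [w0 wc].
by apply: count_near_le => //; exact: eta_gt0.
Qed.

Let C3 : R := T + 2 + C1 * T + 2 * C1.
Let cU : R := T / 3 * (range_cst + 2) + C3 * (2 * range_cst + 2).
Let cL : R := range_cst * (T / 3 + (2 + (T + 1) + C1 * (T + 1))).
Let cS : R := range_cst ^+ 2 * (2 * (T / 3) * (T + 1) + (T + 1) ^+ 2 + C1 * (T + 1) ^+ 2 +
     (1 + C1) * (6 * (T + 1) + 2 * (T + 1) ^+ 2)) +
    7 * ((1 + C1) * (T + 1) * (range_cst + 128)).
Let x : R := T / 3 * range_cst.

Let T_ge0 : 0 <= T. Proof. exact: ltW T_gt0. Qed.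
Let C1_ge0 : 0 <= C1. Proof. exact: ltW C1_gt0. Qed.
Let C3_ge0 : 0 <= C3.
Proof.
exact: addr_ge0 (addr_ge0 (addr_ge0 T_ge0 (ler0n R 2)) (mulr_ge0 C1_ge0 T_ge0))
  (mulr_ge0 (ler0n R 2) C1_ge0).
Qed.

(** The squared smallness of [1 / Q], [s] and [1 / (Q ^+ 3 * s)] absorbs the factors [1 / eps] and
    [1 / sqrt eps] of the second moment, so that every error is a multiple of [eps]. The upper count
    uses the half-width [(1 + eps) * eta]. *)
Let bounds eps Q : (0 < Q)%N -> 0 < eps -> eps < (C1 + 1)^-1 ->
  Q%:R^-1 <= eps ^+ 2 -> s Q <= eps ^+ 2 -> (Q%:R ^+ 3 * s Q)^-1 <= eps ^+ 2 ->
  let X := Q%:R ^+ 3 * s Q in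
  exists U : Omega -> \bar R, exists L : Omega -> R,
  [/\ {ae P, forall w, ((L w)%:E <= N Q w)%E /\ (N Q w <= U w)%E},
      measurable_fun setT U /\ (forall w, (0 <= U w)%E),
      measurable_fun setT L /\ (forall w, 0 <= L w),
      (\int[P]_w U w <= (X * (x + eps * cU))%:E)%E &
      ((X * (x - eps * cL))%:E <= \int[P]_w (L w)%:E)%E /\
      (\int[P]_w (L w ^+ 2)%:E <= (X ^+ 2 * (x ^+ 2 + eps * cS))%:E)%E].
Proof.
move=> Q0 eps0 epsC Qe se Xe X.
have Qp : 0 < Q%:R :> R by rewrite ltr0n.
have Q1 : 1 <= Q%:R :> R by rewrite (ler_nat R 1).
have Qu : Q%:R * Q%:R^-1 = 1 :> R by rewrite divff // gt_eqF.
have h0 := eta_gt0 Q0; have s0 := s_gt0 Q0; have s2 := sqr_s Q0; have eQ := etaQ Q0.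
have eps1 : eps < 1.
  by rewrite (lt_le_trans epsC) // invf_le1 ?lerDr ?ltW // addr_gt0.
have X0 : 0 < X by rewrite mulr_gt0 ?exprn_gt0.
have e0 : 0 < (1 + eps) * eta Q by rewrite mulr_gt0 // addr_gt0.
have eQ2 : 2 * ((1 + eps) * eta Q) * Q%:R <= 1.
  apply: le_trans eQ; rewrite ler_wpM2r ?(ltW Qp) // mulrA ler_wpM2r ?(ltW h0) //; lra.
have eta_e : eta Q < (1 + eps) * eta Q by rewrite ltr_pMl // ltrDl.
(* The bound on [eps] gives [C1 + 1 < 1 / eps], and [1 / Q <= eps ^+ 2] gives
   [1 / eps <= eps * Q]. *)
have CQ : C1 <= eps * Q%:R.
  have h : C1 + 1 < eps^-1 by rewrite invf_pgt ?posrE ?addr_gt0.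
  have h2 : eps^-1 <= eps * Q%:R.
    rewrite -[leLHS]mul1r ler_pdivrMr // mulrAC -expr2.
    by rewrite -ler_pdivrMr // mul1r.
  by rewrite ltW // (lt_le_trans _ h2) // (lt_trans _ h) // ltrDl.
have eta2 : 2 * eta Q * Q%:R <= 1.
  by apply: le_trans eQ; rewrite ler_wpM2r ?(ltW Qp) // ler_wpM2r ?(ltW h0) // ler_nat.
(* The relative sampling loss is also taken equal to [eps]. *)
have [n [K [n0 hL]]] := integral_lower_count_ge hB T10 T12 Q0 h0 eps0 eps0 eps1 eta2 CQ.
have hS := integral_lower_count_sqr_le hB T10 T12 Q0 h0 eps0 K n0.
exists (upper_limit ((1 + eps) * eta Q) Q).
exists (lower_count B T1 T2 (eta Q) (eps * Q%:R) Q K n).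
split.
- have := N_le Q0 eta_e eQ2; move: good_paths.
  apply: filterS2 => w [w0 wc] h; split => //; exact: lower_count_le.
- by split; [exact: measurable_upper_limit|move=> w; exact: upper_limit_ge0].
- split; last by move=> w; apply: sumr_ge0 => z _; exact: wpoints_ge0.
  rewrite /lower_count; under eq_fun do rewrite -big_filter.
  by apply: measurable_sum => z; exact: measurable_wpoints.
- apply: integral_upper_limit_le => m m0.
  apply: (le_trans (integral_upper_count_le hB T10 T12 Q0 e0 eQ2 m0)).
  have E : 2 * ((1 + eps) * eta Q) = (1 + eps) * s Q ^+ 2 by rewrite s2; ring.
  rewrite E lee_fin.
  apply: (upper_asymptotics T_gt0 Q1 s0 range_cst_gt0 eps0 (ltW eps1) Qu Qe se).
  + exact: C3_ge0.
  + exact: sqrtr_ge0.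
  + by apply: upper_sqrt_le; exact: ltW.
split.
- apply: le_trans hL; rewrite lee_fin.
  exact: (lower_asymptotics T_gt0 (ltW C1_gt0) Q1 s0 range_cst_gt0 eps0 (ltW eps1) Qu Qe).
apply: (le_trans hS); rewrite lee_fin.
have -> : X ^+ 2 = Q%:R ^+ 6 * s Q ^+ 2 by rewrite exprMn -exprM.
have e2 : eps ^+ 2 <= eps by rewrite expr2 ler_piMl // ltW.
apply: (second_moment_asymptotics T_gt0 (ltW C1_gt0) Q1 s0 range_cst_gt0 eps0 (ltW eps1) Qu Qe se Xe).
- by rewrite divff // gt_eqF.
- by rewrite invr_ge0 sqrtr_ge0.
- rewrite ler_pdivrMr ?sqrtr_gt0 //; apply: (le_trans Qe).
  rewrite expr2 ler_wpM2l ?(ltW eps0) //.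
  rewrite -(ler_pXn2r (_ : 0 < 2)%N) ?nnegrE ?sqrtr_ge0 ?(ltW eps0) //.
  by rewrite sqr_sqrtr // ltW.
- apply: mulr_ge0 => //; by rewrite addr_ge0 // mulr_ge0 ?sqr_ge0 // mulr_ge0 // ltW.
- have -> : 4 * eta Q = 2 * s Q ^+ 2 by rewrite s2; ring.
  have -> : 8 * eta Q = 4 * s Q ^+ 2 by rewrite s2; ring.
  apply: near_eta_le; [exact: ltW..|].
  by rewrite (le_trans se) // (le_trans e2) // ltW.
- by [].
- by [].
- by rewrite s2.
Qed.

Let constants_ge0 : [/\ 0 <= cU, 0 <= cL & 0 <= cS].
Proof.
have t0 := T_ge0; have c0 := C1_ge0; have r0 : 0 <= range_cst :> R := ltW range_cst_gt0.
have two0 := ler0n R 2; have t30 : 0 <= T / 3 by rewrite divr_ge0.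
have t10 : 0 <= T + 1 by exact: addr_ge0.
have C30 := C3_ge0.
have c10 : 0 <= 1 + C1 by exact: addr_ge0.
split.
- apply: addr_ge0; apply: mulr_ge0 => //; apply: addr_ge0 => //; exact: mulr_ge0.
- apply: mulr_ge0 => //; apply: addr_ge0 => //; apply: addr_ge0; last exact: mulr_ge0.
  exact: addr_ge0.
- apply: addr_ge0; apply: mulr_ge0; rewrite ?sqr_ge0 //.
    apply: addr_ge0; last first.
      by apply: mulr_ge0 => //; apply: addr_ge0; apply: mulr_ge0; rewrite ?sqr_ge0 ?ler0n.
    apply: addr_ge0; last by rewrite mulr_ge0 ?sqr_ge0.
    by apply: addr_ge0; rewrite ?sqr_ge0 // mulr_ge0 // mulr_ge0.
  by apply: mulr_ge0; [exact: mulr_ge0|exact: addr_ge0].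
Qed.

(** Only the order of magnitude matters here, so the half-width is doubled, and [Q ^+ 2 <= Q ^+ 3]
    and [s ^+ 2 <= s] replace the asymptotics; the bound holds for every positive [Q]. *)
Lemma first_moment_bound : exists2 c : R, 0 < c & forall Q : nat, (0 < Q)%N ->
  exists U : Omega -> \bar R,
  [/\ {ae P, forall w, (count_near (fun t => B t w) T1 T2 delta Q <= U w)%E},
      measurable_fun setT U, forall w, (0 <= U w)%E &
      (\int[P]_w U w <= (c * (Q%:R ^+ 3 * Num.sqrt (2 * (delta Q / Q%:R))))%:E)%E].
Proof.
have r0 : 0 < range_cst :> R := range_cst_gt0.
have two0 := ler0n R 2; have t30 : 0 < T / 3 by rewrite divr_gt0.
have C30 := C3_ge0.
exists ((T / 3 + C3) * (2 * (range_cst + 1))).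
  rewrite mulr_gt0 //; first by rewrite ltr_pwDl.
  by rewrite mulr_gt0 // addr_gt0.
move=> Q Q0; have Q1 : 1 <= Q%:R :> R by rewrite (ler_nat R 1).
have Qp : 0 < Q%:R :> R by rewrite ltr0n.
have h0 := eta_gt0 Q0; have s0 := s_gt0 Q0; have s2 := sqr_s Q0; have eQ := etaQ Q0.
have e0 : 0 < 2 * eta Q by rewrite mulr_gt0.
have eQ2 : 2 * (2 * eta Q) * Q%:R <= 1 by rewrite mulrA -natrM.
have eta_e : eta Q < 2 * eta Q by rewrite ltr_pMl // (ltr_nat R 1).
exists (upper_limit (2 * eta Q) Q); split.
- exact: N_le.
- exact: measurable_upper_limit.
- by move=> w; exact: upper_limit_ge0.
apply: integral_upper_limit_le => m m0.
apply: (le_trans (integral_upper_count_le hB T10 T12 Q0 e0 eQ2 m0)).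
rewrite lee_fin -/(eta Q) -/(s Q) -s2.
have s1 : s Q <= 1.
  rewrite -(ler_pXn2r (_ : 0 < 2)%N) ?nnegrE ?(ltW s0) // expr1n s2.
  apply: le_trans eQ; rewrite -[leLHS]mulr1; apply: ler_pM => //; first exact: ltW.
  by rewrite ler_wpM2r ?(ltW h0) // ler_nat.
have sq : Num.sqrt (2 * s Q ^+ 2) <= 2 * s Q.
  rewrite (_ : 2 = 1 + 1 :> R); last by rewrite -(natrD R 1 1).
  by apply: upper_sqrt_le => //; exact: ltW.
have ss : s Q ^+ 2 <= s Q by rewrite expr2 ler_piMl // ltW.
have h1 : range_cst * Num.sqrt (2 * s Q ^+ 2) + 2 * s Q ^+ 2 <= s Q * (2 * (range_cst + 1)).
  rewrite (_ : s Q * _ = range_cst * (2 * s Q) + 2 * s Q); last by ring.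
  by apply: lerD; [rewrite ler_wpM2l // ltW|rewrite ler_wpM2l].
have h2 : T * (Q%:R ^+ 3 / 3) + C3 * Q%:R ^+ 2 <= Q%:R ^+ 3 * (T / 3 + C3).
  rewrite mulrDr (_ : T * _ = Q%:R ^+ 3 * (T / 3)); last by ring.
  rewrite lerD2l mulrC ler_wpM2r // exprS ler_peMl // exprn_ge0 //.
apply: (@le_trans _ _ (Q%:R ^+ 3 * (T / 3 + C3) * (s Q * (2 * (range_cst + 1))))).
  apply: ler_pM => //.
  - by rewrite addr_ge0 ?mulr_ge0 ?divr_ge0 ?exprn_ge0.
  - by rewrite addr_ge0 // mulr_ge0 ?sqrtr_ge0 ?sqr_ge0 // ltW.
by rewrite le_eqVlt; apply/orP; left; apply/eqP; rewrite /s /eta; ring.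
Qed.

Let main (Q : nat) : R :=
  4 / (3 * Num.sqrt pi) * (T2 - T1) * Num.sqrt (delta Q * Q%:R ^+ 5).

Let x_gt0 : 0 < x. Proof. by rewrite mulr_gt0 ?range_cst_gt0 // divr_gt0. Qed.

Let deltaE Q : (0 < Q)%N -> delta Q = eta Q * Q%:R.
Proof. by move=> Q0; rewrite /eta divfK // pnatr_eq0 -lt0n. Qed.

Let mainE Q : (0 < Q)%N -> main Q = Q%:R ^+ 3 * Num.sqrt (2 * eta Q) * x.
Proof.
move=> Q0; apply: main_constant; [exact/ltW/eta_gt0|exact: ler0n|exact: deltaE].
Qed.

Let dev_prob t Q := mu_ext P [set w | (t%:E < `|N Q w * (main Q)^-1%:E - 1%:E|)%E].

Let sqrt_arg_gt0 Q : (0 < Q)%N -> 0 < delta Q * Q%:R ^+ 5.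
Proof. by move=> Q0; have /andP[d0 _] := hdelta Q0; rewrite mulr_gt0 ?exprn_gt0 ?ltr0n. Qed.

Let scaleE Q : (0 < Q)%N -> Q%:R ^+ 3 * Num.sqrt (2 * eta Q) =
  Num.sqrt 2 * Num.sqrt (delta Q * Q%:R ^+ 5).
Proof.
move=> Q0; apply: scale_sqrt; [exact/ltW/eta_gt0|exact: ler0n|exact: deltaE].
Qed.

Let deviation_le : exists2 A : R, 0 < A & forall eps t Q, (0 < Q)%N ->
  0 < eps -> eps < ((Num.sqrt T1)^-1 + 1)^-1 -> 0 < t ->
  Q%:R^-1 <= eps ^+ 2 -> Num.sqrt (2 * eta Q) <= eps ^+ 2 ->
  (Q%:R ^+ 3 * Num.sqrt (2 * eta Q))^-1 <= eps ^+ 2 ->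
  (dev_prob t Q <= (4 * (A * eps) / t + 12 * (A * eps) / t ^+ 2)%:E)%E.
Proof.
have [U0 L0 S0] := constants_ge0.
have [A A0 rel] := relative_bounds x_gt0 U0 L0 S0.
exists A => // eps t Q Q0 e0 eC t0 Qe se Xe.
have [U [L [LNU [mU Ug] [mL Lg] hU [hL hL2]]]] := bounds Q0 e0 eC Qe se Xe.
have X0 : 0 < Q%:R ^+ 3 * Num.sqrt (2 * eta Q).
  by rewrite mulr_gt0 ?exprn_gt0 ?ltr0n // sqrtr_gt0 mulr_gt0 // eta_gt0.
have [rU rL rS] := rel eps _ (ltW e0) (ltW X0).
rewrite /dev_prob mainE //; apply: (concentration LNU mU Ug mL Lg _ t0).
- exact: mulr_gt0.
- by apply: (le_trans hU); rewrite lee_fin.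
- by apply: le_trans hL; rewrite lee_fin.
- by apply: (le_trans hL2); rewrite lee_fin.
Qed.

Let sqrt_growth : ((fun Q : nat => delta Q * Q%:R ^+ 5) @ \oo --> +oo) ->
  forall M : R, \forall Q \near \oo, M <= Num.sqrt (delta Q * Q%:R ^+ 5).
Proof.
move=> /cvgryPge h M; have := h (M ^+ 2); apply: filterS => Q hQ.
by rewrite (le_trans (ler_norm M)) // -sqrtr_sqr ler_wsqrtr.
Qed.

Let eventually_small (e : R) : 0 < e -> \forall Q \near \oo, (0 < Q)%N /\ Q%:R^-1 <= e.
Proof.
move=> e0; exists (Num.truncn e^-1).+1 => // Q /= hQ.
have Q0 : (0 < Q)%N by exact: leq_trans hQ.
split=> //; rewrite invf_ple ?posrE ?ltr0n //.
by rewrite ltW // (lt_le_trans (truncnS_gt _)) // ler_nat.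
Qed.

Lemma ratio_cvg_in_prob : ((fun Q : nat => delta Q * Q%:R ^+ 5) @ \oo --> +oo) ->
  cvg_in_prob P (fun Q w => (N Q w * ((main Q)^-1)%:E)%E) 1.
Proof.
move=> hoo t t0; apply: cvge0_le => [Q|c c0]; first exact: mu_ext_ge0.
have [A A0 dev] := deviation_le.
have C0 : 0 <= (Num.sqrt T1)^-1 by rewrite invr_ge0 sqrtr_ge0.
pose D := 4 / t + 12 / t ^+ 2.
have D0 : 0 < D by rewrite addr_gt0 ?divr_gt0 ?exprn_gt0.
(* The first entry makes the bound [A * D * eps] at most [c]; halving the second gives the strict
   inequality required of [eps]. *)
pose eps := Num.min (c / (A * D)) (((Num.sqrt T1)^-1 + 1)^-1 / 2).
have eps0 : 0 < eps.
  by rewrite lt_min !divr_gt0 ?mulr_gt0 ?invr_gt0 // ltr_wpDl.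
have epsC : eps < ((Num.sqrt T1)^-1 + 1)^-1.
  have z0 : 0 < ((Num.sqrt T1)^-1 + 1)^-1 by rewrite invr_gt0 ltr_wpDl.
  rewrite gt_min; apply/orP; right.
  by rewrite ltr_pdivrMr // ltr_pMr // (ltr_nat R 1).
have eps2 : 0 < eps ^+ 2 by rewrite exprn_gt0.
have e1 := eventually_small eps2.
have e2 := eventually_small (exprn_gt0 2 eps2).
have e3 := sqrt_growth hoo (eps ^+ 2)^-1.
apply: filterS3 e1 e2 e3 => Q [Q0 Q1] [_ Q2] Q3.
apply: (@le_trans _ _ (4 * (A * eps) / t + 12 * (A * eps) / t ^+ 2)%:E).
  apply: dev => //.
  (* [2 * eta Q = 2 * delta Q / Q] is at most [1 / Q], which is at most the fourth power of
     [eps]. *)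
  - rewrite -(ler_pXn2r (_ : 0 < 2)%N) ?nnegrE ?sqrtr_ge0 ?(ltW eps2) //.
    apply: le_trans Q2; rewrite sqr_sqrtr; last exact: mulr_ge0 (ler0n R 2) (ltW (eta_gt0 Q0)).
    have /andP[_ d1] := hdelta Q0.
    by rewrite /eta mulrA ler_pdivrMr ?ltr0n // mulVf ?pnatr_eq0 -?lt0n //; lra.
  - rewrite scaleE // invf_ple ?posrE ?mulr_gt0 ?sqrtr_gt0 ?sqrt_arg_gt0 //.
    apply: (le_trans Q3); rewrite ler_peMl ?sqrtr_ge0 //.
    by rewrite -[leLHS]sqrtr1 ler_wsqrtr // (ler_nat R 1).
rewrite lee_fin (_ : _ + _ = A * D * eps); last by rewrite /D; ring.
rewrite mulrC -ler_pdivlMr ?mulr_gt0 //.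
by rewrite /eps ge_min lexx.
Qed.

(** If [N <= M] while the main term exceeds [2 * |M|], the ratio is below 1/2, an event of small
    probability by the convergence of the ratio. *)
Lemma cvg_in_prob_infinity : ((fun Q : nat => delta Q * Q%:R ^+ 5) @ \oo --> +oo) ->
  cvg_in_prob_pinfty P N.
Proof.
move=> hoo M; apply: cvge0_le => [Q|c c0]; first exact: mu_ext_ge0.
have h2 : 0 < 2^-1 :> R by [].
have /fine_cvgP[fin /cvgrPdist_le/(_ c c0) h] := ratio_cvg_in_prob hoo h2.
pose K := (2 * `|M| + 1) / x.
have g := sqrt_growth hoo K.
have p := eventually_small ltr01.
apply: filterS2 (filterI fin h) (filterI g p) => Q [finQ hQ] [gQ [Q0 _]].
have m0 : 2 * `|M| < main Q.
  rewrite mainE // scaleE //.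
  have s2 : 1 <= Num.sqrt 2 :> R by rewrite -[leLHS]sqrtr1 ler_wsqrtr // (ler_nat R 1).
  have : 2 * `|M| + 1 <= Num.sqrt (delta Q * Q%:R ^+ 5) * x by rewrite -ler_pdivrMr.
  set S := Num.sqrt (delta Q * _) => hS; rewrite -mulrA.
  have Sx : 0 <= S * x by rewrite mulr_ge0 ?sqrtr_ge0 // ltW.
  apply: (@lt_le_trans _ _ (S * x)); last by rewrite ler_peMl.
  by apply: lt_le_trans hS; rewrite ltrDl.
have mp : 0 < main Q by apply: le_lt_trans m0; rewrite mulr_ge0.
apply: (@le_trans _ _ (dev_prob 2^-1 Q)).
  apply: le_mu_ext => w /= NM.
  have N0 : (0 <= N Q w)%E by rewrite /N /count_near /counting; case: ifP; rewrite ?lee_fin ?leey.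
  case: (N Q w) NM N0 => [r| |] //; rewrite !lee_fin => rM r0.
  rewrite -EFinM -EFinB /= lte_fin distrC ger0_norm.
    rewrite ltrBrDr -ltrBrDl ltr_pdivrMr //.
    have := ler_norm M; lra.
  rewrite subr_ge0 ler_pdivrMr // mul1r.
  have := ler_norm M; lra.
have := hQ; rewrite sub0r normrN /= ger0_norm ?fine_ge0 ?mu_ext_ge0 //.
by rewrite -lee_fin fineK.
Qed.

Lemma prob_ge1_le : exists2 c : R, 0 < c & forall Q : nat, (0 < Q)%N ->
  (mu_ext P [set w | (1%:E <= N Q w)%E] <=
   (c * (T2 - T1) * Num.sqrt (delta Q * Q%:R ^+ 5))%:E)%E.
Proof.
have [c c0 hc] := first_moment_bound.
have T0 : 0 < T2 - T1 by rewrite subr_gt0.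
(* The division offsets the factor [T2 - T1] displayed in the bound; the constant depends on [T1]
   and [T2] but not on [Q]. *)
exists (c * Num.sqrt 2 / (T2 - T1)).
  by rewrite divr_gt0 // mulr_gt0 // sqrtr_gt0.
move=> Q Q0; have [U [NU mU U0 hU]] := hc Q Q0.
rewrite divfK ?gt_eqF // -mulrA -scaleE //.
pose A := [set w | (1%:E <= U w)%E].
have mA : measurable A.
  rewrite -[A]setTI; exact: emeasurable_fun_c_infty.
apply: (le_trans (mu_ext_le_ae NU mA _)).
  by move=> w h1 h2; exact: le_trans h1.
(* Markov's inequality at level 1 is [markov_gap] with the zero function as lower bound. *)
have hg : (0%:E <= \int[P]_w (0 : R)%:E)%E by rewrite integral0.
have := @markov_gap _ _ _ P A U (cst 0) 1 _ 0 mA (@measurable_cst _ _ _ _ _ _) (fun=> lexx _) mU U0 ler01 _ hg hU.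
rewrite mul1e adde0; apply.
apply: aeW => w; rewrite mul1r addr0 indicE.
case: (boolP (w \in A)) => [|_]; last exact: U0.
by rewrite inE.
Qed.

(** A counting measure below 1 vanishes, so for every positive [e] the event [N > e] lies in the
    event [N >= 1]. *)
Lemma cvg_in_prob_zero : ((fun Q : nat => delta Q * Q%:R ^+ 5) @ \oo --> 0) ->
  cvg_in_prob P N 0.
Proof.
move=> h0 e e0; apply: cvge0_le => [Q|c c0]; first exact: mu_ext_ge0.
have [C C0 hC] := prob_ge1_le.
have CT : 0 < C * (T2 - T1) by rewrite mulr_gt0 // subr_gt0.
have b0 : 0 < (c / (C * (T2 - T1))) ^+ 2 by rewrite exprn_gt0 // divr_gt0.
have /cvgrPdist_le/(_ _ b0) h := h0.
apply: filterS2 h (eventually_small ltr01) => Q hQ [Q0 _].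
apply: (@le_trans _ _ (mu_ext P [set w | (1%:E <= N Q w)%E])).
  apply: le_mu_ext => w /=; rewrite sube0 leNgt => eN; apply/negP => /counting_lt1 Nw.
  by move: eN; rewrite /N /count_near Nw abse0 lte_fin ltNge (ltW e0).
apply: (le_trans (hC Q Q0)); rewrite lee_fin mulrC -ler_pdivlMr //.
rewrite -[leRHS](ger0_norm (ltW (divr_gt0 c0 CT))) -sqrtr_sqr ler_wsqrtr //.
by apply: le_trans hQ; rewrite sub0r normrN ler_norm.
Qed.

End dichotomy.

Theorem mainTheorem3 (R : realType) (d : measure_display)
    (Omega : measurableType d) (P : probability Omega R)
    (B : R -> {RV P >-> R}) (hB : standard_brownian_motion B)
    (T1 T2 : R) (hT1 : 0 < T1) (hT12 : T1 < T2)
    (delta : nat -> R)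
    (hdelta : forall Q : nat, (0 < Q)%N -> 0 < delta Q < 4^-1)
    (hlimsup : (limn_esup (fun Q => (delta Q)%:E) < (4^-1)%:E)%E) :
  let N (Q : nat) (w : Omega) : \bar R :=
    count_near (fun t => B t w) T1 T2 delta Q in
  let main (Q : nat) : R :=
    4 / (3 * Num.sqrt pi) * (T2 - T1) * Num.sqrt (delta Q * Q%:R ^+ 5) in
  (((fun Q : nat => delta Q * Q%:R ^+ 5) @ \oo --> +oo) ->
     cvg_in_prob P (fun Q w => (N Q w * ((main Q)^-1)%:E)%E) 1 /\
     cvg_in_prob_pinfty P N) /\
  (((fun Q : nat => delta Q * Q%:R ^+ 5) @ \oo --> 0) ->
     (exists2 c : R, 0 < c & forall Q : nat, (0 < Q)%N ->
        (mu_ext P [set w | (1%:E <= N Q w)%E] <=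
         (c * (T2 - T1) * Num.sqrt (delta Q * Q%:R ^+ 5))%:E)%E) /\
     cvg_in_prob P N 0).
Proof.
split=> h; split.
- exact: ratio_cvg_in_prob h.
- exact: cvg_in_prob_infinity h.
- exact: prob_ge1_le.
- exact: cvg_in_prob_zero h.
Qed.
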